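(* Let $s>1$. There exist a sequence $(u_0^n)_{n}$ of nonzero functions in $\bigcap_{r\in\mathbb R}H^r(\mathbb T)$ and a sequence of times $t^{(n)}>0$ such that, for every $r\in\mathbb R$, $$\|u_0^n\|_{H^r}\longrightarrow 0\quad\text{as } n\to\infty,$$ while the solution $u^n$ of $$i\partial_tu^n-|D|u^n=|u^n|^2u^n,\qquad u^n(0,\cdot)=u_0^n,$$ satisfies $$\|u^n(t^{(n)})\|_{H^s}\simeq\|u_0^n\|_{H^s}\left(\log\frac1{\|u_0^n\|_{H^s}}\right)^{2s-1},$$ that is, there are constants $0<A\le B$ independent of $n$ such that, for all sufficiently large $n$, the left-hand side lies between $A$ times and $B$ times the right-hand side.
   Context: $\mathbb T=\mathbb R/2\pi\mathbb Z$. For $u=\sum_{k\in\mathbb Z}u_ke^{ikx}$: $|D|u=\sum_k|k|\,u_ke^{ikx}$ and $\|u\|_{H^r}^2=\sum_k(1+k^2)^r|u_k|^2$. Functions are complex valued. For every $s\ge\frac12$ and $u_0\in H^s(\mathbb T)$, the equation $i\partial_tu-|D|u=|u|^2u$, $u(0)=u_0$, has a unique global solution $u\in C(\mathbb R,H^{1/2}(\mathbb T))$, and it belongs to $C(\mathbb R,H^s(\mathbb T))$; this is the solution meant in the statement. *)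

(* Defs.v *)
(* MathComp-Analysis; the scalars are R[i] (mathcomp-real-closed) over a realType R. *)
From HB Require Import structures.
From mathcomp Require Import all_boot all_order all_algebra.
From mathcomp Require Import complex.
From mathcomp Require Import all_classical all_reals all_analysis.

Set Implicit Arguments.
Unset Strict Implicit.
Unset Printing Implicit Defensive.

Import Order.TTheory GRing.Theory Num.Theory.
Import numFieldNormedType.Exports.

Local Open Scope classical_set_scope.
Local Open Scope complex_scope.
Local Open Scope ring_scope.

Section HalfWave.
Context {R : realType}.
Implicit Types (f : R -> R[i]) (k : int) (r t : R).

Definition torus_ae_eq f g : Prop :=
  {ae (@lebesgue_measure R), forall x, f x = g x}.

Definition cmeasurable f : Prop :=
  measurable_fun setT (fun x => complex.Re (f x)) /\
  measurable_fun setT (fun x => complex.Im (f x)).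

Definition torus_integral f : R[i] :=
  (\int[@lebesgue_measure R]_(x in `[0, pi *+ 2]) complex.Re (f x)) +i*
  (\int[@lebesgue_measure R]_(x in `[0, pi *+ 2]) complex.Im (f x)).

(* L^2(T): representatives are 2pi-periodic functions on the line. *)
Definition torus_L2 f : Prop :=
  [/\ cmeasurable f,
      periodic f (pi *+ 2) &
      (\int[@lebesgue_measure R]_(x in `[0%R, (pi *+ 2)%R])
         ((ComplexField.Normc.normc (f x)) ^+ 2)%:E < +oo)%E].

Definition expi (x : R) : R[i] := cos x +i* sin x.

Definition fourier f k : R[i] :=
  ((pi *+ 2)^-1)%:C * torus_integral (fun x => f x * expi (- (k%:~R * x))).

Definition Hnorm r f : \bar R :=
  ((\esum_(k in [set: int])
      ((1 + k%:~R ^+ 2) `^ r *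
        ComplexField.Normc.normc (fourier f k) ^+ 2)%:E) `^ 2^-1)%E.

(* For r >= 0 this is all of H^r(T). For r < 0 it is only the part of H^r(T)
   lying in L^2(T), which leaves the intersection of all the H^r(T)
   unchanged. *)
Definition in_H r f : Prop := torus_L2 f /\ (Hnorm r f < +oo)%E.

Definition continuous_in_H r (u : R -> R -> R[i]) : Prop :=
  (forall t, in_H r (u t)) /\
  (forall t, Hnorm r (u t' \- u t) @[t' --> t] --> 0%E).

Definition is_cderive (c : R -> R[i]) t (d : R[i]) : Prop :=
  is_derive t 1 (fun t' => complex.Re (c t')) (complex.Re d) /\
  is_derive t 1 (fun t' => complex.Im (c t')) (complex.Im d).

(* u : R -> H^{1/2}(T) is continuous, u(0) = u0, and i u_t - |D|u = |u|^2 u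
   holds in the sense of distributions. As the k-th Fourier coefficient of
   |D|u is |k| u_k, and the coefficients of u and of |u|^2 u are continuous in
   time for such u, testing against e^{ikx} shows that this means that, for
   every k, the coefficient u_k is differentiable at every time and satisfies
   i u_k' - |k| u_k = (|u|^2 u)_k. *)
Definition half_wave_solution (u0 : R -> R[i]) (u : R -> R -> R[i]) : Prop :=
  [/\ continuous_in_H 2^-1 u,
      torus_ae_eq (u 0) u0 &
      forall t k, exists d : R[i],
        is_cderive (fun t' => fourier (u t') k) t d /\
        'i * d - (`|k|%:~R) * fourier (u t) k =
          fourier (fun x => `|u t x| ^+ 2 * u t x) k].

End HalfWave.

(* Main.v *)
(* We follow an explicit solution of the cubic Szego equation
     i v' = |D| v + Pi (|v|^2 v)   (Pi: projection onto the frequencies k >= 0),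
   namely v = e (b + A z / (1 - P z)) with z = e^{ix} and initial value
   e (d + z).  At a time of order 1 / (d e^2) its pole 1 / P comes within a
   distance of order d^2 of the unit circle, and the modulus of its k-th
   coefficient is e eta (1 - eta)^{(k-1)/2} with eta = d^2 / (4 + d^2), so that
   its H^s norm has the size e eta^{1/2 - s}.

   In the half-wave equation the negative frequencies of |v|^2 v are
   non-resonant: the corrector - T_k(v) / (2 |k|), k < 0, where T_k(v) is the
   k-th coefficient of |v|^2 v, absorbs them up to O(e^5).  With the weight
   sigma^{-|k|}, sigma^8 = 1 - eta, the weighted l^1 norm is submultiplicative
   and v stays O(e) up to the peak time, although its pole gets so close to the
   circle.  A Gronwall argument therefore bounds the difference of the two
   solutions by O(e^3 exp (C e^2 t)), which is O(e^3 exp (2 C m)) for d = 1 / m.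
   With e = exp (- 500 m) this is negligible against e eta, mode by mode, and
   the H^s norm at the peak time is comparable to e m^{2s - 1}, where m is
   comparable to log (1 / e).

   The solutions themselves are limits of Galerkin approximations, which are
   bounded in the weighted l^1 norm with weight 1 + |k| by the conservation of
   mass and energy and a logarithmic (Brezis-Gallouet) inequality.  All the
   estimates are made on these finite systems and passed to the limit. *)

(* The obstacle: the peak pushes the pole of v to within d^2 of the circle, where the Sobolev norms
   of v grow, yet the Gronwall argument needs one norm in which v stays O(e) up to that time. The
   weighted l^1 norm does this because residue and pole are linked by |A| = 1 - |P|^2. Its value on
   the geometric part is at most e (1 - |P|^2) / (sigma - |P|), and |P| <= sigma^4 keeps 1 - |P| at
   least twice 1 - sigma, so the small numerator pays for the small denominator. The same norm has
   no loss on the cubic term and bounds the error in mode k by a multiple of sigma^|k|, hence in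
   every H^s at once. Non-resonance: v has only frequencies k >= 0, on which |D| acts as a
   derivative and its flow is a translation. So T_k(v) rotates at rate k, while for k < 0 the free
   k-th mode rotates at rate |k|; the gap 2 |k| is the denominator of the corrector. The logarithm:
   e^2 t is of order m at the peak, so Gronwall loses a factor exponential in m. To beat it, e must
   be exponentially small in m, and a power of m is then a power of log (1 / e). *)
Require Import Defs.
From HB Require Import structures.
From mathcomp Require Import all_boot all_order all_algebra.
From mathcomp Require Import complex ring lra zify.
From mathcomp Require Import all_classical all_reals all_analysis.

Import Order.TTheory GRing.Theory Num.Theory.
Import numFieldNormedType.Exports.

Local Open Scope classical_set_scope.
Local Open Scope complex_scope.
Local Open Scope ring_scope.

Set Implicit Arguments.
Unset Strict Implicit.
Unset Printing Implicit Defensive.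

(** * Complex modulus and complex-valued derivatives *)

Notation nm := ComplexField.Normc.normc.
Notation cj := conjc.

Lemma le_of_eq (d : Order.disp_t) (T : porderType d) (x y : T) : x = y -> (x <= y)%O.
Proof. by move=> ->. Qed.

Section ComplexModulus.
Variable R : realType.
Implicit Types (z w : R[i]).

Lemma nmE z : nm z = Num.sqrt (complex.Re z ^+ 2 + complex.Im z ^+ 2).
Proof. by case: z. Qed.

Lemma nm_sqr z : nm z ^+ 2 = complex.Re z ^+ 2 + complex.Im z ^+ 2.
Proof. by rewrite nmE sqr_sqrtr // addr_ge0 // sqr_ge0. Qed.

Lemma nm_ge0 z : 0 <= nm z.
Proof. by rewrite nmE sqrtr_ge0. Qed.

Lemma nm0 : nm (0 : R[i]) = 0.
Proof. exact: ComplexField.Normc.normc0. Qed.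

Lemma nm1 : nm (1 : R[i]) = 1.
Proof. exact: ComplexField.Normc.normc1. Qed.

Lemma nm_eq0 z : (nm z == 0) = (z == 0).
Proof.
by apply/eqP/eqP => [/ComplexField.Normc.eq0_normc//|->]; rewrite nm0.
Qed.

Lemma nmM z w : nm (z * w) = nm z * nm w.
Proof. exact: ComplexField.Normc.normcM. Qed.

Lemma nmV z : nm z^-1 = (nm z)^-1.
Proof. exact: ComplexField.Normc.normcV. Qed.

Lemma nmX z n : nm (z ^+ n) = nm z ^+ n.
Proof. by elim: n => [|n IH]; rewrite ?expr0 ?nm1// !exprS nmM IH. Qed.

Lemma nmD z w : nm (z + w) <= nm z + nm w.
Proof. exact: le_normcD. Qed.

Lemma nmN z : nm (- z) = nm z.
Proof. exact: normcN. Qed.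

Lemma nmB z w : nm (z - w) <= nm z + nm w.
Proof. by rewrite -[nm w]nmN nmD. Qed.

Lemma nm_distC z w : nm (z - w) = nm (w - z).
Proof. by rewrite -nmN opprB. Qed.

Lemma nm_lerB z w : nm z - nm w <= nm (z - w).
Proof. by rewrite lerBlDr -{1}(subrK w z) nmD. Qed.

Lemma nmJ z : nm (cj z) = nm z.
Proof. by case: z => a b /=; rewrite sqrrN. Qed.

Lemma nm_real (x : R) : nm x%:C = `|x|.
Proof. by rewrite /= expr0n /= addr0 sqrtr_sqr. Qed.

Lemma nm_i : nm ('i%C : R[i]) = 1.
Proof. by rewrite /= expr0n /= add0r expr1n sqrtr1. Qed.

Lemma nm_Re z : `|complex.Re z| <= nm z.
Proof.
rewrite -(@ler_pXn2r _ 2) ?nnegrE ?nm_ge0 // nm_sqr real_normK ?num_real //.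
by rewrite lerDl sqr_ge0.
Qed.

Lemma nm_Im z : `|complex.Im z| <= nm z.
Proof.
rewrite -(@ler_pXn2r _ 2) ?nnegrE ?nm_ge0 // nm_sqr real_normK ?num_real //.
by rewrite lerDr sqr_ge0.
Qed.

Lemma nm_ReIm z : nm z <= `|complex.Re z| + `|complex.Im z|.
Proof.
rewrite -(@ler_pXn2r _ 2) ?nnegrE ?nm_ge0 ?addr_ge0 // nm_sqr sqrrD.
rewrite !real_normK ?num_real // -addrA lerD2l lerDr.
by rewrite mulrn_wge0// mulr_ge0.
Qed.

Lemma nm_sum (I : Type) (r : seq I) (P : pred I) (F : I -> R[i]) :
  nm (\sum_(i <- r | P i) F i) <= \sum_(i <- r | P i) nm (F i).
Proof.
elim/big_ind2 : _ => [|x a y b ha hb|//]; first by rewrite nm0.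
by apply: (le_trans (nmD _ _)); exact: lerD.
Qed.

Lemma Re_sum (I : Type) (r : seq I) (P : pred I) (F : I -> R[i]) :
  complex.Re (\sum_(i <- r | P i) F i) = \sum_(i <- r | P i) complex.Re (F i).
Proof. by elim/big_ind2 : _ => // x a y b <- <-; case: a => ? ?; case: b. Qed.

Lemma Im_sum (I : Type) (r : seq I) (P : pred I) (F : I -> R[i]) :
  complex.Im (\sum_(i <- r | P i) F i) = \sum_(i <- r | P i) complex.Im (F i).
Proof. by elim/big_ind2 : _ => // x a y b <- <-; case: a => ? ?; case: b. Qed.

Lemma cReD z w : complex.Re (z + w) = complex.Re z + complex.Re w.
Proof. by case: z; case: w. Qed.
Lemma cImD z w : complex.Im (z + w) = complex.Im z + complex.Im w.
Proof. by case: z; case: w. Qed.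
Lemma cReN z : complex.Re (- z) = - complex.Re z.
Proof. by case: z. Qed.
Lemma cImN z : complex.Im (- z) = - complex.Im z.
Proof. by case: z. Qed.
Lemma cReM z w : complex.Re (z * w) =
  complex.Re z * complex.Re w - complex.Im z * complex.Im w.
Proof. by case: z; case: w. Qed.
Lemma cImM z w : complex.Im (z * w) =
  complex.Re z * complex.Im w + complex.Im z * complex.Re w.
Proof. by case: z; case: w. Qed.
Lemma cReJ z : complex.Re (cj z) = complex.Re z.
Proof. by case: z. Qed.
Lemma cImJ z : complex.Im (cj z) = - complex.Im z.
Proof. by case: z. Qed.

Lemma mulzJ z : z * (cj z) = (nm z ^+ 2)%:C.
Proof.
rewrite nm_sqr; case: z => a b; apply/eqP; rewrite eq_complex /=.
by rewrite mulrN opprK -!expr2 eqxx mulrN mulrC addNr eqxx.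
Qed.

Lemma eq_ReIm z w : complex.Re z = complex.Re w -> complex.Im z = complex.Im w -> z = w.
Proof. by case: z; case: w => a b c d /= -> ->. Qed.

Lemma nm_expi (x : R) : nm (expi x) = 1.
Proof. by rewrite nmE /= cos2Dsin2 sqrtr1. Qed.

Lemma expiD (x y : R) : expi (x + y) = expi x * expi y.
Proof. by rewrite /expi cosD sinD; apply: eq_ReIm => /=; rewrite // addrC mulrC; congr (_ + _); rewrite mulrC. Qed.

Lemma expi0 : expi (0 : R) = 1.
Proof. by rewrite /expi cos0 sin0. Qed.

Lemma expiN (x : R) : expi (- x) = cj (expi x).
Proof. by rewrite /expi cosN sinN. Qed.

Lemma expi_mulJ (x : R) : expi x * cj (expi x) = 1.
Proof. by rewrite mulzJ nm_expi expr1n. Qed.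

Lemma ImiE : ('i%R : R[i]) = 'i%C.
Proof. by rewrite complexiE. Qed.

Lemma ii : 'i%C * 'i%C = -1 :> R[i].
Proof. by rewrite -expr2 sqr_i. Qed.

(** The witness is conj z / |z|, and 0 when z = 0. It lets a weighted l^1 norm at a fixed time be
    written as the real part of a linear functional. *)
Lemma unimodular z : exists2 w : R[i], nm w <= 1 & complex.Re (w * z) = nm z.
Proof.
have [->|z0] := eqVneq z 0; first by exists 0; rewrite ?nm0 ?ler01 ?mulr0.
have nz : nm z != 0 by rewrite nm_eq0.
exists ((cj z) * ((nm z)^-1)%:C).
  by rewrite nmM nmJ nm_real normfV ger0_norm ?nm_ge0// divff.
rewrite mulrAC [(cj z) * z]mulrC mulzJ -rmorphM /= expr2 -mulrA divff ?mulr1 //.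
Qed.

End ComplexModulus.

Section ComplexDerivative.
Variable R : realType.
Implicit Types (c e : R -> R[i]) (t : R).

Lemma rder_eq (f : R -> R) t d d' :
  is_derive t 1 f d -> d = d' -> is_derive t 1 f d'.
Proof. by move=> h <-. Qed.

Lemma cder_eq c t d d' : d = d' -> is_cderive c t d -> is_cderive c t d'.
Proof. by move=> ->. Qed.

Lemma cder_ext c e t d : c =1 e -> is_cderive c t d -> is_cderive e t d.
Proof. by move=> /funext ->. Qed.

Lemma cder_cst (z : R[i]) t : is_cderive (fun=> z) t 0.
Proof. by split; exact: is_derive_cst. Qed.

Lemma cderD c e t d d' : is_cderive c t d -> is_cderive e t d' ->
  is_cderive (fun x => c x + e x) t (d + d').
Proof.
move=> [c1 c2] [e1 e2]; split.
- rewrite cReD; under eq_fun do rewrite cReD.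
  by apply: is_deriveD.
- rewrite cImD; under eq_fun do rewrite cImD.
  by apply: is_deriveD.
Qed.

Lemma cderN c t d : is_cderive c t d -> is_cderive (fun x => - c x) t (- d).
Proof.
move=> [c1 c2]; split.
- rewrite cReN; under eq_fun do rewrite cReN.
  by apply: is_deriveN.
- rewrite cImN; under eq_fun do rewrite cImN.
  by apply: is_deriveN.
Qed.

Lemma cderB c e t d d' : is_cderive c t d -> is_cderive e t d' ->
  is_cderive (fun x => c x - e x) t (d - d').
Proof. by move=> h1 /cderN; exact: cderD. Qed.

Lemma cderM c e t d d' : is_cderive c t d -> is_cderive e t d' ->
  is_cderive (fun x => c x * e x) t (d * e t + c t * d').
Proof.
move=> [c1 c2] [e1 e2]; split.
- under eq_fun do rewrite cReM.
  have h1 := is_deriveM c1 e1; have h2 := is_deriveM c2 e2.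
  apply: (rder_eq (is_deriveB h1 h2)).
  by rewrite cReD !cReM /= /GRing.scale /=; ring.
- under eq_fun do rewrite cImM.
  have h1 := is_deriveM c1 e2; have h2 := is_deriveM c2 e1.
  apply: (rder_eq (is_deriveD h1 h2)).
  by rewrite cImD !cImM /= /GRing.scale /=; ring.
Qed.

Lemma cderZ (z : R[i]) c t d : is_cderive c t d ->
  is_cderive (fun x => z * c x) t (z * d).
Proof.
move=> h; apply: cder_eq (cderM (cder_cst z t) h).
by rewrite mul0r add0r.
Qed.

Lemma cderJ c t d : is_cderive c t d -> is_cderive (fun x => cj (c x)) t (cj d).
Proof.
move=> [c1 c2]; split.
- by rewrite cReJ; under eq_fun do rewrite cReJ.
- rewrite cImJ; under eq_fun do rewrite cImJ.
  by apply: is_deriveN.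
Qed.

Lemma cder_sum_in (I : eqType) (r : seq I) (F : I -> R -> R[i]) (D : I -> R[i]) t :
  (forall i, i \in r -> is_cderive (F i) t (D i)) ->
  is_cderive (fun x => \sum_(i <- r) F i x) t (\sum_(i <- r) D i).
Proof.
elim: r => [|a r IH] h.
  by rewrite big_nil; under eq_fun do rewrite big_nil; exact: cder_cst.
rewrite big_cons; under eq_fun do rewrite big_cons.
by apply: cderD; [apply: h; rewrite mem_head|apply: IH => i ir; apply: h; rewrite in_cons ir orbT].
Qed.

Lemma cderX c t d n : is_cderive c t d ->
  is_cderive (fun x => c x ^+ n) t (n%:R * c t ^+ n.-1 * d).
Proof.
move=> h; elim: n => [|n IH].
  by rewrite !mul0r; under eq_fun do rewrite expr0; exact: cder_cst.
under eq_fun do rewrite exprS.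
apply: cder_eq (cderM h IH).
case: n {IH} => [|n] /=; first by rewrite !expr0; ring.
by rewrite exprS; ring.
Qed.

Lemma rder_lin (M t : R) : is_derive t 1 (fun s : R => M * s) M.
Proof.
have := @is_deriveZ _ _ _ (@id R) M t 1 1 _.
by rewrite /GRing.scale /= mulr1; apply; exact: is_derive_id.
Qed.

Lemma cder_expi (a : R) t :
  is_cderive (fun x => expi (a * x)) t ('i%C * a%:C * expi (a * t)).
Proof.
have ha := rder_lin a t.
have hc := @is_derive1_comp R cos (fun x : R => a * x) t _ _ (is_derive_cos _) ha.
have hs := @is_derive1_comp R sin (fun x : R => a * x) t _ _ (is_derive_sin _) ha.
split; rewrite /=.
- apply: (rder_eq hc).
  by rewrite /=; ring.
- apply: (rder_eq hs).
  by rewrite /=; ring.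
Qed.

Lemma cder_Re c t d : is_cderive c t d ->
  is_derive t 1 (fun x => complex.Re (c x)) (complex.Re d).
Proof. by case. Qed.

Lemma cder_comp_lin c (a : R) t d : is_cderive c (a * t) d ->
  is_cderive (fun x => c (a * x)) t (a%:C * d).
Proof.
have ha := rder_lin a t.
move=> [c1 c2]; split.
- apply: (rder_eq (@is_derive1_comp R _ (fun x : R => a * x) t _ _ c1 ha)).
  by rewrite cReM /=; ring.
- apply: (rder_eq (@is_derive1_comp R _ (fun x : R => a * x) t _ _ c2 ha)).
  by rewrite cImM /=; ring.
Qed.

End ComplexDerivative.

(** * A norm comparison principle *)

Section Comparison.
Variable R : realType.

Lemma mvt_le (f df : R -> R) (a b : R) : a <= b ->
  (forall x : R, a <= x <= b -> is_derive x 1 f (df x)) ->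
  exists2 c, a <= c <= b & f b - f a = df c * (b - a).
Proof.
move=> ab h.
have [||c] := @MVT_segment R f df a b ab.
- by move=> x; rewrite in_itv /= => /andP[/ltW ? /ltW ?]; apply: h; apply/andP.
- apply: derivable_within_continuous => x; rewrite in_itv /= => xab.
  by case: (h x xab).
by rewrite in_itv /= => cab e; exists c.
Qed.

Lemma deriv_le0 (f df : R -> R) (a b : R) : a <= b ->
  (forall x : R, a <= x <= b -> is_derive x 1 f (df x)) ->
  (forall x : R, a <= x <= b -> df x <= 0) -> f b <= f a.
Proof.
move=> ab h h0; have [c cab e] := mvt_le ab h.
by rewrite -subr_le0 e mulr_le0_ge0 ?h0// subr_ge0.
Qed.

Lemma deriv_continuous (f : R -> R) (t d : R) :
  is_derive t (1 : R) f d -> {for t, continuous f}.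
Proof. by case=> h _; apply/differentiable_continuous/derivable1_diffP. Qed.

Lemma nm_continuous (c : R -> R[i]) t d : is_cderive c t d ->
  {for t, continuous (fun s => nm (c s))}.
Proof.
move=> [h1 h2].
have -> : (fun s => nm (c s)) = (fun s => Num.sqrt (complex.Re (c s) ^+ 2 + complex.Im (c s) ^+ 2)).
  by apply/funext => s; rewrite nmE.
apply: continuous_comp; last exact: sqrt_continuous.
apply: continuousD; apply: (@continuous_comp _ _ _ _ (fun x : R => x ^+ 2));
  try exact: exprn_continuous; exact: deriv_continuous.
Qed.

Lemma sum_continuous (I : eqType) (r : seq I) (f : I -> R -> R) (u : R) :
  (forall k, k \in r -> {for u, continuous (f k)}) ->
  {for u, continuous (fun s => \sum_(k <- r) f k s)}.
Proof.
elim: r => [|a r IH] h.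
  have -> : (fun s => \sum_(k <- [::]) f k s) = (fun=> 0) by apply/funext => s; rewrite big_nil.
  exact: cst_continuous.
have -> : (fun s => \sum_(k <- a :: r) f k s) = (fun s => f a s + \sum_(k <- r) f k s).
  by apply/funext => s; rewrite big_cons.
apply: continuousD; first by apply: h; rewrite mem_head.
by apply: IH => k kr; apply: h; rewrite in_cons kr orbT.
Qed.

(** The time is the infimum of the set where D <= 0. Continuity gives D <= 0 there, and positivity
    on the left excludes D < 0. *)
Lemma first_zero (D : R -> R) (T : R) : 0 <= T ->
  (forall t : R, 0 <= t <= T -> {for t, continuous D}) -> 0 < D 0 -> D T <= 0 ->
  exists t1 : R, [/\ 0 < t1, t1 <= T, D t1 = 0 & forall s : R, 0 <= s < t1 -> 0 < D s].
Proof.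
move=> T0 cD D0 DT.
pose B := [set t | 0 <= t <= T /\ D t <= 0].
have BT : B T by split; rewrite ?T0 ?lexx.
have hB : has_inf B by split; [exists T|exists 0 => x [/andP[]]].
pose t1 := inf B.
have t1T : t1 <= T by apply: ge_inf => //; case: hB.
have t10 : 0 <= t1 by apply: lb_le_inf; [exists T|move=> x [/andP[]]].
have lt1 s : 0 <= s < t1 -> 0 < D s.
  move=> /andP[s0 st]; rewrite ltNge; apply/negP => Ds.
  have : B s by split; rewrite // s0 ltW// (lt_le_trans st).
  by move=> /(ge_inf hB.2); rewrite leNgt st.
have ct1 := cD t1 (introT andP (conj t10 t1T)).
have Dt1 : D t1 <= 0.
  rewrite leNgt; apply/negP => Dp.
  have /cvgrPdist_lt/(_ _ Dp) [e /= e0 he] := ct1.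
  have [b Bb bt] := inf_adherent e0 hB.
  have tb : t1 <= b by apply: ge_inf => //; case: hB.
  have h : `|t1 - b| < e by rewrite ler0_norm ?subr_le0// opprB ltrBlDl.
  have := he b h; rewrite ltr_norml => /andP[_]; rewrite ltrBlDr ltrDl ltNge.
  by case: Bb => _ ->.
have t1p : 0 < t1.
  rewrite lt_neqAle t10 andbT; apply/eqP => e.
  by move: Dt1; rewrite -e leNgt D0.
exists t1; split => //; apply/eqP; rewrite eq_le Dt1 /= leNgt; apply/negP => Dn.
have Dn' : 0 < - D t1 by rewrite oppr_gt0.
have /cvgrPdist_lt/(_ _ Dn') [e /= e0 he] := ct1.
(* The maximum with 0 keeps the test point in [0, t1), where D is already known to be positive. *)
pose s := Num.max 0 (t1 - e / 2).
have st : s < t1 by rewrite gt_max t1p ltrBlDr ltrDl divr_gt0.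
have s0 : 0 <= s by rewrite le_max lexx.
have ss : t1 - e / 2 <= s by rewrite le_max lexx orbT.
have h : `|t1 - s| < e by rewrite ger0_norm ?subr_ge0 ?ltW//; lra.
have := he s h; rewrite /= ltr_norml => /andP[+ _]; rewrite opprK ltrBrDr -ltrBrDl subrr.
by rewrite ltNge ltW// lt1// s0.
Qed.

Variables (I : eqType) (W : seq I) (w lam : I -> R) (w0 : forall k, 0 <= w k).
Variables (q g : R -> I -> R[i]) (y y' : R -> R).

Let S t := \sum_(k <- W) w k * nm (q t k).

(* The factors e^{i lam_k t} remove the linear part, and constant phases th_k
   turn the weighted l^1 norm at the final time into the real part of a linear
   functional, to which the scalar mean value theorem applies. *)
Lemma mvt_norm (T : R) : 0 <= T ->
  (forall (t : R) k, 0 <= t <= T -> k \in W ->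
    is_cderive (q^~ k) t (- ('i%C * (lam k)%:C * q t k) + g t k)) ->
  (forall t : R, 0 <= t <= T -> is_derive t 1 y (y' t)) ->
  (forall t : R, 0 <= t <= T -> \sum_(k <- W) w k * nm (g t k) <= y' t) ->
  S T <= S 0 + y T - y 0.
Proof.
move=> T0 hq hy hg.
have [th Hth] : {th : I -> R[i] & forall k, nm (th k) <= 1 /\ complex.Re (th k * q T k) = nm (q T k)}.
  apply: (@choice _ _ (fun k (z : R[i]) => nm z <= 1 /\ complex.Re (z * q T k) = nm (q T k))) => k.
  by have [z z1 z2] := unimodular (q T k); exists z.
(* The factor exp (- i lam_k T) makes m k T equal to w_k th_k, so that psi T is exactly S T - y T;
   at time 0 the bound |m k 0| <= w_k is enough. *)
pose m k t := (w k)%:C * (th k * (expi (lam k * t) * expi (- (lam k * T)))).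
pose psi t := complex.Re (\sum_(k <- W) m k t * q t k) - y t.
have dpsi t : 0 <= t <= T -> is_derive t (1 : R) psi (complex.Re (\sum_(k <- W) m k t * g t k) - y' t).
  move=> tT; apply: is_deriveB; last exact: hy.
  apply: cder_Re.
  apply: (cder_sum_in (F := fun k t => m k t * q t k)) => k kW.
  have h2 := hq t k tT kW.
  have h1 : is_cderive (m k) t ('i%C * (lam k)%:C * m k t).
    rewrite /m; apply: cder_eq (cderZ _ (cderZ _ (cderM (cder_expi (lam k) t) (cder_cst _ t)))).
    by ring.
  apply: cder_eq (cderM h1 h2).
  by ring.
have m_le k t : 0 <= w k -> nm (m k t) <= w k.
  move=> wk; rewrite /m !nmM nm_real ger0_norm// !nm_expi !mulr1 -[leRHS]mulr1.
  by rewrite ler_wpM2l//; case: (Hth k).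
have le0 : psi T <= psi 0.
  apply: deriv_le0 T0 dpsi _ => t tT; rewrite subr_le0.
  apply: le_trans (hg t tT).
  apply: le_trans (le_trans (ler_norm _) (nm_Re _)) _.
  apply: le_trans (nm_sum _ _ _) _.
  apply: ler_sum => k _; rewrite nmM ler_wpM2r ?nm_ge0//; exact: m_le.
have e1 : psi T = S T - y T.
  rewrite /psi Re_sum; congr (_ - _); apply: eq_bigr => k _.
  rewrite /m -expiD subrr expi0 mulr1 -mulrA cReM mul0r subr0.
  by rewrite (Hth k).2.
have e2 : psi 0 <= S 0 - y 0.
  rewrite /psi lerD2r; apply: le_trans (le_trans (ler_norm _) (nm_Re _)) _.
  apply: le_trans (nm_sum _ _ _) _.
  apply: ler_sum => k _; rewrite nmM ler_wpM2r ?nm_ge0//; exact: m_le.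
move: le0 e2; rewrite e1; lra.
Qed.

(** A continuity argument: the bound on g is assumed only while S <= y. At a first contact time t1,
    [mvt_norm] on [0, t1] would give S t1 <= S 0 + y t1 - y 0 < y t1. *)
Lemma comparison (T : R) :
  (forall (t : R) k, 0 <= t <= T -> k \in W ->
    is_cderive (q^~ k) t (- ('i%C * (lam k)%:C * q t k) + g t k)) ->
  (forall t : R, 0 <= t <= T -> is_derive t 1 y (y' t)) ->
  (forall t : R, 0 <= t <= T -> S t <= y t -> \sum_(k <- W) w k * nm (g t k) <= y' t) ->
  S 0 < y 0 ->
  forall t : R, 0 <= t <= T -> S t < y t.
Proof.
move=> hq hy hg S0 t /andP[t0 tT].
rewrite ltNge; apply/negP => yS.
have sub u s : 0 <= u <= s -> s <= T -> 0 <= u <= T.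
  by move=> /andP[-> us] sT; exact: le_trans us sT.
have cD u : 0 <= u <= t -> {for u, continuous (fun s => y s - S s)}.
  move=> ut; have uT := sub u t ut tT.
  apply: continuousB; first exact: deriv_continuous (hy u uT).
  apply: sum_continuous => k kW.
  apply: continuousM; first exact: cst_continuous.
  exact: nm_continuous (hq u k uT kW).
have [||t1 [t1p t1t D1 D2]] := first_zero t0 cD; rewrite ?subr_gt0 ?subr_le0//.
have t1T := le_trans t1t tT.
have : S t1 <= S 0 + y t1 - y 0.
  apply: mvt_norm (ltW t1p) _ _ _.
  - by move=> u k ut; apply: hq; exact: sub ut t1T.
  - by move=> u ut; apply: hy; exact: sub ut t1T.
  - move=> u ut; apply: hg; first exact: sub ut t1T.
    (* At the endpoint t1 there is equality S = y, so the hypothesis on g still applies. *)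
    have [->|ne] := eqVneq u t1; first by rewrite -subr_ge0 D1.
    by case/andP: ut => u0 ut; rewrite -subr_ge0 ltW// D2// u0 lt_neqAle ne.
by move: D1 S0; lra.
Qed.

End Comparison.

(** * Antiderivatives, limits and Picard iteration *)

Section Antiderivative.
Variable R : realType.
Local Notation mu := (@lebesgue_measure R).

Lemma antiderivative_local (f : R -> R) (a : R) :
  (forall t : R, {for t, continuous f}) ->
  exists G : R -> R, forall x : R, - a < x < a -> is_derive x 1 G (f x).
Proof.
move=> cf.
have intf : mu.-integrable `[- a, a] (EFin \o f).
  apply: continuous_compact_integrable; first exact: segment_compact.
  exact: continuous_subspaceT.
exists (fun x => (\int[mu]_(t in `[(- a), x]) (f t))%R) => x /andP[ax xa].
have [h1 h2] := continuous_FTC1_closed xa intf ax (cf x).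
by apply: DeriveDef; [exact: h1|rewrite -derive1E; exact: h2].
Qed.

Lemma deriv_eq_cst (f g df : R -> R) (a b : R) :
  (forall x : R, a < x < b -> is_derive x 1 f (df x)) ->
  (forall x : R, a < x < b -> is_derive x 1 g (df x)) ->
  forall x y : R, a < x -> x <= y -> y < b -> f y - f x = g y - g x.
Proof.
move=> hf hg x y ax xy yb.
have h (z : R) : x <= z <= y -> is_derive z 1 (fun z => f z - g z) (df z - df z).
  move=> /andP[xz zy]; have zab : a < z < b.
    by rewrite (lt_le_trans ax)//= (le_lt_trans zy).
  by apply: is_deriveB; [exact: hf|exact: hg].
have [c _] := mvt_le xy h.
by rewrite subrr mul0r => /eqP; rewrite subr_eq0 => /eqP; lra.
Qed.

(** The fundamental theorem gives antiderivatives on bounded intervals only. Normalised to vanish at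
    0, they agree on overlaps, and the one of radius |x| + 1 is used at x. *)
Lemma antiderivative (f : R -> R) :
  (forall t : R, {for t, continuous f}) ->
  exists2 G : R -> R, G 0 = 0 & forall x : R, is_derive x 1 G (f x).
Proof.
move=> cf.
have [G HG] := @choice _ _ (fun a (G : R -> R) =>
  forall x : R, - a < x < a -> is_derive x 1 G (f x))
  (fun a => antiderivative_local a cf).
pose H a x := G a x - G a 0.
have HE (a b x : R) : `|x| < a -> `|x| < b -> H a x = H b x.
  wlog ab : a b / a <= b.
    move=> hw xa xb; have [|/ltW] := leP a b; first by move/hw; exact.
    by move=> ba; rewrite (hw b a).
  move=> xa xb; have a0 : 0 < a by exact: le_lt_trans (normr_ge0 _) xa.
  have h1 := @HG a.
  have h2 (z : R) : - a < z < a -> is_derive z 1 (G b) (f z).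
    by move=> /andP[z1 z2]; apply: HG; lra.
  have [x0|x0] := leP 0 x.
    apply: (@deriv_eq_cst _ _ f (- a) a) => //; first by rewrite oppr_lt0.
    by rewrite -(ger0_norm x0).
  apply: oppr_inj; rewrite /H !opprB.
  apply: (@deriv_eq_cst _ _ f (- a) a) => //; last exact: ltW.
  by rewrite ltrNl -(ltr0_norm x0).
exists (fun x => H (`|x| + 1) x) => [|x]; first by rewrite /H subrr.
(* Near x the varying radius |y| + 1 is replaced by the fixed radius |x| + 2, which contains all y
   with |y - x| < 1. *)
apply: (@near_eq_is_derive _ _ _ (H (`|x| + 2))).
  near=> y; apply: HE; last by rewrite ltrDl.
  have : `|x - y| < 1.
    by near: y; apply: (@cvgr_dist_lt _ _ _ _ _ id x) => //.
  rewrite distrC => xy; have -> : y = x + (y - x) by rewrite addrC subrK.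
  by apply: le_lt_trans (ler_normD _ _) _; lra.
have hx : - (`|x| + 2) < x < `|x| + 2.
  have := ler_norm x; have := ler_norm (- x); rewrite normrN; lra.
apply: rder_eq (is_deriveB (HG _ _ hx) (is_derive_cst _ _ _)) _.
by rewrite subr0.
Unshelve. all: by end_near. Qed.

Lemma cantiderivative (c : R -> R[i]) :
  (forall t : R, {for t, continuous (fun s => complex.Re (c s))}) ->
  (forall t : R, {for t, continuous (fun s => complex.Im (c s))}) ->
  exists G : R -> R[i], G 0 = 0 /\ forall t, is_cderive G t (c t).
Proof.
move=> /antiderivative[G G0 HG] /antiderivative[K K0 HK].
by exists (fun t => G t +i* K t); split; [by rewrite G0 K0|move=> t; split; [exact: HG|exact: HK]].
Qed.

(** Differentiability deduced from a quadratic remainder, an inequality that survives pointwise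
    limits. *)
Lemma rder_quad (f : R -> R) (t d C : R) :
  (forall s, `|s - t| <= 1 -> `|f s - f t - (s - t) * d| <= C * (s - t) ^+ 2) ->
  is_derive t 1 f d.
Proof.
move=> h.
have C0 : 0 <= C.
  have := h (t + 1); rewrite addrAC subrr add0r normr1 expr1n mulr1 lexx.
  by move=> /(_ isT); apply: le_trans.
have H : (h^-1 *: (f (h *: (1 : R) + t) - f t)) @[h --> 0^'] --> d.
  apply/cvgrPdist_le => e e0.
  near=> x.
  have x0 : x != 0 by near: x; exact: nbhs_dnbhs_neq.
  have x1 : `|x| <= 1.
    by near: x; apply: dnbhs0_le.
  have xe : `|x| <= e / (C + 1).
    by near: x; apply: dnbhs0_le; rewrite divr_gt0// ltr_wpDl.
  have := h (x + t); rewrite addrK => /(_ x1) hx.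
  rewrite /GRing.scale /= mulr1 distrC.
  rewrite -(@ler_pM2l _ `|x|) ?normr_gt0// -normrM mulrBr mulrA divff// mul1r.
  apply: le_trans hx _.
  rewrite -[x ^+ 2]ger0_norm ?sqr_ge0// normrX expr2 mulrCA ler_wpM2l//.
  apply: le_trans (ler_wpM2l C0 xe) _.
  by rewrite mulrCA ler_piMr ?(ltW e0)// ler_pdivrMr ?ltr_wpDl// mul1r lerDl.
by apply: DeriveDef; [apply/cvg_ex; exists d|exact/cvg_lim].
Unshelve. all: by end_near. Qed.

End Antiderivative.

(** * Limits of complex sequences and of differentiable functions *)

Section Limits.
Variable R : realType.

(** Every x n - e n lies below every x m + e m, so the supremum of the former is a point within e n
    of each x n. This yields the rate directly. *)
Lemma rcauchy (x e : nat -> R) : (forall n m, (n <= m)%N -> `|x m - x n| <= e n) ->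
  exists l, forall n, `|l - x n| <= e n.
Proof.
move=> h.
have hnm n m : x n - e n <= x m + e m.
  have := h _ _ (leq_maxl n m); have := h _ _ (leq_maxr n m).
  by rewrite !ler_norml => /andP[? ?] /andP[? ?]; lra.
pose A := [set y | exists n, y = x n - e n].
have hA : has_sup A.
  by split; [exists (x 0%N - e 0%N), 0%N|exists (x 0%N + e 0%N) => _ [n ->]].
exists (sup A) => n; rewrite ler_norml.
have h1 : x n - e n <= sup A by apply: ub_le_sup; [case: hA|exists n].
have h2 : sup A <= x n + e n by apply: ge_sup; [case: hA|move=> _ [m ->]].
by lra.
Qed.

Lemma ccauchy (z : nat -> R[i]) (e : nat -> R) :
  (forall n m, (n <= m)%N -> nm (z m - z n) <= e n) ->
  exists l, forall n, nm (l - z n) <= 2 * e n.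
Proof.
move=> h.
have [|a ha] := @rcauchy (fun n => complex.Re (z n)) e.
  by move=> n m nm_; rewrite -cReN -cReD; exact: le_trans (nm_Re _) (h _ _ nm_).
have [|b hb] := @rcauchy (fun n => complex.Im (z n)) e.
  by move=> n m nm_; rewrite -cImN -cImD; exact: le_trans (nm_Im _) (h _ _ nm_).
exists (a +i* b) => n; apply: le_trans (nm_ReIm _) _.
rewrite cReD cReN cImD cImN /= mulrDl mul1r.
by apply: lerD.
Qed.

(** Complex convergence is encoded by a real sequence, so that only the topology of R enters. *)
Definition ccvg (z : nat -> R[i]) (l : R[i]) := (fun n => nm (z n - l)) @ \oo --> (0 : R).

Lemma cvg0_le (a b : nat -> R) : (forall n, 0 <= a n) -> (\forall n \near \oo, a n <= b n) ->
  b @ \oo --> (0 : R) -> a @ \oo --> (0 : R).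
Proof.
move=> a0 ab hb; apply: (squeeze_cvgr _ (cvg_cst 0) hb).
by near=> n; rewrite a0 /=; near: n.
Unshelve. all: by end_near. Qed.

Lemma ccvg_le (z : nat -> R[i]) l (b : nat -> R) :
  (\forall n \near \oo, nm (z n - l) <= b n) -> b @ \oo --> (0 : R) -> ccvg z l.
Proof. by move=> h; apply: cvg0_le h => n; exact: nm_ge0. Qed.

Lemma le_of_cvg0 (a b : R) (e : nat -> R) : (\forall n \near \oo, a <= b + e n) ->
  e @ \oo --> (0 : R) -> a <= b.
Proof.
move=> h he.
have hbe : (fun n => b + e n) @ \oo --> b + 0 by apply: cvgD he; exact: cvg_cst.
by rewrite addr0 in hbe; exact: (cvgr_to_ge hbe h).
Qed.

Lemma cvg0Z (c : R) (e : nat -> R) : e @ \oo --> (0 : R) -> (fun n => c * e n) @ \oo --> (0 : R).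
Proof. by move=> h; rewrite -(mulr0 c); apply: cvgM h; exact: cvg_cst. Qed.

Lemma cvg0_geom (c x : R) : 0 <= x -> x < 1 -> (fun n => c * x ^+ n) @ \oo --> (0 : R).
Proof. by move=> x0 x1; apply/cvg0Z/cvg_expr; rewrite ger0_norm. Qed.

Lemma cvg0_sum (I : eqType) (r : seq I) (e : I -> nat -> R) :
  (forall i, i \in r -> e i @ \oo --> (0 : R)) ->
  (fun n => \sum_(i <- r) e i n) @ \oo --> (0 : R).
Proof.
elim: r => [|i r IH] h.
  by under eq_fun do rewrite big_nil; exact: cvg_cst.
under eq_fun do rewrite big_cons.
have h1 : e i @ \oo --> (0 : R) by apply: h; rewrite mem_head.
have h2 : (fun n => \sum_(i <- r) e i n) @ \oo --> (0 : R).
  by apply: IH => j jr; apply: h; rewrite in_cons jr orbT.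
have h3 : (fun n => e i n + \sum_(j <- r) e j n) @ \oo --> (0 + 0 : R) by exact: cvgD.
by rewrite addr0 in h3.
Qed.

Lemma ccvg_unique (z : nat -> R[i]) a b : ccvg z a -> ccvg z b -> a = b.
Proof.
move=> ha hb; apply/eqP; rewrite -subr_eq0 -nm_eq0 eq_le nm_ge0 andbT.
apply: (le_of_cvg0 (e := fun n => nm (z n - a) + nm (z n - b))).
  near=> n; rewrite add0r -[a - b](subrKA (z n)) [nm (z n - a)]nm_distC; exact: nmD.
by rewrite -(addr0 0); exact: cvgD.
Unshelve. all: by end_near. Qed.

Lemma nm_ccvg_le (z : nat -> R[i]) l (B : R) : ccvg z l ->
  (\forall n \near \oo, nm (z n) <= B) -> nm l <= B.
Proof.
move=> h hB; apply: le_of_cvg0 h.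
near=> n; have h1 : nm (z n) <= B by near: n; exact: hB.
by have := nm_lerB l (z n); rewrite nm_distC; move: h1; lra.
Unshelve. all: by end_near. Qed.

Lemma ccvgD (z w : nat -> R[i]) a b : ccvg z a -> ccvg w b ->
  ccvg (fun n => z n + w n) (a + b).
Proof.
move=> ha hb; apply: (ccvg_le (b := fun n => nm (z n - a) + nm (w n - b))).
  by near=> n; rewrite opprD addrACA nmD.
by rewrite -(addr0 0); exact: cvgD.
Unshelve. all: by end_near. Qed.

Lemma ccvgZ (x : R[i]) (z : nat -> R[i]) a : ccvg z a -> ccvg (fun n => x * z n) (x * a).
Proof.
move=> ha; apply: (ccvg_le (b := fun n => nm x * nm (z n - a))).
  by near=> n; rewrite -mulrBr nmM.
exact: cvg0Z.
Unshelve. all: by end_near. Qed.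

Lemma ccvgB (z w : nat -> R[i]) a b : ccvg z a -> ccvg w b ->
  ccvg (fun n => z n - w n) (a - b).
Proof.
move=> ha /(ccvgZ (-1)) hb; rewrite -[- b]mulN1r.
by under eq_fun do rewrite -[- w _]mulN1r; exact: ccvgD.
Qed.

Lemma ccvg_cst (a : R[i]) : ccvg (fun=> a) a.
Proof. by rewrite /ccvg subrr nm0; exact: cvg_cst. Qed.

(** The mean value theorem is applied to the real and imaginary parts separately, whence the factor
    2. *)
Lemma cmvt (c d : R -> R[i]) (s t C : R) : 0 <= C -> `|s - t| <= 1 ->
  (forall x, is_cderive c x (d x)) ->
  (forall x, `|x - t| <= 1 -> nm (d x - d t) <= C * `|x - t|) ->
  nm (c s - c t - (s - t)%:C * d t) <= 2 * C * (s - t) ^+ 2.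
Proof.
move=> C0 st hc hd.
have key (f df : R -> R) : (forall x : R, is_derive x 1 f (df x)) ->
    (forall x, `|x - t| <= 1 -> `|df x - df t| <= C * `|x - t|) ->
    `|f s - f t - (s - t) * df t| <= C * (s - t) ^+ 2.
  move=> hf hdf.
  have [x xst ->] : exists2 x, `|x - t| <= `|s - t| & f s - f t = df x * (s - t).
    have [ts|/ltW ts] := leP t s.
      have [x /andP[tx xs] e] := mvt_le ts (fun x _ => hf x); exists x => //.
      by rewrite !ger0_norm ?subr_ge0// lerD2r.
    have [x /andP[tx xs] e] := mvt_le ts (fun x _ => hf x); exists x.
      by rewrite !ler0_norm ?subr_le0// !opprB lerD2l lerN2.
    by rewrite -opprB e -mulrN opprB.
  rewrite [_ * df t]mulrC -mulrBl normrM.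
  apply: (@le_trans _ _ (C * `|x - t| * `|s - t|)).
    by rewrite ler_wpM2r// hdf// (le_trans xst).
  rewrite -mulrA ler_wpM2l// -[_ ^+ 2]ger0_norm ?sqr_ge0// expr2 normrM.
  by rewrite ler_wpM2r.
apply: le_trans (nm_ReIm _) _; rewrite -mulrA mulrDl mul1r; apply: lerD.
  rewrite !cReD !cReN cReM /= mul0r subr0.
  apply: (key (fun x => complex.Re (c x)) (fun x => complex.Re (d x))).
    by move=> x; case: (hc x).
  by move=> x xt; rewrite -cReN -cReD; apply: le_trans (nm_Re _) (hd _ xt).
rewrite !cImD !cImN cImM /= mul0r addr0.
apply: (key (fun x => complex.Im (c x)) (fun x => complex.Im (d x))).
  by move=> x; case: (hc x).
by move=> x xt; rewrite -cImN -cImD; apply: le_trans (nm_Im _) (hd _ xt).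
Qed.

(** Derivatives that are Lipschitz at t uniformly in n give, through [cmvt], a quadratic remainder
    uniform in n. It passes to the limit, so convergence of the derivatives is asked at t alone. *)
Lemma cder_limit (c d : nat -> R -> R[i]) (f : R -> R[i]) (t C : R) (l : R[i]) :
  0 <= C ->
  (forall n x, is_cderive (c n) x (d n x)) ->
  (forall n x, `|x - t| <= 1 -> nm (d n x - d n t) <= C * `|x - t|) ->
  (forall s, ccvg (fun n => c n s) (f s)) -> ccvg (fun n => d n t) l ->
  is_cderive f t l.
Proof.
move=> C0 hc hd hf hl.
have key s : `|s - t| <= 1 -> nm (f s - f t - (s - t)%:C * l) <= 2 * C * (s - t) ^+ 2.
  move=> st.
  have h : ccvg (fun n => c n s - c n t - (s - t)%:C * d n t) (f s - f t - (s - t)%:C * l).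
    by apply: ccvgB; [exact: ccvgB|exact: ccvgZ].
  by apply: nm_ccvg_le h _; near=> n; exact: (cmvt C0 st (hc n) (hd n)).
split.
- apply: (@rder_quad _ _ _ _ (2 * C)) => s st.
  apply: le_trans (key s st); apply: le_trans (nm_Re _).
  by rewrite !cReD !cReN cReM /= mul0r subr0.
- apply: (@rder_quad _ _ _ _ (2 * C)) => s st.
  apply: le_trans (key s st); apply: le_trans (nm_Im _).
  by rewrite !cImD !cImN cImM /= mul0r addr0.
Unshelve. all: by end_near. Qed.

End Limits.

(** * Time reversal, Lipschitz bounds in time and global Picard iteration *)

Section Picard.
Variable R : realType.

Lemma cder_rev (c : R -> R[i]) t d : is_cderive c (- t) d ->
  is_cderive (fun s => c (- s)) t (- d).
Proof.
move=> h; apply: cder_ext (_ : is_cderive (fun s => c (-1 * s)) t (- d)).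
  by move=> s; rewrite mulN1r.
by apply: cder_eq (@cder_comp_lin _ c (-1) t d _); rewrite ?mulN1r // rmorphN1 mulN1r.
Qed.

(** For negative T the reversal t -> - t turns lam into - lam and g into its opposite, a system of
    the same form. *)
Lemma mvt_norm_abs (I : eqType) (W : seq I) (w lam : I -> R)
    (q g : R -> I -> R[i]) (y y' : R -> R) (T : R) :
  (forall k, 0 <= w k) ->
  (forall (t : R) k, `|t| <= `|T| -> k \in W ->
    is_cderive (q^~ k) t (- ('i%C * (lam k)%:C * q t k) + g t k)) ->
  (forall t : R, 0 <= t <= `|T| -> is_derive t 1 y (y' t)) ->
  (forall t : R, `|t| <= `|T| -> \sum_(k <- W) w k * nm (g t k) <= y' `|t|) ->
  \sum_(k <- W) w k * nm (q T k) <= \sum_(k <- W) w k * nm (q 0 k) + y `|T| - y 0.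
Proof.
move=> w0 hq hy hg; have [T0|/ltW T0] := leP 0 T.
  rewrite ger0_norm // in hq hy hg *.
  apply: (mvt_norm (lam := lam) (g := g) (y' := y') w0 T0) => //.
  - by move=> t k /andP[t0 tT]; apply: hq; rewrite ger0_norm.
  - by move=> t /andP[t0 tT]; have := hg t; rewrite ger0_norm//; exact.
have NT : 0 <= - T by rewrite oppr_ge0.
rewrite ler0_norm // in hq hy hg *.
have := @mvt_norm R I W w (fun k => - lam k) w0 (fun t => q (- t)) (fun t k => - g (- t) k) y y' (- T) NT.
rewrite opprK oppr0; apply => //.
- move=> t k /andP[t0 tT] kW.
  apply: cder_eq (cder_rev (c := q^~ k) (hq (- t) k _ kW)).
    by rewrite rmorphN; ring.
  by rewrite normrN ger0_norm.
- move=> t /andP[t0 tT]; have := hg (- t); rewrite normrN ger0_norm// => /(_ tT).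
  by under [X in _ -> X <= _]eq_bigr do rewrite nmN.
Qed.

Lemma comparison_abs (I : eqType) (W : seq I) (w lam : I -> R)
    (q g : R -> I -> R[i]) (y y' : R -> R) (T : R) :
  (forall k, 0 <= w k) ->
  (forall (t : R) k, `|t| <= T -> k \in W ->
    is_cderive (q^~ k) t (- ('i%C * (lam k)%:C * q t k) + g t k)) ->
  (forall t : R, 0 <= t <= T -> is_derive t 1 y (y' t)) ->
  (forall t : R, `|t| <= T -> \sum_(k <- W) w k * nm (q t k) <= y `|t| ->
     \sum_(k <- W) w k * nm (g t k) <= y' `|t|) ->
  \sum_(k <- W) w k * nm (q 0 k) < y 0 ->
  forall t : R, `|t| <= T -> \sum_(k <- W) w k * nm (q t k) < y `|t|.
Proof.
move=> w0 hq hy hg h0 t tT; have [t0|/ltW t0] := leP 0 t.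
  rewrite ger0_norm // in tT *.
  apply: (comparison (lam := lam) (g := g) (y' := y') (T := T) w0) => //.
  - by move=> s k /andP[s0 sT]; apply: hq; rewrite ger0_norm.
  - by move=> s /andP[s0 sT]; have := hg s; rewrite ger0_norm//; exact.
  - by rewrite t0.
rewrite ler0_norm // in tT *.
have := @comparison R I W w (fun k => - lam k) w0 (fun t => q (- t)) (fun t k => - g (- t) k) y y' T.
move=> /(_ _ _ _ _ (- t)); rewrite opprK oppr0; apply => //.
- move=> s k /andP[s0 sT] kW.
  apply: cder_eq (cder_rev (c := q^~ k) (hq (- s) k _ kW)).
    by rewrite rmorphN; ring.
  by rewrite normrN ger0_norm.
- move=> s /andP[s0 sT]; have := hg (- s); rewrite normrN ger0_norm// => /(_ sT).
  by under [X in _ -> _ -> X <= _]eq_bigr do rewrite nmN.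
- by rewrite oppr_ge0 t0.
Qed.

Lemma cexpR_deriv (a b t : R) : is_derive t 1 (fun t => a * expR (b * t)) (b * (a * expR (b * t))).
Proof.
have he := @is_derive1_comp R expR (fun x : R => b * x) t _ _ (is_derive_expR _) (rder_lin b t).
have := @is_deriveZ _ _ _ (expR \o (fun x : R => b * x)) a t 1 _ he.
by move=> h; apply: (rder_eq h); rewrite /GRing.scale /=; ring.
Qed.

Lemma cder_shift (c : R -> R[i]) (a t : R) d : is_cderive c (a + t) d ->
  is_cderive (fun s => c (a + s)) t d.
Proof.
have ha : is_derive t (1 : R) (fun x : R => a + x) 1.
  by apply: rder_eq (is_deriveD (is_derive_cst _ _ _) (is_derive_id _ _)) _; rewrite add0r.
move=> [c1 c2]; split.
- by apply: (rder_eq (@is_derive1_comp R _ (fun x : R => a + x) t _ _ c1 ha)); rewrite mulr1.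
- by apply: (rder_eq (@is_derive1_comp R _ (fun x : R => a + x) t _ _ c2 ha)); rewrite mulr1.
Qed.

Lemma lip_norm (I : eqType) (W : seq I) (q d : R -> I -> R[i]) (t x M : R) :
  (forall s k, `|s - t| <= `|x - t| -> k \in W -> is_cderive (q^~ k) s (d s k)) ->
  (forall s, `|s - t| <= `|x - t| -> \sum_(k <- W) nm (d s k) <= M) ->
  \sum_(k <- W) nm (q x k - q t k) <= M * `|x - t|.
Proof.
move=> hq hd.
have : \sum_(k <- W) 1 * nm (q (t + (x - t)) k - q t k) <=
    \sum_(k <- W) 1 * nm (q (t + 0) k - q t k) + M * `|x - t| - M * 0.
  apply: (mvt_norm_abs (w := fun=> 1) (lam := fun=> 0) (q := fun s k => q (t + s) k - q t k)
    (g := fun s k => d (t + s) k) (y := fun s => M * s) (y' := fun=> M) (T := x - t)) => //.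
  - move=> s k sx kW; rewrite mulr0 mul0r oppr0 add0r.
    have h : is_cderive (q^~ k) (t + s) (d (t + s) k) by apply: hq => //; rewrite addrAC subrr add0r.
    by apply: cder_eq (cderB (cder_shift h) (cder_cst _ _)); rewrite subr0.
  - by move=> s _; exact: rder_lin.
  - move=> s sx; under eq_bigr do rewrite mul1r.
    by apply: hd; rewrite addrAC subrr add0r.
rewrite [X in _ <= X + _ - _]big1 => [|k _]; last by rewrite addr0 subrr nm0 mulr0.
rewrite add0r mulr0 subr0 [t + _]addrC subrK.
by under eq_bigr do rewrite mul1r.
Qed.

(** The iterates are built by entrywise antiderivatives. Differences are measured against an
    exponential in |t|, so they converge on the whole line at once, without continuation in time. *)
Lemma picard (I : eqType) (W : seq I) (F : (I -> R[i]) -> I -> R[i]) (L : R) (x0 : I -> R[i]) :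
  (forall x k, k \notin W -> F x k = 0) -> 1 <= L ->
  (forall x y, \sum_(k <- W) nm (F x k - F y k) <= L * \sum_(k <- W) nm (x k - y k)) ->
  exists u : R -> I -> R[i], u 0 = x0 /\ forall t k, is_cderive (u^~ k) t (F (u t) k).
Proof.
move=> FW L1 FL.
have L0 : 0 <= L by exact: le_trans L1.
pose good (u : R -> I -> R[i]) := exists d, forall t k, is_cderive (u^~ k) t (d t k).
have FLk x y k : nm (F x k - F y k) <= L * \sum_(j <- W) nm (x j - y j).
  have [kW|kW] := boolP (k \in W); last first.
    by rewrite !FW// subrr nm0 mulr_ge0// sumr_ge0// => j _; exact: nm_ge0.
  apply: le_trans (FL x y); rewrite (big_rem k)//= lerDl sumr_ge0// => j _; exact: nm_ge0.
(* Stated for every u, with the conclusion claimed for good u only, so that [choice] yields a total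
   iteration map. *)
have step (u : R -> I -> R[i]) : exists v : R -> I -> R[i], good u ->
    [/\ good v, v 0 = x0 & forall t k, is_cderive (v^~ k) t (F (u t) k)].
  have [[d hd]|] := pselect (good u); last by exists u.
  have cF (t : R) : (fun s => L * \sum_(j <- W) nm (u s j - u t j)) @ t --> (0 : R).
    have : {for t, continuous (fun s => L * \sum_(j <- W) nm (u s j - u t j))}.
      apply: continuousM; first exact: cst_continuous.
      apply: sum_continuous => j _.
      by apply: nm_continuous; apply: cderB (hd t j) (cder_cst _ _).
    have e : L * \sum_(j <- W) nm (u t j - u t j) = 0.
      by rewrite big1 ?mulr0// => j _; rewrite subrr nm0.
    by rewrite /prop_for /continuous_at /= e.
  have cont (P : R[i] -> R) : (forall z w, `|P z - P w| <= nm (z - w)) ->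
      forall k (t : R), {for t, continuous (fun s => P (F (u s) k))}.
    move=> hP k t; apply/cvgrPdist_le => e e0.
    have /cvgrPdist_le/(_ _ e0) := cF t.
    apply: filterS => s; rewrite sub0r normrN => h.
    apply: le_trans (hP _ _) _; rewrite nm_distC.
    exact: le_trans (FLk _ _ _) (le_trans (ler_norm _) h).
  have [G HG] : {G : I -> R -> R[i] & forall k, G k 0 = 0 /\ forall t, is_cderive (G k) t (F (u t) k)}.
    apply: (@choice _ _ (fun k G => G 0 = 0 /\ forall t, is_cderive G t (F (u t) k))) => k.
    apply: cantiderivative.
      by apply: (cont (@complex.Re R)) => z w; rewrite -cReN -cReD nm_Re.
    by apply: (cont (@complex.Im R)) => z w; rewrite -cImN -cImD nm_Im.
  have hv t k : is_cderive (fun s => x0 k + G k s) t (F (u t) k).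
    by apply: cder_eq (cderD (cder_cst _ _) ((HG k).2 t)); rewrite add0r.
  exists (fun t k => x0 k + G k t) => _; split => //.
    by exists (fun t k => F (u t) k).
  by apply/funext => k; rewrite (HG k).1 addr0.
have [nxt Hn] := choice step.
pose u n := iter n nxt (fun=> x0).
have gu n : good (u n).
  elim: n => [|n IH]; last by case: (Hn _ IH).
  by exists (fun _ _ => 0) => t k; exact: cder_cst.
have u0 n : u n 0 = x0 by case: n => [|n] //=; case: (Hn _ (gu n)).
have du n t k : is_cderive ((u n.+1)^~ k) t (F (u n t) k) by case: (Hn _ (gu n)) => _ _; apply.
pose A := \sum_(k <- W) nm (F x0 k).
have A0 : 0 <= A by apply: sumr_ge0 => k _; exact: nm_ge0.
(* The integral of L a exp (2 L s) is at most (a / 2) exp (2 L s): the rate 2 L halves the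
   difference at each iteration. *)
pose E (t : R) := expR (2 * L * `|t|).
have bnd n t : \sum_(k <- W) nm (u n.+1 t k - u n t k) <= A * 2^-1 ^+ n * E t.
  have dE a s : is_derive s (1 : R) (fun s => a * expR (2 * L * s)) (2 * L * (a * expR (2 * L * s))).
    exact: cexpR_deriv.
  have conv (f : I -> R) : \sum_(k <- W) f k = \sum_(k <- W) 1 * f k.
    by apply: eq_bigr => k _; rewrite mul1r.
  rewrite conv.
  have z0 m : \sum_(k <- W) 1 * nm (u m.+1 0 k - u m 0 k) = 0.
    by rewrite big1// => k _; rewrite !u0 subrr nm0 mulr0.
  have fin a s : 0 <= a -> 0 + a * expR (2 * L * s) - a * expR (2 * L * 0) <= a * expR (2 * L * s).
    by move=> a0; rewrite add0r mulr0 expR0 mulr1 gerBl.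
  have B0 m : 0 <= A * 2^-1 ^+ m by rewrite mulr_ge0// exprn_ge0// invr_ge0.
  elim: n t => [|n IH] t.
    apply: le_trans (fin _ `|t| (B0 0%N)); rewrite -[X in _ <= X + _ - _](z0 0%N).
    apply: (mvt_norm_abs (lam := fun=> 0) (g := fun s k => F x0 k) (w := fun=> 1)
      (q := fun s k => u 1%N s k - u 0%N s k) (T := t) (y := fun s => A * 2^-1 ^+ 0 * expR (2 * L * s))
      (y' := fun s => 2 * L * (A * 2^-1 ^+ 0 * expR (2 * L * s)))) => //.
      move=> s k _ _; apply: cder_eq (cderB (du 0%N s k) (cder_cst _ s)).
      by rewrite subr0 mulr0 mul0r oppr0 add0r.
    move=> s _; rewrite -conv -/A expr0 mulr1 mulrCA -[leLHS]mulr1 ler_wpM2l//.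
    have : 1 <= expR (2 * L * `|s|) by rewrite -expR0 ler_expR !mulr_ge0.
    nra.
  apply: le_trans (fin _ `|t| (B0 n.+1)); rewrite -[X in _ <= X + _ - _](z0 n.+1).
  apply: (mvt_norm_abs (lam := fun=> 0) (g := fun s k => F (u n.+1 s) k - F (u n s) k) (w := fun=> 1)
    (q := fun s k => u n.+2 s k - u n.+1 s k) (T := t) (y := fun s => A * 2^-1 ^+ n.+1 * expR (2 * L * s))
    (y' := fun s => 2 * L * (A * 2^-1 ^+ n.+1 * expR (2 * L * s)))) => //.
    move=> s k _ _; apply: cder_eq (cderB (du n.+1 s k) (du n s k)).
    by rewrite mulr0 mul0r oppr0 add0r.
  move=> s _; rewrite -conv; apply: le_trans (FL _ _) _.
  have IHs := IH s; rewrite -conv in IHs.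
  apply: le_trans (ler_wpM2l L0 IHs) _.
  rewrite exprS /E; apply: le_of_eq.
  by field.
have E0 t : 0 <= E t by exact: expR_ge0.
have cau n m t : (n <= m)%N -> \sum_(k <- W) nm (u m t k - u n t k) <= 2 * A * 2^-1 ^+ n * E t.
  move=> nm_; suff : \sum_(k <- W) nm (u m t k - u n t k) <= 2 * A * (2^-1 ^+ n - 2^-1 ^+ m) * E t.
    move/le_trans; apply; rewrite ler_wpM2r// ler_wpM2l ?mulr_ge0// gerBl.
    by rewrite exprn_ge0// invr_ge0.
  rewrite -(subnKC nm_); elim: (m - n)%N => [|p IH].
    rewrite addn0 subrr mulr0 mul0r big1// => k _; by rewrite subrr nm0.
  apply: (@le_trans _ _ (\sum_(k <- W) (nm (u (n + p.+1)%N t k - u (n + p)%N t k) + nm (u (n + p)%N t k - u n t k)))).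
    by apply: ler_sum => k _; rewrite -[X in nm X](subrKA (u (n + p)%N t k)) nmD.
  rewrite big_split /= addnS; apply: le_trans (lerD (bnd _ _) IH) _.
  rewrite exprS; apply: le_of_eq.
  by field.
have le_sum1 (f : I -> R[i]) k : k \in W -> nm (f k) <= \sum_(j <- W) nm (f j).
  by move=> kW; rewrite (big_rem k)//= lerDl sumr_ge0// => j _; exact: nm_ge0.
have uC t k : exists l, forall n, k \in W -> nm (l - u n t k) <= 2 * (2 * A * 2^-1 ^+ n * E t).
  have [kW|kW] := boolP (k \in W); last by exists 0.
  have [|l hl] := @ccauchy R (fun n => u n t k) (fun n => 2 * A * 2^-1 ^+ n * E t).
    by move=> n m nm_; apply: le_trans (cau _ _ _ nm_); exact: (le_sum1 (fun j => u m t j - u n t j)).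
  by exists l => n _.
have [ul Hul] : {ul : R -> I -> R[i] & forall t k n, k \in W ->
    nm (ul t k - u n t k) <= 2 * (2 * A * 2^-1 ^+ n * E t)}.
  have [f hf] := @choice _ _ (fun (p : R * I) l => forall n, p.2 \in W ->
    nm (l - u n p.1 p.2) <= 2 * (2 * A * 2^-1 ^+ n * E p.1)) (fun p => uC p.1 p.2).
  by exists (fun t k => f (t, k)) => t k n; exact: (hf (t, k)).
have uW t k : k \in W -> ccvg (fun n => u n t k) (ul t k).
  move=> kW; apply: (ccvg_le (b := fun n => 2 * (2 * A * E t) * 2^-1 ^+ n)).
    near=> n; rewrite nm_distC; apply: le_trans (Hul t k n kW) _.
    by apply: le_of_eq; ring.
  by apply: cvg0_geom; rewrite ?invr_ge0// invf_lt1// ltr1n.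
(* Outside W the field vanishes, so those entries keep their initial value. *)
pose v t k := if k \in W then ul t k else x0 k.
have vW t k : k \in W -> ccvg (fun n => u n t k) (v t k) by rewrite /v => kW; rewrite kW; exact: uW.
exists v; split.
  apply/funext => k; rewrite /v; case: ifP => // kW.
  apply: ccvg_unique (uW 0 k kW) _; under eq_fun do rewrite u0; exact: ccvg_cst.
move=> t k; have [kW|kW] := boolP (k \in W); last first.
  rewrite FW//; apply: cder_ext (cder_cst (x0 k) t) => s.
  by rewrite /v (negbTE kW).
(* M bounds the speed of all iterates for |s - t| <= 1, so L M is the Lipschitz constant in time
   required by [cder_limit]. *)
pose M := A + L * (2 * A * expR (2 * L * (`|t| + 1))).
have M0 : 0 <= M by rewrite addr_ge0// !mulr_ge0// expR_ge0.
have hM n s : `|s - t| <= 1 -> \sum_(j <- W) nm (F (u n s) j) <= M.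
  move=> st.
  apply: (@le_trans _ _ (\sum_(j <- W) (nm (F x0 j) + nm (F (u n s) j - F x0 j)))).
    by apply: ler_sum => j _; have := nm_lerB (F (u n s) j) (F x0 j); lra.
  rewrite big_split /=; apply: lerD => //; apply: le_trans (FL _ _) _.
  rewrite ler_wpM2l//; apply: le_trans (cau 0%N n s (leq0n n)) _.
  rewrite expr0 mulr1 ler_wpM2l ?mulr_ge0// ler_expR ler_wpM2l ?mulr_ge0//.
  by have := ler_normD (s - t) t; rewrite subrK; lra.
have LM0 : 0 <= L * M by rewrite mulr_ge0.
apply: (@cder_limit R (fun n s => u n.+1 s k) (fun n s => F (u n s) k) _ t (L * M)) => //.
- move=> n x xt; apply: le_trans (FLk _ _ _) _; rewrite -mulrA ler_wpM2l//.
  case: n => [|n].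
    by rewrite big1 ?mulr_ge0// => j _; rewrite subrr nm0.
  apply: (lip_norm (d := fun s j => F (u n s) j)) => // s st.
  by apply: hM; exact: le_trans st xt.
- move=> s; have := uW s k kW; rewrite /v kW => h.
  rewrite /ccvg; have := cvg_shiftS (fun n => nm (u n s k - ul s k)) (nbhs (0 : R)).
  by move=> e; have : [sequence nm (u n.+1 s k - ul s k)]_n @ \oo --> (0 : R) by rewrite e.
- apply: (ccvg_le (b := fun n => L * \sum_(j <- W) nm (u n t j - v t j))).
    by near=> n; exact: FLk.
  by apply/cvg0Z/cvg0_sum => j jW; exact: vW.
Unshelve. all: by end_near. Qed.

End Picard.

(** * The trilinear form on Fourier coefficients *)

(* The k-th Fourier coefficient of f * conj g * h, for f, g, h with frequencies
   in W. *)
Definition tri (R : realType) (W : seq int) (f g h : int -> R[i]) (k : int) : R[i] :=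
  \sum_(a <- W) \sum_(b <- W) \sum_(c <- W)
    if a - b + c == k then f a * cj (g b) * h c else 0.

Notation tri3 W f := (tri W f f f).

Section Trilinear.
Variable R : realType.
Implicit Types (f g h e : int -> R[i]) (W V : seq int) (w : int -> R).

Definition win (N : nat) : seq int := [seq (i%:Z - N%:Z) | i <- iota 0 (2 * N).+1].

Lemma mem_win N (k : int) : (k \in win N) = (`|k| <= N)%N.
Proof.
apply/mapP/idP => [[j]|h]; first by rewrite mem_iota => ? ->; lia.
by exists (absz (k + N%:Z)); rewrite ?mem_iota; lia.
Qed.

Lemma uniq_win N : uniq (win N).
Proof. by rewrite map_inj_uniq ?iota_uniq// => i j; lia. Qed.

Lemma perm_winS N : perm_eq (win N.+1) [:: N.+1%:Z, - N.+1%:Z & win N].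
Proof.
have e (k : int) : (`|k| = N.+1)%N -> k \notin win N by move=> e; rewrite mem_win e ltnn.
apply: uniq_perm; first exact: uniq_win.
  apply/andP; split; last by apply/andP; split; [apply: e; lia|exact: uniq_win].
  by rewrite in_cons negb_or; apply/andP; split; [lia|apply: e; lia].
by move=> k; rewrite mem_win 2!in_cons mem_win; lia.
Qed.

Definition NW w W f : R := \sum_(k <- W) w k * nm (f k).

Lemma NW_ge0 w W f : (forall k, 0 <= w k) -> 0 <= NW w W f.
Proof. by move=> w0; apply: sumr_ge0 => k _; rewrite mulr_ge0// nm_ge0. Qed.

Lemma NWD w W f g : (forall k, 0 <= w k) ->
  NW w W (fun k => f k + g k) <= NW w W f + NW w W g.
Proof.
move=> w0; rewrite /NW -big_split /=; apply: ler_sum => k _.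
by rewrite -mulrDr ler_wpM2l// nmD.
Qed.

Lemma NWN w W f : NW w W (fun k => - f k) = NW w W f.
Proof. by apply: eq_bigr => k _; rewrite nmN. Qed.

Lemma NWB w W f g : (forall k, 0 <= w k) ->
  NW w W (fun k => f k - g k) <= NW w W f + NW w W g.
Proof. by move=> w0; apply: le_trans (NWD _ _ _ w0) _; rewrite NWN. Qed.

Lemma NWZ w W (x : R[i]) f : NW w W (fun k => x * f k) = nm x * NW w W f.
Proof. by rewrite /NW big_distrr /=; apply: eq_bigr => k _; rewrite nmM mulrCA. Qed.

Lemma eq_NW w W f g : {in W, f =1 g} -> NW w W f = NW w W g.
Proof. by move=> fg; apply: eq_big_seq => k kW; rewrite fg. Qed.

Lemma NW_term w W f k : (forall k, 0 <= w k) -> k \in W -> w k * nm (f k) <= NW w W f.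
Proof.
move=> w0 kW; rewrite /NW (big_rem k)//= lerDl sumr_ge0// => j _.
by rewrite mulr_ge0// nm_ge0.
Qed.

Lemma NW_sub w W V f : (forall k, 0 <= w k) -> uniq V -> uniq W -> {subset V <= W} ->
  NW w V f <= NW w W f.
Proof.
move=> w0 uV uW VW; rewrite /NW [leRHS](bigID (mem V)) /=.
rewrite -[X in _ <= X + _]big_filter [X in _ <= X + _](perm_big V).
  by rewrite lerDl sumr_ge0// => k _; rewrite mulr_ge0// nm_ge0.
apply: uniq_perm => //; first exact: filter_uniq.
by move=> k; rewrite mem_filter; apply/andP/idP => [[]//|kV]; split; rewrite // VW.
Qed.

Lemma sum_supp (A : nmodType) W V (F : int -> A) : uniq V -> uniq W -> {subset V <= W} ->
  (forall k, k \notin V -> F k = 0) -> \sum_(k <- W) F k = \sum_(k <- V) F k.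
Proof.
move=> uV uW VW h; rewrite (bigID (mem V)) /= [X in _ + X]big1 ?addr0//.
rewrite -big_filter; apply: perm_big.
apply: uniq_perm => //; first exact: filter_uniq.
by move=> k; rewrite mem_filter; apply/andP/idP => [[]//|kV]; split; rewrite // VW.
Qed.

(** Each triple (a, b, c) feeds at most one output mode, so the sum over k collapses. Phi is the
    product w a w b w c for the algebra property, and the sum of the three weights for the tame
    estimate [jap_tame]. *)
Lemma tri_bound_gen w (Phi : int -> int -> int -> R) W V f g h : (forall k, 0 <= w k) ->
  (forall a b c, w (a - b + c) <= Phi a b c) -> uniq V ->
  NW w V (tri W f g h) <= \sum_(a <- W) \sum_(b <- W) \sum_(c <- W)
    Phi a b c * (nm (f a) * nm (g b) * nm (h c)).
Proof.
move=> w0 wM uV.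
apply: (@le_trans _ _ (\sum_(k <- V) \sum_(a <- W) \sum_(b <- W) \sum_(c <- W)
    if a - b + c == k then w k * (nm (f a) * nm (g b) * nm (h c)) else 0)).
  apply: ler_sum => k _; rewrite /tri.
  apply: le_trans (ler_wpM2l (w0 k) (nm_sum _ _ _)) _; rewrite big_distrr /=.
  apply: ler_sum => a _; apply: le_trans (ler_wpM2l (w0 k) (nm_sum _ _ _)) _; rewrite big_distrr /=.
  apply: ler_sum => b _; apply: le_trans (ler_wpM2l (w0 k) (nm_sum _ _ _)) _; rewrite big_distrr /=.
  apply: ler_sum => c _; case: ifP => _; last by rewrite nm0 mulr0.
  by rewrite !nmM nmJ.
rewrite exchange_big /=; apply: ler_sum => a _.
rewrite exchange_big /=; apply: ler_sum => b _.
rewrite exchange_big /=; apply: ler_sum => c _.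
have n0 : 0 <= nm (f a) * nm (g b) * nm (h c) by rewrite !mulr_ge0 ?nm_ge0.
have P0 : 0 <= Phi a b c by exact: le_trans (w0 _) (wM a b c).
have [aV|aV] := boolP (a - b + c \in V); last first.
  rewrite big_seq big1 => [|k kV]; first by rewrite mulr_ge0.
  by case: eqP => // e; rewrite e kV in aV.
rewrite (bigD1_seq (a - b + c)) //= eqxx big1 => [|k]; last by rewrite eq_sym => /negbTE ->.
by rewrite addr0 ler_wpM2r.
Qed.

Lemma tri_bound w W V f g h : (forall k, 0 <= w k) ->
  (forall a b c, w (a - b + c) <= w a * w b * w c) -> uniq V ->
  NW w V (tri W f g h) <= NW w W f * NW w W g * NW w W h.
Proof.
move=> w0 wM uV; apply: le_trans (tri_bound_gen _ _ _ _ w0 wM uV) _.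
apply: le_of_eq.
rewrite /NW !big_distrl /=; apply: eq_bigr => a _.
rewrite -mulrA big_distrlr /= big_distrr /=; apply: eq_bigr => b _.
rewrite big_distrr /=; apply: eq_bigr => c _.
by ring.
Qed.

Lemma triBl W f f' g h k : tri W (fun k => f k - f' k) g h k = tri W f g h k - tri W f' g h k.
Proof.
rewrite /tri -!sumrB; apply: eq_bigr => a _; rewrite -!sumrB; apply: eq_bigr => b _.
by rewrite -!sumrB; apply: eq_bigr => c _; case: ifP => _; rewrite ?subr0//; ring.
Qed.

Lemma triBm W f g g' h k : tri W f (fun k => g k - g' k) h k = tri W f g h k - tri W f g' h k.
Proof.
rewrite /tri -!sumrB; apply: eq_bigr => a _; rewrite -!sumrB; apply: eq_bigr => b _.
rewrite -!sumrB; apply: eq_bigr => c _; case: ifP => _; rewrite ?subr0// rmorphB /=; ring.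
Qed.

Lemma triBr W f g h h' k : tri W f g (fun k => h k - h' k) k = tri W f g h k - tri W f g h' k.
Proof.
rewrite /tri -!sumrB; apply: eq_bigr => a _; rewrite -!sumrB; apply: eq_bigr => b _.
by rewrite -!sumrB; apply: eq_bigr => c _; case: ifP => _; rewrite ?subr0//; ring.
Qed.

Lemma tri_diff w W V f g : (forall k, 0 <= w k) ->
  (forall a b c, w (a - b + c) <= w a * w b * w c) -> uniq V ->
  NW w V (fun k => tri3 W f k - tri3 W g k) <=
  (NW w W f ^+ 2 + NW w W f * NW w W g + NW w W g ^+ 2) * NW w W (fun k => f k - g k).
Proof.
move=> w0 wM uV.
have -> : NW w V (fun k => tri3 W f k - tri3 W g k) =
  NW w V (fun k => (tri W (fun k => f k - g k) f f k + tri W g (fun k => f k - g k) f k)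
     + tri W g g (fun k => f k - g k) k).
  by apply: eq_NW => k _; rewrite triBl triBm triBr; ring.
apply: le_trans (NWD _ _ _ w0) _.
apply: le_trans (lerD (NWD _ _ _ w0) (tri_bound _ _ _ _ w0 wM uV)) _.
apply: le_trans (lerD (lerD (tri_bound _ _ _ _ w0 wM uV) (tri_bound _ _ _ _ w0 wM uV)) (lexx _)) _.
by apply: le_of_eq; ring.
Qed.

Lemma tri_supp W V f g h k : uniq V -> uniq W -> {subset V <= W} ->
  (forall k, k \notin V -> f k = 0) -> (forall k, k \notin V -> g k = 0) ->
  (forall k, k \notin V -> h k = 0) -> tri W f g h k = tri V f g h k.
Proof.
move=> uV uW VW hf hg hh; rewrite /tri.
rewrite (sum_supp uV uW VW) => [|a aV].
  apply: eq_bigr => a _; rewrite (sum_supp uV uW VW) => [|b bV].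
    apply: eq_bigr => b _; rewrite (sum_supp uV uW VW) => [//|c cV].
    by rewrite hh// mulr0 if_same.
  by rewrite big1 => // c _; rewrite (hg b)// rmorph0 mulr0 mul0r if_same.
by rewrite big1 => // b _; rewrite big1 => // c _; rewrite (hf a)// !mul0r if_same.
Qed.

Lemma cder_tri W (f g h f' g' h' : R -> int -> R[i]) k t :
  {in W, forall k, is_cderive (f^~ k) t (f' t k)} ->
  {in W, forall k, is_cderive (g^~ k) t (g' t k)} ->
  {in W, forall k, is_cderive (h^~ k) t (h' t k)} ->
  is_cderive (fun s => tri W (f s) (g s) (h s) k) t
    (tri W (f' t) (g t) (h t) k + tri W (f t) (g' t) (h t) k + tri W (f t) (g t) (h' t) k).
Proof.
move=> hf hg hh; rewrite /tri -!big_split /=.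
apply: (cder_sum_in (F := fun a s => _)) => a aW; rewrite -!big_split /=.
apply: (cder_sum_in (F := fun b s => _)) => b bW; rewrite -!big_split /=.
apply: (cder_sum_in (F := fun c s => _)) => c cW.
case: ifP => _; last by rewrite !addr0; exact: cder_cst.
apply: cder_eq (cderM (cderM (hf _ aW) (cderJ (hg _ bW))) (hh _ cW)).
by ring.
Qed.

(** The mean over the torus of f conj(g) h conj(e), on the coefficient side. Its symmetries below
    come from the symmetric resonance condition a + c = b + k. *)
Definition quad W f g h e : R[i] := \sum_(k <- W) tri W f g h k * cj (e k).

Lemma quadE W f g h e : quad W f g h e =
  \sum_(a <- W) \sum_(b <- W) \sum_(c <- W) \sum_(k <- W)
    if a + c == b + k then f a * cj (g b) * h c * cj (e k) else 0.
Proof.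
rewrite /quad /tri; under eq_bigr do rewrite big_distrl /=.
rewrite exchange_big /=; apply: eq_bigr => a _.
under eq_bigr do rewrite big_distrl /=; rewrite exchange_big /=; apply: eq_bigr => b _.
under eq_bigr do rewrite big_distrl /=; rewrite exchange_big /=; apply: eq_bigr => c _.
apply: eq_bigr => k _; have -> : (a - b + c == k) = (a + c == b + k) by lia.
by case: ifP => _ //; rewrite mul0r.
Qed.

Lemma quad_swap_ac W f g h e : quad W f g h e = quad W h g f e.
Proof.
rewrite !quadE; under eq_bigr do rewrite exchange_big /=.
rewrite exchange_big /=; apply: eq_bigr => c _.
rewrite [RHS]exchange_big /=; rewrite exchange_big /=.
rewrite [RHS]exchange_big /=; apply: eq_bigr => b _.
apply: eq_bigr => a _; apply: eq_bigr => k _; rewrite [c + a]addrC; case: ifP => // _; ring.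
Qed.

Lemma quad_conj W f g h e : cj (quad W f g h e) = quad W g f e h.
Proof.
rewrite !quadE [RHS]exchange_big /= rmorph_sum /=; apply: eq_bigr => a _.
rewrite rmorph_sum /=; apply: eq_bigr => b _.
rewrite [RHS]exchange_big /= rmorph_sum /=; apply: eq_bigr => c _.
rewrite rmorph_sum /=; apply: eq_bigr => k _.
rewrite eq_sym; case: ifP => _; last by rewrite rmorph0.
by rewrite !rmorphM /= !conjcK; ring.
Qed.

Lemma quad_swap_bk W f g h e : quad W f g h e = quad W f e h g.
Proof. by rewrite -[LHS]conjcK quad_conj quad_swap_ac quad_conj. Qed.

Lemma quad_real W f : complex.Im (quad W f f f f) = 0.
Proof.
by have := congr1 (@complex.Im R) (quad_conj W f f f f); rewrite cImJ; lra.
Qed.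

(* Re (quad W f f f f) = sum_n |Q_n|^2, with Q the coefficients of f^2. *)
Lemma quad_ge0 W f : 0 <= complex.Re (quad W f f f f).
Proof.
pose V := undup [seq a + c | a <- W, c <- W].
pose Q n := \sum_(a <- W) \sum_(c <- W) if a + c == n then f a * f c else 0.
have -> : quad W f f f f = \sum_(n <- V) Q n * cj (Q n).
  transitivity (\sum_(n <- V) \sum_(a <- W) \sum_(c <- W) \sum_(b <- W) \sum_(k <- W)
    if (a + c == n) && (b + k == n) then f a * cj (f b) * f c * cj (f k) else 0).
    rewrite quadE [RHS]exchange_big /=; apply: eq_big_seq => a aW.
    rewrite exchange_big /= [RHS]exchange_big /=; apply: eq_big_seq => c cW.
    rewrite [RHS]exchange_big /=; apply: eq_bigr => b _.
    rewrite [RHS]exchange_big /=; apply: eq_bigr => k _.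
    have acV : a + c \in V by rewrite mem_undup; apply/allpairsP; exists (a, c).
    rewrite (bigD1_seq (a + c)) ?undup_uniq//= eqxx /= big1 ?addr0; first by rewrite eq_sym.
    by move=> n; rewrite eq_sym => /negbTE ->.
  apply: eq_bigr => n _; rewrite /Q big_distrl /=; apply: eq_bigr => a _.
  rewrite big_distrl /=; apply: eq_bigr => c _.
  rewrite rmorph_sum /= big_distrr /=; apply: eq_bigr => b _.
  rewrite rmorph_sum /= big_distrr /=; apply: eq_bigr => k _.
  case: eqP => _; last by rewrite mul0r.
  case: eqP => _; last by rewrite rmorph0 mulr0.
  by rewrite rmorphM /=; ring.
by rewrite Re_sum sumr_ge0// => n _; rewrite mulzJ /= sqr_ge0.
Qed.

(** By the swaps and conjugation, the four slots contribute the same real part, whence the factor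
    4. *)
Lemma cder_quad W (f f' : R -> int -> R[i]) t :
  {in W, forall k, is_cderive (f^~ k) t (f' t k)} ->
  is_derive t 1 (fun s => complex.Re (quad W (f s) (f s) (f s) (f s)))
    (4 * complex.Re (quad W (f t) (f t) (f t) (f' t))).
Proof.
move=> hf.
have h : is_cderive (fun s => quad W (f s) (f s) (f s) (f s)) t
   (quad W (f' t) (f t) (f t) (f t) + quad W (f t) (f' t) (f t) (f t)
    + quad W (f t) (f t) (f' t) (f t) + quad W (f t) (f t) (f t) (f' t)).
  rewrite /quad -!big_split /=; apply: (cder_sum_in (F := fun k s => _)) => k kW.
  apply: cder_eq (cderM (cder_tri k hf hf hf) (cderJ (hf k kW))).
  by ring.
apply: (rder_eq (cder_Re h)).
have e1 : quad W (f t) (f' t) (f t) (f t) = quad W (f t) (f t) (f t) (f' t) by exact: quad_swap_bk.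
have e2 : complex.Re (quad W (f' t) (f t) (f t) (f t)) = complex.Re (quad W (f t) (f t) (f t) (f' t)).
  by rewrite -e1 -cReJ quad_conj.
have e3 : quad W (f t) (f t) (f' t) (f t) = quad W (f' t) (f t) (f t) (f t) by exact: quad_swap_ac.
by rewrite !cReD e3 e1 e2; ring.
Qed.

Lemma cder_nm2 (c : R -> R[i]) t d : is_cderive c t d ->
  is_derive t 1 (fun s => nm (c s) ^+ 2) (2 * complex.Re (c t * cj d)).
Proof.
move=> h; have -> : (fun s => nm (c s) ^+ 2) = (fun s => complex.Re (c s * cj (c s))).
  by apply/funext => s; rewrite mulzJ.
apply: (rder_eq (cder_Re (cderM h (cderJ h)))).
rewrite cReD -[X in X + _]cReJ rmorphM /= conjcK [cj d * _]mulrC; ring.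
Qed.

Lemma rder_sum (I : eqType) (r : seq I) (f : I -> R -> R) (d : I -> R) (t : R) :
  (forall i, i \in r -> is_derive t (1 : R) (f i) (d i)) ->
  is_derive t 1 (fun s => \sum_(i <- r) f i s) (\sum_(i <- r) d i).
Proof.
elim: r => [|a r IH] h.
  by rewrite big_nil; under eq_fun do rewrite big_nil; exact: is_derive_cst.
rewrite big_cons; under eq_fun do rewrite big_cons.
by apply: is_deriveD; [apply: h; rewrite mem_head|apply: IH => i ir; apply: h; rewrite in_cons ir orbT].
Qed.

Lemma deriv0_cst (f : R -> R) : (forall t : R, is_derive t 1 f 0) -> forall t, f t = f 0.
Proof.
move=> h t; have [t0|/ltW t0] := leP 0 t;
  by have [c _] := mvt_le t0 (fun x _ => h x); rewrite mul0r => /subr0_eq.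
Qed.

(** Lagrange's identity: the double sum of squares is twice the defect in the inequality. *)
Lemma cauchy_schwarz_sum (I : Type) (r : seq I) (a b : I -> R) :
  (\sum_(i <- r) a i * b i) ^+ 2 <= (\sum_(i <- r) a i ^+ 2) * (\sum_(i <- r) b i ^+ 2).
Proof.
have : 0 <= \sum_(i <- r) \sum_(j <- r) (a i * b j - a j * b i) ^+ 2.
  by apply: sumr_ge0 => i _; apply: sumr_ge0 => j _; exact: sqr_ge0.
have -> : \sum_(i <- r) \sum_(j <- r) (a i * b j - a j * b i) ^+ 2 =
  2 * ((\sum_(i <- r) a i ^+ 2) * (\sum_(i <- r) b i ^+ 2) - (\sum_(i <- r) a i * b i) ^+ 2).
  transitivity (\sum_(i <- r) \sum_(j <- r) (a i ^+ 2 * b j ^+ 2 + (a j ^+ 2 * b i ^+ 2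
     + (- 2) * ((a i * b i) * (a j * b j))))).
    by apply: eq_bigr => i _; apply: eq_bigr => j _; ring.
  under eq_bigr do rewrite !big_split /=.
  rewrite !big_split /=.
  rewrite -big_distrlr /= exchange_big -big_distrlr /=.
  under [X in _ + (_ + X)]eq_bigr do rewrite -big_distrr /=.
  rewrite -big_distrr -big_distrlr /= expr2; ring.
by rewrite pmulr_rge0// subr_ge0.
Qed.

End Trilinear.

(** * Galerkin systems *)

Section Conservation.
Variable R : realType.
Implicit Types (x y : int -> R[i]) (W : seq int).

Lemma cjD (z w : R[i]) : cj (z + w) = cj z + cj w. Proof. exact: rmorphD. Qed.
Lemma cjM (z w : R[i]) : cj (z * w) = cj z * cj w. Proof. exact: rmorphM. Qed.
Lemma cjN (z : R[i]) : cj (- z) = - cj z. Proof. exact: rmorphN. Qed.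
Lemma cj_i : cj ('i%C : R[i]) = - 'i%C.
Proof. by apply/eqP; rewrite eq_complex /= oppr0 !eqxx. Qed.

Definition lam (k : int) : R := `|k|%:~R.
Definition mass W x : R := \sum_(k <- W) nm (x k) ^+ 2.
Definition n1 W x : R := NW (fun=> 1) W x.

Lemma lam_ge0 k : 0 <= lam k.
Proof. by rewrite /lam ler0z. Qed.

Lemma mass_ge0 W x : 0 <= mass W x.
Proof. by apply: sumr_ge0 => k _; exact: sqr_ge0. Qed.

Lemma n1_ge0 W x : 0 <= n1 W x.
Proof. exact: NW_ge0. Qed.

Lemma n1E W x : n1 W x = \sum_(k <- W) nm (x k).
Proof. by apply: eq_bigr => k _; rewrite mul1r. Qed.

Lemma n1_sqr W x : n1 W x ^+ 2 <= (size W)%:R * mass W x.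
Proof.
apply: le_trans (cauchy_schwarz_sum W (fun=> 1) (fun k => nm (x k))) _.
by rewrite /mass ler_wpM2r ?mass_ge0// expr1n big_const_seq count_predT iter_addr_0.
Qed.

Lemma mass_lip W x y :
  `|mass W x - mass W y| <= n1 W (fun k => x k - y k) * (n1 W x + n1 W y).
Proof.
rewrite /mass -sumrB; apply: le_trans (ler_norm_sum _ _ _) _.
rewrite [n1 W (fun _ => _)]n1E big_distrl /= big_seq [leRHS]big_seq.
apply: ler_sum => k kW.
rewrite subr_sqr normrM; apply: ler_pM => //.
  rewrite ler_norml; have := nm_lerB (x k) (y k); have := nm_lerB (y k) (x k).
  by rewrite [nm (y k - _)]nm_distC; lra.
rewrite ger0_norm ?addr_ge0 ?nm_ge0// !n1E; apply: lerD.
  by rewrite (big_rem k)//= lerDl sumr_ge0// => j _; exact: nm_ge0.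
by rewrite (big_rem k)//= lerDl sumr_ge0// => j _; exact: nm_ge0.
Qed.

(* The factor damp (mass u(0)) (mass u) makes the cubic vector field globally
   Lipschitz; it is 1 along the solution because the mass is conserved. *)
Definition damp (m0 m : R) : R := (1 + m0 ^+ 2) / (1 + m ^+ 2).

Lemma damp_den (m : R) : 0 < 1 + m ^+ 2.
Proof. by apply: ltr_wpDr; rewrite ?sqr_ge0. Qed.

(** Scalar core of [damp_tri_lip]: X and Y are l^1 norms, mx and my masses, S the size of the
    window, D the l^1 distance. Since X^2 <= S mx and Y^2 <= S my, each power of a norm is traded
    for masses, which the denominators 1 + m^2 absorb. *)
Lemma damp_real (S mx my X Y D m0 : R) :
  0 <= S -> 0 <= mx -> 0 <= my -> my <= mx -> 0 <= X -> 0 <= Y -> 0 <= D ->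
  X ^+ 2 <= S * mx -> Y ^+ 2 <= S * my -> `|mx - my| <= D * (X + Y) ->
  damp m0 mx * ((X ^+ 2 + X * Y + Y ^+ 2) * D) +
    `|damp m0 mx - damp m0 my| * (Y * Y * Y) <=
  (1 + m0 ^+ 2) * (3 * S + 4 * S ^+ 2) * D.
Proof.
move=> S0 mx0 my0 yx X0 Y0 D0 hX hY hm.
set c0 := 1 + m0 ^+ 2; have c00 : 0 <= c0 by rewrite ltW// damp_den.
have hYx : Y ^+ 2 <= S * mx by apply: le_trans hY _; exact: ler_wpM2l.
have hXY : 2 * (X * Y) <= X ^+ 2 + Y ^+ 2 by have := sqr_ge0 (X - Y); rewrite sqrrB; lra.
have mlt (m : R) : 0 <= m -> m <= 1 + m ^+ 2 by move=> m00; have := sqr_ge0 (m - 1); nra.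
have t1 : damp m0 mx * ((X ^+ 2 + X * Y + Y ^+ 2) * D) <= c0 * (3 * S) * D.
  rewrite mulrA ler_wpM2r// /damp -/c0 mulrAC ler_pdivrMr ?damp_den// -mulrA ler_wpM2l//.
  apply: (@le_trans _ _ (3 * S * mx)); first by nra.
  by rewrite ler_wpM2l ?mlt// mulr_ge0.
have t2 : `|damp m0 mx - damp m0 my| * (Y * Y * Y) <= c0 * (4 * S ^+ 2) * D.
  have -> : damp m0 mx - damp m0 my = c0 * ((my - mx) * (mx + my)) / ((1 + mx ^+ 2) * (1 + my ^+ 2)).
    by rewrite /damp -/c0; field; rewrite !gt_eqF// damp_den.
  rewrite normrM normfV [`|_ * (1 + my ^+ 2)|]gtr0_norm ?mulr_gt0 ?damp_den//.
  rewrite mulrAC ler_pdivrMr ?mulr_gt0 ?damp_den// normrM (ger0_norm c00) -!mulrA ler_wpM2l//.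
  rewrite normrM distrC [`|mx + my|]ger0_norm ?addr_ge0//.
  have h1 : (X + Y) * (Y * (Y * Y)) <= 2 * S ^+ 2 * mx * my.
    have q1 : X * Y <= S * mx by lra.
    have q2 : (X * Y + Y ^+ 2) * Y ^+ 2 <= (2 * (S * mx)) * (S * my).
      by apply: ler_pM => //; [rewrite addr_ge0 ?mulr_ge0 ?sqr_ge0|exact: sqr_ge0|lra].
    have -> : (X + Y) * (Y * (Y * Y)) = (X * Y + Y ^+ 2) * Y ^+ 2 by ring.
    by apply: le_trans q2 _; apply: le_of_eq; ring.
  apply: (@le_trans _ _ (D * (2 * S ^+ 2 * mx * my) * (2 * mx))).
    have -> : `|mx - my| * (mx + my) * (Y * (Y * Y)) = (`|mx - my| * (Y * (Y * Y))) * (mx + my) by ring.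
    apply: ler_pM; rewrite ?addr_ge0 ?mulr_ge0//; last by lra.
    apply: le_trans (ler_wpM2r _ hm) _; first by rewrite !mulr_ge0.
    have -> : D * (X + Y) * (Y * (Y * Y)) = D * ((X + Y) * (Y * (Y * Y))) by ring.
    by rewrite ler_wpM2l.
  have -> : D * (2 * S ^+ 2 * mx * my) * (2 * mx) = (4 * S ^+ 2 * D) * (mx ^+ 2 * my) by ring.
  have -> : 4 * (S * (S * (D * ((1 + mx ^+ 2) * (1 + my ^+ 2))))) =
    (4 * S ^+ 2 * D) * ((1 + mx ^+ 2) * (1 + my ^+ 2)) by ring.
  apply: ler_wpM2l; first by rewrite !mulr_ge0 ?sqr_ge0.
  by apply: ler_pM; rewrite ?sqr_ge0 ?mlt// lerDr.
by apply: le_trans (lerD t1 t2) _; apply: le_of_eq; ring.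
Qed.

Lemma damp_tri_lip W m0 x y : uniq W ->
  n1 W (fun k => (damp m0 (mass W x))%:C * tri3 W x k -
                 (damp m0 (mass W y))%:C * tri3 W y k)
  <= (1 + m0 ^+ 2) * (3 * (size W)%:R + 4 * (size W)%:R ^+ 2) * n1 W (fun k => x k - y k).
Proof.
move=> uW.
(* The distance is symmetric in x and y; the order makes mx + my <= 2 mx in [damp_real]. *)
wlog yx : x y / mass W y <= mass W x.
  move=> h; have [/h//|/ltW /h] := leP (mass W y) (mass W x).
  have e f g : n1 W (fun k => f k - g k) = n1 W (fun k => g k - f k).
    by rewrite !n1E; apply: eq_bigr => k _; rewrite nm_distC.
  by rewrite e [X in _ -> _ <= _ * X]e.
have th0 (m : R) : 0 <= damp m0 m by rewrite /damp divr_ge0// ltW// damp_den.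
have -> : n1 W (fun k => (damp m0 (mass W x))%:C * tri3 W x k - (damp m0 (mass W y))%:C * tri3 W y k) =
  n1 W (fun k => (damp m0 (mass W x))%:C * (tri3 W x k - tri3 W y k) +
    (damp m0 (mass W x) - damp m0 (mass W y))%:C * tri3 W y k).
  by apply: eq_NW => k _; rewrite rmorphB; ring.
apply: le_trans (NWD _ _ _ (fun=> ler01)) _; rewrite !NWZ !nm_real (ger0_norm (th0 _)).
have w1 (a b c : int) : (1 : R) <= 1 * 1 * 1 by rewrite !mulr1.
have hd := @tri_diff R (fun=> 1) W W x y (fun=> ler01) w1 uW.
have hb := tri_bound W y y y (fun=> ler01) w1 uW.
apply: le_trans (lerD (ler_wpM2l (th0 _) hd) (ler_wpM2l (normr_ge0 _) hb)) _.
apply: damp_real; rewrite ?mass_ge0 ?n1_ge0 ?n1_sqr ?mass_lip ?ler0n//.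
Qed.

(** The Hamiltonian: the mean of conj(u) |D| u plus half the mean of |u|^4, for u with coefficients
    x in W. *)
Definition energy W x : R :=
  \sum_(k <- W) lam k * nm (x k) ^+ 2 + 2^-1 * complex.Re (quad W x x x x).

(** Mass is conserved for every real factor th, since [quad] is real on the diagonal. Applied to the
    damped system, this first forces th = 1, and only then is energy conservation available. *)
Lemma mass_energy_conserved W (u : R -> int -> R[i]) (th : R -> R) :
  (forall t k, k \in W -> is_cderive (u^~ k) t
     (- ('i%C * (lam k)%:C * u t k) + - ('i%C * ((th t)%:C * tri3 W (u t) k)))) ->
  (forall t, mass W (u t) = mass W (u 0)) /\
  ((forall t, th t = 1) -> forall t, energy W (u t) = energy W (u 0)).
Proof.
move=> hu; split.
  apply: deriv0_cst => t.
  set d := fun k => - ('i%C * (lam k)%:C * u t k) + - ('i%C * ((th t)%:C * tri3 W (u t) k)).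
  have h : is_derive t (1 : R) (fun s => mass W (u s)) (\sum_(k <- W) 2 * complex.Re (u t k * cj (d k))).
    by apply: (rder_sum (f := fun k s => nm (u s k) ^+ 2)) => k kW; apply: cder_nm2; exact: hu.
  apply: (rder_eq h); rewrite -big_distrr /= -Re_sum.
  have -> : \sum_(k <- W) u t k * cj (d k) =
     'i%C * (\sum_(k <- W) (lam k * nm (u t k) ^+ 2)%:C + (th t)%:C * cj (quad W (u t) (u t) (u t) (u t))).
    rewrite /quad rmorph_sum /= big_distrr -big_split /= big_distrr /=; apply: eq_bigr => k _.
    have -> : (lam k * nm (u t k) ^+ 2)%:C = (lam k)%:C * (u t k * cj (u t k)) :> R[i] by rewrite mulzJ -rmorphM.
    by rewrite /d cjD !cjN !cjM !conjcK cj_i !conjc_real; ring.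
  rewrite cReM /= mul0r add0r mul1r cImD Im_sum big1 // add0r cImM /= mul0r addr0 cImJ quad_real.
  by rewrite oppr0 mulr0 oppr0 mulr0.
move=> th1; apply: deriv0_cst => t.
set d := fun k => - ('i%C * (lam k)%:C * u t k) + - ('i%C * ((th t)%:C * tri3 W (u t) k)).
have h1 : is_derive t (1 : R) (fun s => \sum_(k <- W) lam k * nm (u s k) ^+ 2)
   (\sum_(k <- W) lam k * (2 * complex.Re (u t k * cj (d k)))).
  apply: (rder_sum (f := fun k s => lam k * nm (u s k) ^+ 2)) => k kW.
  by have := is_deriveZ (lam k) (cder_nm2 (hu t k kW)).
have h2 := is_deriveZ 2^-1 (@cder_quad R W u (fun _ => d) t (fun k kW => hu t k kW)).
apply: (rder_eq (is_deriveD h1 h2)).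
rewrite /GRing.scale /=.
have -> : \sum_(k <- W) lam k * (2 * complex.Re (u t k * cj (d k))) =
   2 * complex.Re (\sum_(k <- W) (lam k)%:C * u t k * cj (d k)).
  rewrite Re_sum big_distrr /=; apply: eq_bigr => k _.
  by rewrite -mulrA [in RHS]cReM /= mul0r subr0; ring.
(* The Hamiltonian structure: the gradient of the energy is i d, and its pairing with the velocity d
   is i |d|^2, which is purely imaginary. *)
have e : \sum_(k <- W) (lam k)%:C * u t k * cj (d k) + quad W (u t) (u t) (u t) d =
   'i%C * (\sum_(k <- W) nm (d k) ^+ 2)%:C.
  rewrite /quad -big_split rmorph_sum big_distrr /=; apply: eq_bigr => k _.
  rewrite -mulzJ /d th1; set z := tri3 _ _ _; set dd := cj _.
  have -> : 'i%C * ((- ('i%C * (lam k)%:C * u t k) + - ('i%C * (1%:C * z))) * dd) =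
    - ('i%C * 'i%C) * ((lam k)%:C * u t k + z) * dd by rewrite rmorph1; ring.
  by rewrite ii opprK mul1r; ring.
have -> : 2^-1 * (4 * complex.Re (quad W (u t) (u t) (u t) d)) = 2 * complex.Re (quad W (u t) (u t) (u t) d).
  by field.
by rewrite -mulrDr -cReD e cReM /= mul0r mulr0 subr0 mulr0.
Qed.

End Conservation.

Notation wave_rhs W x k := (- ('i%C * (lam _ k)%:C * x k) + - ('i%C * tri3 W x k)).

Section Galerkin.
Variable R : realType.
Local Notation lam := (@lam R).

Definition galerkin (N : nat) (u : R -> int -> R[i]) :=
  (forall t k, k \notin win N -> u t k = 0) /\
  (forall t k, k \in win N -> is_cderive (u^~ k) t (wave_rhs (win N) (u t) k)).

Lemma galerkin_exists (N : nat) (f0 : int -> R[i]) :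
  (forall k, k \notin win N -> f0 k = 0) ->
  exists u : R -> int -> R[i], [/\ u 0 = f0, galerkin N u,
    forall t, mass (win N) (u t) = mass (win N) f0 &
    forall t, energy (win N) (u t) = energy (win N) f0].
Proof.
move=> hf0; set W := win N; set m0 := mass W f0.
pose F x k : R[i] := if k \in W then - ('i%C * (lam k)%:C * x k) + - ('i%C * ((damp m0 (mass W x))%:C * tri3 W x k)) else 0.
pose L0 := (1 + m0 ^+ 2) * (3 * (size W)%:R + 4 * (size W)%:R ^+ 2).
have S0 : 0 <= (size W)%:R :> R by exact: ler0n.
have L00 : 0 <= L0.
  apply: mulr_ge0; first by rewrite ltW// damp_den.
  by apply: addr_ge0; rewrite mulr_ge0 ?sqr_ge0.
(* N bounds [lam] on the window and L0 the damped cubic term; the summand 1 secures 1 <= L. *)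
have := @picard R _ W F (1 + N%:R + L0) f0.
case.
- by move=> x k /negbTE kW; rewrite /F kW.
- by rewrite -addrA lerDl addr_ge0// ler0n.
- move=> x y; have := damp_tri_lip m0 x y (uniq_win N); rewrite -/W -/L0 => hl.
  rewrite -!n1E.
  have -> : n1 W (fun k => F x k - F y k) = n1 W (fun k => - ('i%C * ((lam k)%:C * (x k - y k))) +
     - ('i%C * ((damp m0 (mass W x))%:C * tri3 W x k - (damp m0 (mass W y))%:C * tri3 W y k))).
    by apply: eq_NW => k kW; rewrite /F kW; ring.
  apply: le_trans (NWD _ _ _ (fun=> ler01)) _; rewrite !NWN !NWZ nm_i !mul1r mulrDl.
  apply: lerD => //.
  rewrite /NW big_distrr /= big_seq [leRHS]big_seq; apply: ler_sum => k; rewrite mem_win => kN.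
  rewrite nmM nm_real !mul1r ler_wpM2r ?nm_ge0// ger0_norm ?lam_ge0//.
  have : lam k <= N%:R by rewrite /lam (_ : N%:R = (Posz N)%:~R :> R) // ler_int; lia.
  lra.
move=> u [u0 hu].
have huW (t : R) k : k \in W -> is_cderive (u^~ k) t (- ('i%C * (lam k)%:C * u t k) +
    - ('i%C * ((damp m0 (mass W (u t)))%:C * tri3 W (u t) k))).
  by move=> kW; have := hu t k; rewrite /F kW.
have [hm he] := mass_energy_conserved huW.
have hm' t : mass W (u t) = m0 by rewrite hm u0.
have d1 t : damp m0 (mass W (u t)) = 1.
  by rewrite hm' /damp divff// gt_eqF// ltr_wpDr ?sqr_ge0.
exists u; split => //; last by move=> t; rewrite he ?u0.
split=> t k kW; last by apply: cder_eq (huW t k kW); rewrite d1 rmorph1 mul1r.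
have h s : is_cderive (u^~ k) s 0 by have := hu s k; rewrite /F (negbTE kW).
have hd (P : R[i] -> R) : (forall s : R, is_derive s 1 (fun s => P (u s k)) 0) -> P (u t k) = P 0.
  by move=> hP; rewrite -(hf0 _ kW) -u0; exact: (deriv0_cst hP).
by apply: eq_ReIm; [apply: (hd (@complex.Re R))|apply: (hd (@complex.Im R))] => s; case: (h s).
Qed.

End Galerkin.

(** * Uniform bounds and convergence of the Galerkin solutions *)

Section APriori.
Variable R : realType.
Implicit Types (f g h : int -> R[i]) (W V : seq int).
Local Notation lam := (@lam R).

(** Chosen in place of the square root of 1 + k^2, which it dominates, because 1 + |k| is plainly
    submultiplicative. *)
Definition jap (k : int) : R := 1 + lam k.

Lemma jap_ge1 k : 1 <= jap k.
Proof. by rewrite /jap lerDl lam_ge0. Qed.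

Lemma jap_gt0 k : 0 < jap k.
Proof. exact: lt_le_trans ltr01 (jap_ge1 k). Qed.

Lemma jap_ge0 k : 0 <= jap k.
Proof. exact: ltW (jap_gt0 k). Qed.

Lemma lam_tri a b c : lam (a - b + c) <= lam a + lam b + lam c.
Proof. by rewrite /lam -!rmorphD /= ler_int; lia. Qed.

Lemma NWjap_ge0 W f : 0 <= NW jap W f.
Proof. by apply: NW_ge0; exact: jap_ge0. Qed.

Lemma jap_submul a b c : jap (a - b + c) <= jap a * jap b * jap c.
Proof.
have := lam_tri a b c; rewrite /jap.
have := lam_ge0 R a; have := lam_ge0 R b; have := lam_ge0 R c.
move: (lam a) (lam b) (lam c) (lam (a - b + c)) => x y z w z0 y0 x0 h.
have xy : 0 <= x * y by exact: mulr_ge0.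
have xyz : 0 <= x * y * z by exact: mulr_ge0.
have xz : 0 <= x * z by exact: mulr_ge0.
have yz : 0 <= y * z by exact: mulr_ge0.
nra.
Qed.

(** The weight of a - b + c is at most the sum of the three weights, so the bound is linear in the
    strong norm. Its other factor, the plain l^1 norm, grows only logarithmically in the strong
    norm. *)
Lemma jap_tame W V f : uniq V ->
  NW jap V (tri3 W f) <= 3 * n1 W f ^+ 2 * NW jap W f.
Proof.
move=> uV.
have -> : 3 * n1 W f ^+ 2 * NW jap W f = \sum_(a <- W) \sum_(b <- W) \sum_(c <- W)
    (jap a + jap b + jap c) * (nm (f a) * nm (f b) * nm (f c)).
  transitivity (\sum_(a <- W) \sum_(b <- W) \sum_(c <- W)
    (jap a * nm (f a) * (nm (f b) * nm (f c)) + (nm (f a) * (jap b * nm (f b) * nm (f c)) +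
      nm (f a) * (nm (f b) * (jap c * nm (f c)))))); last first.
    by apply: eq_bigr => a _; apply: eq_bigr => b _; apply: eq_bigr => c _; ring.
  under [RHS]eq_bigr do under eq_bigr do rewrite !big_split /= -!big_distrr /=.
  under [RHS]eq_bigr do rewrite !big_split /= -!big_distrr /= -!big_distrl /=.
  rewrite !big_split /= -!big_distrl /= -!n1E -/(NW jap W f); ring.
apply: tri_bound_gen => //; first exact: jap_ge0.
move=> a b c; have := lam_tri a b c; rewrite /jap; have := lam_ge0 R a; lra.
Qed.

(** Induction on M, each step being ln (1 - x) <= - x at x = 1 / (2 + M). *)
Lemma harmonic_log (M : nat) : \sum_(k <- win M) (jap k)^-1 <= 1 + 2 * ln (1 + M%:R : R).
Proof.
elim: M => [|M IH].
  by rewrite big_seq1 /jap /lam subr0 normr0 addr0 invr1 ln1 mulr0 addr0.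
have e1 : jap M.+1%:Z = 2 + M%:R.
  by rewrite /jap /lam -[2]/(1 + 1) -addrA; congr (1 + _); rewrite ger0_norm// (_ : (M.+1%:Z)%:~R = M.+1%:R :> R)// -natr1 addrC.
have e2 : jap (- M.+1%:Z) = 2 + M%:R by rewrite -e1 /jap /lam normrN.
have -> : \sum_(k <- win M.+1) (jap k)^-1 =
    (2 + M%:R)^-1 + ((2 + M%:R)^-1 + \sum_(k <- win M) (jap k)^-1).
  by rewrite (perm_big _ (perm_winS M)) 2!big_cons e1 e2.
rewrite addrA.
have M0 : 0 < 2 + M%:R :> R by rewrite ltr_wpDr.
have e3 : 1 + M.+1%:R = 2 + M%:R :> R by rewrite -natr1; ring.
have h : (2 + M%:R)^-1 + ln (1 + M%:R) <= ln (1 + M.+1%:R : R).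
  rewrite e3; have -> : 1 + M%:R = (2 + M%:R) * (1 + - (2 + M%:R)^-1) :> R.
    by field; rewrite gt_eqF.
  have i1 : (2 + M%:R)^-1 < 1 :> R.
    by rewrite invf_lt1// (@lt_le_trans _ _ 2) ?ltr1n// lerDl.
  rewrite lnM ?posrE// ?subr_gt0//.
  have := @le_ln1Dx R (- (2 + M%:R)^-1); rewrite ltrN2 => /(_ i1); lra.
by apply: le_trans (lerD (lexx _) IH) _; lra.
Qed.

(* Cauchy-Schwarz with the energy on |k| <= M, the weighted norm beyond. *)
Lemma n1_log W f (E0 : R) (M : nat) : uniq W ->
  \sum_(k <- W) jap k * nm (f k) ^+ 2 <= E0 ->
  n1 W f ^+ 2 <= 2 * (E0 * (1 + 2 * ln (1 + M%:R))) + 2 * (NW jap W f / (1 + M%:R)) ^+ 2.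
Proof.
move=> uW hE.
have E00 : 0 <= E0 by apply: le_trans hE; apply: sumr_ge0 => k _; rewrite mulr_ge0 ?sqr_ge0 ?jap_ge0.
have M0 : 0 < 1 + M%:R :> R by rewrite ltr_wpDr.
rewrite n1E (bigID (fun k => k \in win M)) /=.
set A := \sum_(_ <- _ | _) _; set B := \sum_(_ <- _ | _) _.
have hA : A ^+ 2 <= E0 * (1 + 2 * ln (1 + M%:R)).
  have -> : A = \sum_(k <- [seq k <- W | k \in win M]) Num.sqrt (jap k) * nm (f k) * (Num.sqrt (jap k))^-1.
    rewrite big_filter; apply: eq_bigr => k _; rewrite mulrAC divff ?mul1r//.
    by rewrite gt_eqF// sqrtr_gt0 jap_gt0.
  apply: le_trans (cauchy_schwarz_sum _ _ _) _; apply: ler_pM.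
  - by apply: sumr_ge0 => k _; exact: sqr_ge0.
  - by apply: sumr_ge0 => k _; exact: sqr_ge0.
  - apply: le_trans hE; rewrite big_filter [leRHS](bigID (fun k => k \in win M)) /=.
    apply: (@le_trans _ _ (\sum_(k <- W | k \in win M) jap k * nm (f k) ^+ 2)).
      by apply: ler_sum => k _; rewrite exprMn sqr_sqrtr// jap_ge0.
    by rewrite lerDl sumr_ge0// => k _; rewrite mulr_ge0 ?sqr_ge0 ?jap_ge0.
  - apply: le_trans (harmonic_log M).
    have -> : \sum_(k <- [seq k <- W | k \in win M]) (Num.sqrt (jap k))^-1 ^+ 2 =
       \sum_(k <- [seq k <- W | k \in win M]) (jap k)^-1.
      by apply: eq_bigr => k _; rewrite exprVn sqr_sqrtr// jap_ge0.
    have conv V : \sum_(k <- V) (jap k)^-1 = NW (fun k => (jap k)^-1) V (fun=> 1).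
      by apply: eq_bigr => k _; rewrite nm1 mulr1.
    rewrite !conv; apply: NW_sub; [|exact: filter_uniq|exact: uniq_win|].
      by move=> k; rewrite invr_ge0 jap_ge0.
    by move=> k; rewrite mem_filter => /andP[].
have hB : B <= NW jap W f / (1 + M%:R).
  rewrite ler_pdivlMr// /B big_distrl /= /NW [leRHS](bigID (fun k => k \in win M)) /=.
  rewrite -[leLHS]add0r; apply: lerD.
    by apply: sumr_ge0 => k _; rewrite mulr_ge0 ?nm_ge0 ?jap_ge0.
  apply: ler_sum => k; rewrite mem_win -ltnNge mulrC => Mk; rewrite ler_wpM2r ?nm_ge0// /jap lerD2l.
  by rewrite /lam (_ : M%:R = (Posz M)%:~R :> R) // ler_int; lia.
have A0 : 0 <= A by apply: sumr_ge0 => k _; exact: nm_ge0.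
have B0 : 0 <= B by apply: sumr_ge0 => k _; exact: nm_ge0.
have hB2 : B ^+ 2 <= (NW jap W f / (1 + M%:R)) ^+ 2.
  by rewrite ler_pXn2r ?nnegrE// (le_trans B0 hB).
by have := sqr_ge0 (A - B); rewrite sqrrB sqrrD; move: hA hB2; lra.
Qed.

(** The solution of y' = a y ln y with a = 6 (5 E0 + 1) and ln y(0) = c, the equation to which the
    logarithmic inequality leads. *)
Definition ybound (E0 c : R) (t : R) : R := expR (c * expR (6 * (5 * E0 + 1) * t)).

Lemma tri_growth W V f (E0 c t : R) : uniq W -> uniq V -> 1 <= c -> 0 <= t ->
  \sum_(k <- W) jap k * nm (f k) ^+ 2 <= E0 ->
  NW jap W f <= ybound E0 c t ->
  NW jap V (tri3 W f) <= 6 * (5 * E0 + 1) * (c * expR (6 * (5 * E0 + 1) * t)) * ybound E0 c t.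
Proof.
move=> uW uV c1 t0 hE hX.
have E00 : 0 <= E0 by apply: le_trans hE; apply: sumr_ge0 => k _; rewrite mulr_ge0 ?sqr_ge0 ?jap_ge0.
set X := NW jap W f in hX *.
have X0 : 0 <= X by exact: NWjap_ge0.
set z := c * expR _.
have z1 : 1 <= z.
  rewrite /z -[1]mulr1; apply: ler_pM => //.
  by rewrite -[leLHS]expR0 ler_expR !mulr_ge0 ?addr_ge0 ?mulr_ge0.
have yE : ybound E0 c t = expR z by [].
(* Cutting at M = trunc X makes the high-frequency term at most 1, while ln (1 + M) stays below 1 +
   z. *)
have /andP[m1 m2] := truncn_itv X0.
set M := Num.trunc X in m1 m2.
have M0 : 0 < 1 + M%:R :> R by rewrite ltr_wpDr.
have hn := n1_log M uW hE.
have h1 : X / (1 + M%:R) <= 1 by rewrite ler_pdivrMr// mul1r addrC natr1 ltW.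
have h1' : (X / (1 + M%:R)) ^+ 2 <= 1.
  by rewrite expr_le1// divr_ge0// ltW.
have h2 : ln (1 + M%:R) <= 1 + z.
  have y1 : 1 <= expR z by rewrite -expR0 ler_expR (le_trans _ z1).
  apply: (@le_trans _ _ (ln (2 * expR z))).
    rewrite ler_ln ?posrE ?mulr_gt0 ?expR_gt0//.
    by move: m1 hX y1; rewrite yE; lra.
  rewrite lnM ?posrE ?expR_gt0// expRK lerD2r.
  by have := @le_ln1Dx R 1; rewrite -[1 + 1]/(2); apply; lra.
have hn1 : n1 W f ^+ 2 <= 2 * (5 * E0 + 1) * z.
  apply: le_trans hn _.
  have : E0 * (1 + 2 * ln (1 + M%:R)) <= E0 * (5 * z) by apply: ler_wpM2l => //; lra.
  by move: h1'; rewrite -/X; nra.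
apply: le_trans (jap_tame _ _ uV) _; rewrite -/X.
apply: ler_pM => //; first by rewrite mulr_ge0 ?sqr_ge0.
by move: hn1; lra.
Qed.

Lemma ybound_deriv (E0 c t : R) : is_derive t 1 (ybound E0 c)
  (6 * (5 * E0 + 1) * (c * expR (6 * (5 * E0 + 1) * t)) * ybound E0 c t).
Proof.
have h := cexpR_deriv c (6 * (5 * E0 + 1)) t.
have := @is_derive1_comp R expR _ t _ _ (is_derive_expR _) h.
by move=> h'; apply: (rder_eq h'); rewrite mulrC.
Qed.

Lemma ybound_mono (E0 c : R) : 0 <= E0 -> 0 <= c -> {homo ybound E0 c : s t / s <= t}.
Proof.
move=> E00 c0 s t st; rewrite /ybound ler_expR ler_wpM2l// ler_expR ler_wpM2l//.
by rewrite !mulr_ge0 ?addr_ge0 ?mulr_ge0.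
Qed.

Lemma galerkin_bound N u (E0 c : R) : galerkin N u -> 1 <= c ->
  (forall t, \sum_(k <- win N) jap k * nm (u t k) ^+ 2 <= E0) ->
  NW jap (win N) (u 0) < expR c ->
  forall t, NW jap (win N) (u t) <= ybound E0 c `|t|.
Proof.
move=> [_ hu] c1 hE h0 t; apply: ltW.
apply: (comparison_abs (lam := lam) (g := fun s k => - ('i%C * tri3 (win N) (u s) k))
  (y' := fun t => 6 * (5 * E0 + 1) * (c * expR (6 * (5 * E0 + 1) * t)) * ybound E0 c t) (T := `|t|)) => //.
- exact: jap_ge0.
- by move=> s k _; exact: hu.
- by move=> s _; exact: ybound_deriv.
- move=> s st hs; rewrite -/(NW jap (win N) (fun k => _)) NWN NWZ nm_i mul1r.
  exact: tri_growth (uniq_win N) (uniq_win N) c1 (normr_ge0 _) (hE s) hs.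
- by rewrite /ybound mulr0 expR0 mulr1.
Qed.

Lemma win_sub N M : (N <= M)%N -> {subset win N <= win M}.
Proof. by move=> NM k; rewrite !mem_win => /leq_trans; exact. Qed.

Lemma n1_term W f k : k \in W -> nm (f k) <= n1 W f.
Proof. by move=> kW; have := NW_term f (fun=> ler01) kW; rewrite mul1r. Qed.

Lemma n1_jap W f : n1 W f <= NW jap W f.
Proof. by apply: ler_sum => k _; rewrite ler_wpM2r ?nm_ge0 ?jap_ge1. Qed.

Lemma tri_lip (w : int -> R) W V f g (B : R) : (forall k, 0 <= w k) ->
  (forall a b c, w (a - b + c) <= w a * w b * w c) -> uniq V ->
  NW w W f <= B -> NW w W g <= B ->
  NW w V (fun k => tri3 W f k - tri3 W g k) <= 3 * B ^+ 2 * NW w W (fun k => f k - g k).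
Proof.
move=> w0 wM uV hf hg; apply: le_trans (tri_diff _ _ _ w0 wM uV) _.
apply: ler_wpM2r; first exact: NW_ge0.
have f0 := NW_ge0 W f w0; have g0 := NW_ge0 W g w0.
have B0 := le_trans f0 hf.
have h1 : NW w W f ^+ 2 <= B ^+ 2 by rewrite ler_pXn2r ?nnegrE.
have h2 : NW w W g ^+ 2 <= B ^+ 2 by rewrite ler_pXn2r ?nnegrE.
have h3 : NW w W f * NW w W g <= B * B by exact: ler_pM.
by move: h1 h2 h3; rewrite !expr2; lra.
Qed.

(** uN solves the larger system up to the output modes |k| > N. There the weight exceeds 1 + N, so a
    bound in the weighted norm gains a factor 1 / (1 + N) in plain l^1. *)
Lemma galerkin_cauchy N M uN uM (B T : R) : (N <= M)%N -> galerkin N uN -> galerkin M uM ->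
  uN 0 = uM 0 -> 0 <= B ->
  (forall t, `|t| <= T -> NW jap (win N) (uN t) <= B) ->
  (forall t, `|t| <= T -> NW jap (win M) (uM t) <= B) ->
  forall t, `|t| <= T ->
    n1 (win M) (fun k => uM t k - uN t k) <= (1 + N%:R)^-1 * expR ((3 * B ^+ 2 + B ^+ 3) * T).
Proof.
move=> NM [zN dN] [zM dM] e0 B0 hN hM t tT.
have T0 : 0 <= T by exact: le_trans (normr_ge0 t) tT.
set c := 3 * B ^+ 2 + B ^+ 3.
have c0 : 0 <= c by rewrite addr_ge0 ?mulr_ge0 ?exprn_ge0.
have N0 : 0 < 1 + N%:R :> R by rewrite ltr_wpDr.
have uv := uniq_win.
have NMs := win_sub NM.
have hNM s : `|s| <= T -> NW jap (win M) (uN s) <= B.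
  move=> sT; rewrite /NW (sum_supp (uv N) (uv M) NMs); first exact: hN.
  by move=> k kN; rewrite zN// nm0 mulr0.
have triN s k : tri3 (win N) (uN s) k = tri3 (win M) (uN s) k.
  by rewrite (tri_supp _ (uv N) (uv M) NMs) //; exact: zN.
(* The part of the cubic term of uN that its own truncation discards. *)
pose r s k := if k \in win N then 0 else tri3 (win M) (uN s) k.
pose g s k := - ('i%C * ((tri3 (win M) (uM s) k - tri3 (win M) (uN s) k) + r s k)).
apply: (@le_trans _ _ ((1 + N%:R)^-1 * expR (c * `|t|))); last first.
  by rewrite ler_wpM2l ?invr_ge0 ?(ltW N0)// ler_expR ler_wpM2l.
apply: ltW; apply: (comparison_abs (w := fun=> 1) (lam := lam) (g := g) (q := fun s k => uM s k - uN s k)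
  (y := fun s => (1 + N%:R)^-1 * expR (c * s)) (y' := fun s => c * ((1 + N%:R)^-1 * expR (c * s))) (T := T)) => //.
- move=> s k sT kM; have [kN|kN] := boolP (k \in win N).
    apply: cder_eq (cderB (dM s k kM) (dN s k kN)).
    by rewrite /g /r kN triN; ring.
  have hz : is_cderive (uN^~ k) s 0.
    by apply: cder_ext (cder_cst 0 s) => x; rewrite zN.
  apply: cder_eq (cderB (dM s k kM) hz).
  by rewrite /g /r (negbTE kN) (zN s k kN); ring.
- by move=> s _; exact: cexpR_deriv.
- move=> s sT hs; rewrite -/(NW (fun=> 1) (win M) (g s)) /g NWN NWZ nm_i mul1r.
  apply: le_trans (NWD _ _ _ (fun=> ler01)) _.
  have w1 (x y z : int) : (1 : R) <= 1 * 1 * 1 by rewrite !mulr1.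
  have h1 := @tri_lip (fun=> 1) (win M) (win M) (uM s) (uN s) B (fun=> ler01) w1 (uv M)
    (le_trans (n1_jap _ _) (hM s sT)) (le_trans (n1_jap _ _) (hNM s sT)).
  have h2 : NW (fun=> 1) (win M) (r s) <= (1 + N%:R)^-1 * B ^+ 3.
    apply: (@le_trans _ _ ((1 + N%:R)^-1 * NW jap (win M) (tri3 (win M) (uN s)))).
      rewrite /NW big_distrr /=; apply: ler_sum => k _; rewrite /r; case: ifPn => kN.
        by rewrite nm0 mulr0 !mulr_ge0 ?invr_ge0 ?nm_ge0 ?jap_ge0 ?ltW.
      rewrite mulrA ler_wpM2r ?nm_ge0// mulrC ler_pdivlMr// mul1r /jap lerD2l.
      by move: kN; rewrite mem_win -ltnNge /lam (_ : N%:R = (Posz N)%:~R :> R)// ler_int; lia.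
    rewrite ler_wpM2l ?invr_ge0 ?(ltW N0)//.
    apply: le_trans (tri_bound _ _ _ _ jap_ge0 jap_submul (uv M)) _.
    have p0 : 0 <= NW jap (win M) (uN s) by exact: NWjap_ge0.
    by rewrite !exprS expr0 mulr1 mulrA; apply: ler_pM; rewrite ?mulr_ge0 ?hNM//; apply: ler_pM; rewrite ?hNM.
  apply: le_trans (lerD h1 h2) _.
  rewrite -/(NW (fun=> 1) (win M) (fun k => uM s k - uN s k)) in hs.
  have E1 : 1 <= expR (c * `|s|) by rewrite -[leLHS]expR0 ler_expR mulr_ge0.
  move: (expR (c * `|s|)) hs E1 => E hs E1.
  (* The two parts of c: 3 B^2 for the Lipschitz term, and B^3 for the discarded modes, using E >=
     1. *)
  have -> : c * ((1 + N%:R)^-1 * E) =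
    3 * B ^+ 2 * ((1 + N%:R)^-1 * E) + (1 + N%:R)^-1 * B ^+ 3 * E by rewrite /c; ring.
  apply: lerD; first by rewrite ler_wpM2l ?mulr_ge0 ?exprn_ge0.
  by rewrite ler_peMr// mulr_ge0 ?exprn_ge0// invr_ge0 ltW.
- rewrite mulr0 expR0 mulr1 big1 ?invr_gt0// => k _.
  by rewrite e0 subrr nm0 mulr0.
Qed.

(** Windows start at N0 so that each contains the support of the datum. Y bounds the weighted norm
    uniformly in n, K gives the Cauchy rate; monotonicity in |t| makes both locally uniform in
    time. *)
Definition galerkin_family (N0 : nat) f0 (u : nat -> R -> int -> R[i]) (Y K : R -> R) :=
  [/\ forall n, galerkin (n + N0) (u n), forall n, u n 0 = f0,
    {in Num.nneg &, {homo Y : s t / s <= t}} /\ {in Num.nneg &, {homo K : s t / s <= t}},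
    forall n t, NW jap (win (n + N0)) (u n t) <= Y `|t| &
    forall n m t, (n <= m)%N -> n1 (win (m + N0)) (fun k => u m t k - u n t k) <= K `|t| / n.+1%:R].

Lemma galerkin_family_exists (N0 : nat) f0 : (forall k, k \notin win N0 -> f0 k = 0) ->
  exists u Y K, galerkin_family N0 f0 u Y K.
Proof.
move=> hf0.
have hs n : {subset win N0 <= win (n + N0)} by apply: win_sub; rewrite leq_addl.
have hf0n n k : k \notin win (n + N0) -> f0 k = 0.
  by move=> kn; apply: hf0; apply: contra kn; exact: hs.
have hsupp n (F : int -> R) : (forall k, k \notin win N0 -> F k = 0) ->
    \sum_(k <- win (n + N0)) F k = \sum_(k <- win N0) F k.
  by move=> hF; apply: sum_supp => //; exact: uniq_win.
have [u hu] := choice (fun n => galerkin_exists (hf0n n)).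
(* Independent of the window because f0 is supported in win N0. It controls the sum of jap k |u_k|^2
   because the quartic part of the energy is nonnegative (defocusing sign). *)
pose E0 := mass (win N0) f0 + energy (win N0) f0.
have hE n t : \sum_(k <- win (n + N0)) jap k * nm (u n t k) ^+ 2 <= E0.
  have [u0 hg hm he] := hu n.
  have -> : E0 = mass (win (n + N0)) f0 + energy (win (n + N0)) f0.
    congr (_ + _); first by rewrite /mass hsupp// => k kN; rewrite hf0// nm0 expr0n.
    rewrite /energy hsupp => [|k kN]; last by rewrite hf0// nm0 expr0n mulr0.
    congr (_ + _ * complex.Re _); rewrite /quad.
    rewrite [RHS](sum_supp (uniq_win N0) (uniq_win (n + N0)) (hs n)) => [|k kN]; last first.
      by rewrite hf0// rmorph0 mulr0.
    by apply: eq_bigr => k _; rewrite (tri_supp _ (uniq_win N0) (uniq_win (n + N0)) (hs n)).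
  rewrite -(hm t) -(he t) /mass /energy addrA -big_split /=.
  have -> : \sum_(k <- win (n + N0)) jap k * nm (u n t k) ^+ 2 =
    \sum_(k <- win (n + N0)) (nm (u n t k) ^+ 2 + lam k * nm (u n t k) ^+ 2).
    by apply: eq_bigr => k _; rewrite /jap mulrDl mul1r.
  by rewrite lerDl mulr_ge0 ?quad_ge0.
have E00 : 0 <= E0.
  by apply: le_trans (hE 0%N 0); apply: sumr_ge0 => k _; rewrite mulr_ge0 ?sqr_ge0 ?jap_ge0.
pose c := 1 + NW jap (win N0) f0.
have c1 : 1 <= c by rewrite lerDl NWjap_ge0.
have c0 : 0 <= c by exact: le_trans c1.
pose Y := ybound E0 c.
have Y0 t : 0 <= Y t by exact: expR_ge0.
have hY n t : NW jap (win (n + N0)) (u n t) <= Y `|t|.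
  have [u0 hg hm he] := hu n.
  apply: galerkin_bound hg c1 (hE n) _ t.
  rewrite u0 /NW hsupp => [|k kN]; last by rewrite hf0// nm0 mulr0.
  apply: (@lt_le_trans _ _ c); first by rewrite /c ltrDr.
  by have := expR_ge1Dx c; lra.
pose K t := expR ((3 * Y t ^+ 2 + Y t ^+ 3) * t).
have mY : {homo Y : s t / s <= t} by exact: ybound_mono.
exists u, Y, K; split => //.
- by move=> n; case: (hu n).
- by move=> n; case: (hu n).
- split; first by move=> s t _ _; exact: mY.
  move=> s t; rewrite !nnegrE => s0 t0 st; rewrite /K ler_expR.
  apply: ler_pM => //; first by rewrite addr_ge0 ?mulr_ge0 ?exprn_ge0.
  by apply: lerD; [rewrite ler_wpM2l//|]; rewrite ler_pXn2r ?nnegrE ?mY.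
- move=> n m t nm_; have [un gn _ _] := hu n; have [um gm _ _] := hu m.
  have hYt k s : `|s| <= `|t| -> NW jap (win (k + N0)) (u k s) <= Y `|t|.
    by move=> st; apply: le_trans (hY k s) _; exact: mY.
  have nm2 : (n + N0 <= m + N0)%N by rewrite leq_add2r.
  apply: le_trans (galerkin_cauchy nm2 gn gm _ (Y0 _) (hYt n) (hYt m) (lexx _)) _.
    by rewrite un um.
  rewrite mulrC ler_wpM2l ?expR_ge0// lef_pV2 ?posrE ?ltr_wpDr//.
  by rewrite addrC natr1 ler_nat ltnS leq_addr.
Qed.

End APriori.

(** * Fourier coefficients of continuous functions *)

Section Fourier.
Variable R : realType.
Implicit Types (f g : int -> R[i]) (W V : seq int) (u v : R -> R[i]).
Local Notation mu := (@lebesgue_measure R).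
Local Notation I2 := (`[(0 : R), pi *+ 2]%classic).

Definition rcont (f : R -> R) := forall x : R, {for x, continuous f}.

Definition ccont u := rcont (fun y => complex.Re (u y)) /\ rcont (fun y => complex.Im (u y)).

Lemma rcont_ext (f g : R -> R) : f =1 g -> rcont f -> rcont g.
Proof. by move=> /funext ->. Qed.

Lemma cont_integrable (f : R -> R) : (forall x : R, {for x, continuous f}) ->
  mu.-integrable I2 (EFin \o f).
Proof.
move=> cf; apply: continuous_compact_integrable; first exact: segment_compact.
exact: continuous_subspaceT.
Qed.

Lemma pi2_gt0 : 0 < pi *+ 2 :> R.
Proof. by rewrite mulrn_wgt0// pi_gt0. Qed.

Lemma mu_I2 : fine (mu I2) = pi *+ 2.
Proof. by rewrite lebesgue_measure_itv/= lte_fin pi2_gt0 -EFinB subr0. Qed.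

Lemma cder_ccont u : (forall x, exists d, is_cderive u x d) -> ccont u.
Proof.
by move=> h; split=> x; have [d [d1 d2]] := h x; [exact: deriv_continuous d1|exact: deriv_continuous d2].
Qed.

Lemma ccont_uniform (w : nat -> R -> R[i]) u (e : nat -> R) : e @ \oo --> (0 : R) ->
  (forall n, ccont (w n)) -> (forall n x, nm (u x - w n x) <= e n) -> ccont u.
Proof.
move=> e0 cw h.
have key (P : R[i] -> R) : (forall z y, `|P z - P y| <= nm (z - y)) ->
   (forall n (x : R), {for x, continuous (fun y => P (w n y))}) ->
   forall x : R, {for x, continuous (fun y => P (u y))}.
  move=> hP hw x; apply/cvgrPdist_le => d d0.
  have d3 : 0 < d / 3 by rewrite divr_gt0.
  have /cvgrPdist_le/(_ _ d3)[n _ /(_ n (leqnn n))] := e0; rewrite sub0r normrN => en.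
  have := hw n x; move/cvgrPdist_le => /(_ _ d3).
  apply: filterS => y hy.
  have b z : `|P (u z) - P (w n z)| <= d / 3.
    by apply: le_trans (hP _ _) _; apply: le_trans (h n z) _; apply: le_trans (ler_norm _) en.
  have -> : P (u x) - P (u y) = (P (u x) - P (w n x)) + (P (w n x) - P (w n y)) + (P (w n y) - P (u y)) by ring.
  have b2 : `|P (w n y) - P (u y)| <= d / 3 by rewrite distrC.
  apply: le_trans (ler_normD _ _) _; apply: le_trans (lerD (ler_normD _ _) b2) _.
  by have := b x; move: hy => /= hy bx; lra.
split; apply: key => [z y|n x].
- by rewrite -cReN -cReD nm_Re.
- by case: (cw n).
- by rewrite -cImN -cImD nm_Im.
- by case: (cw n).
Qed.

Lemma ccontD u v : ccont u -> ccont v -> ccont (fun x => u x + v x).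
Proof.
move=> [u1 u2] [v1 v2]; split.
- apply: (rcont_ext (f := fun x => complex.Re (u x) + complex.Re (v x))).
    by move=> x; rewrite cReD.
  by move=> x; apply: continuousD; [exact: u1|exact: v1].
- apply: (rcont_ext (f := fun x => complex.Im (u x) + complex.Im (v x))).
    by move=> x; rewrite cImD.
  by move=> x; apply: continuousD; [exact: u2|exact: v2].
Qed.

Lemma ccontM u v : ccont u -> ccont v -> ccont (fun x => u x * v x).
Proof.
move=> [u1 u2] [v1 v2]; split.
- apply: (rcont_ext (f := fun x => complex.Re (u x) * complex.Re (v x) - complex.Im (u x) * complex.Im (v x))).
    by move=> x; rewrite cReM.
  move=> x; apply: continuousB; apply: continuousM;
    by [exact: u1|exact: v1|exact: u2|exact: v2].
- apply: (rcont_ext (f := fun x => complex.Re (u x) * complex.Im (v x) + complex.Im (u x) * complex.Re (v x))).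
    by move=> x; rewrite cImM.
  move=> x; apply: continuousD; apply: continuousM;
    by [exact: u1|exact: v1|exact: u2|exact: v2].
Qed.

Lemma ccont_cst (z : R[i]) : ccont (fun=> z).
Proof. by split => x; exact: cst_continuous. Qed.

Lemma ccont_conj u : ccont u -> ccont (fun x => cj (u x)).
Proof.
move=> [u1 u2]; split.
- by apply: rcont_ext u1 => x; rewrite cReJ.
- apply: (rcont_ext (f := fun x => - complex.Im (u x))).
    by move=> x; rewrite cImJ.
  by move=> x; apply: continuousN; exact: u2.
Qed.

Lemma ccont_expi (a : R) : ccont (fun x => expi (a * x)).
Proof. by apply: cder_ccont => x; eexists; exact: cder_expi. Qed.

Lemma ccont_sum (I : Type) (r : seq I) (w : I -> R -> R[i]) :
  (forall i, ccont (w i)) -> ccont (fun x => \sum_(i <- r) w i x).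
Proof.
move=> h; elim: r => [|a r IH].
  by under eq_fun do rewrite big_nil; exact: ccont_cst.
by under eq_fun do rewrite big_cons; exact: ccontD.
Qed.

Lemma torus_integralD u v : ccont u -> ccont v ->
  torus_integral (fun x => u x + v x) = torus_integral u + torus_integral v.
Proof.
move=> [u1 u2] [v1 v2]; rewrite /torus_integral; apply: eq_ReIm => /=.
  under eq_Rintegral do rewrite cReD.
  by rewrite RintegralD//; exact: cont_integrable.
under eq_Rintegral do rewrite cImD.
by rewrite RintegralD//; exact: cont_integrable.
Qed.

Lemma torus_integralZ (z : R[i]) u : ccont u ->
  torus_integral (fun x => z * u x) = z * torus_integral u.
Proof.
move=> [u1 u2]; rewrite /torus_integral; apply: eq_ReIm.
  rewrite cReM /=; under eq_Rintegral do rewrite cReM.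
  rewrite RintegralB//; try (apply: cont_integrable => x; apply: continuousM; [exact: cst_continuous|by []]).
  by rewrite !RintegralZl//; exact: cont_integrable.
rewrite cImM /=; under eq_Rintegral do rewrite cImM.
rewrite RintegralD//; try (apply: cont_integrable => x; apply: continuousM; [exact: cst_continuous|by []]).
by rewrite !RintegralZl//; exact: cont_integrable.
Qed.

Lemma torus_integral0 : torus_integral (fun _ : R => 0) = 0.
Proof.
transitivity (0 * torus_integral (fun _ : R => 0)); last by rewrite mul0r.
rewrite -torus_integralZ; last exact: ccont_cst.
by congr torus_integral; apply/funext => x; rewrite mul0r.
Qed.

Lemma torus_integral_sum (I : Type) (r : seq I) (w : I -> R -> R[i]) :
  (forall i, ccont (w i)) ->
  torus_integral (fun x => \sum_(i <- r) w i x) = \sum_(i <- r) torus_integral (w i).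
Proof.
move=> h; elim: r => [|a r IH].
  rewrite big_nil -[RHS]torus_integral0; congr torus_integral; apply/funext => x.
  by rewrite big_nil.
rewrite big_cons -IH -torus_integralD//; last exact: ccont_sum.
by congr torus_integral; apply/funext => x; rewrite big_cons.
Qed.

(** The factor 2 comes from bounding real and imaginary parts separately; it reappears in
    [fourier_le]. *)
Lemma torus_integral_le u (C : R) : ccont u -> (forall x, nm (u x) <= C) ->
  nm (torus_integral u) <= 2 * (C * (pi *+ 2)).
Proof.
move=> [u1 u2] hC; apply: le_trans (nm_ReIm _) _; rewrite mulrDl mul1r /=.
have key (f : R -> R) : (forall x : R, {for x, continuous f}) -> (forall x, `|f x| <= C) ->
    `|(\int[mu]_(x in I2) f x)%R| <= C * (pi *+ 2).
  move=> cf hf; apply: le_trans (le_normr_Rintegral _ _) _ => //; first exact: cont_integrable.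
  have -> : C * (pi *+ 2) = (\int[mu]_(x in I2) C)%R.
    by rewrite Rintegral_cst// mu_I2.
  apply: le_Rintegral => //.
  - apply: cont_integrable => x; apply: continuous_comp; first exact: cf.
    exact: norm_continuous.
  - by apply: cont_integrable => x; exact: cst_continuous.
apply: lerD; apply: key => // x.
- by apply: le_trans (nm_Re _) (hC x).
- by apply: le_trans (nm_Im _) (hC x).
Qed.

Lemma torus_FTC (G c : R -> R[i]) : (forall x, is_cderive G x (c x)) -> ccont c ->
  torus_integral c = G (pi *+ 2) - G 0.
Proof.
move=> hG [c1 c2].
have key (F f : R -> R) : (forall x : R, is_derive x 1 F (f x)) -> (forall x : R, {for x, continuous f}) ->
    (\int[mu]_(x in I2) f x)%R = F (pi *+ 2) - F 0.
  move=> hF cf; rewrite /Rintegral (@continuous_FTC2 _ f F) //.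
  - exact: pi2_gt0.
  - exact: continuous_subspaceT.
  - split.
    + by move=> x _; case: (hF x).
    + by apply: cvg_at_right_filter; exact: deriv_continuous (hF 0).
    + by apply: cvg_at_left_filter; exact: deriv_continuous (hF (pi *+ 2)).
  - by move=> x _; rewrite derive1E; case: (hF x).
apply: eq_ReIm; rewrite ?cReD ?cReN ?cImD ?cImN /=.
  by apply: (key (fun x => complex.Re (G x))) => // x; case: (hG x).
by apply: (key (fun x => complex.Im (G x))) => // x; case: (hG x).
Qed.

Lemma expi_2pi (k : int) : expi (k%:~R * (pi *+ 2)) = 1 :> R[i].
Proof.
have n (m : nat) : expi (m%:R * (pi *+ 2)) = 1 :> R[i].
  elim: m => [|m IH]; first by rewrite mul0r expi0.
  rewrite -natr1 mulrDl expiD IH mul1r mul1r; apply: eq_ReIm => /=.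
    by rewrite -[pi *+ 2]add0r cosD2pi cos0.
  by rewrite -[pi *+ 2]add0r sinD2pi sin0.
case: (intP k) => [|m|m]; first by rewrite mul0r expi0.
  exact: (n m.+1).
by rewrite rmorphN mulNr expiN (n m.+1) conjc1.
Qed.

Lemma torus_integral_expi (k : int) :
  torus_integral (fun x : R => expi (k%:~R * x)) = if k == 0 then (pi *+ 2)%:C else 0.
Proof.
case: eqP => [->|/eqP k0].
  have e : (fun x : R => expi (0%:~R * x)) = (fun=> 1) :> (R -> R[i]).
    by apply/funext => x; rewrite mul0r expi0.
  rewrite e /torus_integral /=.
  by rewrite !Rintegral_cst// mu_I2 mul1r mul0r.
have k0' : (k%:~R : R)%:C != 0 :> R[i].
  by rewrite -nm_eq0 nm_real normr_eq0 intr_eq0.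
have ii0 : 'i%C != 0 :> R[i] by rewrite -nm_eq0 nm_i oner_eq0.
have h x : is_cderive (fun x => ('i%C * (k%:~R : R)%:C)^-1 * expi (k%:~R * x)) x (expi (k%:~R * x)).
  apply: cder_eq (cderZ _ (cder_expi (k%:~R) x)).
  by rewrite mulrA mulVf ?mul1r// mulf_neq0.
by rewrite (torus_FTC h (ccont_expi _)) expi_2pi mulr0 expi0 subrr.
Qed.

Definition trig W f (x : R) : R[i] := \sum_(k <- W) f k * expi (k%:~R * x).

Lemma ccont_trig W f : ccont (trig W f).
Proof. by apply: ccont_sum => k; apply: ccontM; [exact: ccont_cst|exact: ccont_expi]. Qed.

(** The frequencies j i may coincide, as they do in the expanded triple product of [fourier_tri]. *)
Lemma fourier_sum (I : Type) (r : seq I) (a : I -> R[i]) (j : I -> int) k :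
  fourier (fun x : R => \sum_(i <- r) a i * expi ((j i)%:~R * x)) k =
  \sum_(i <- r) if j i == k then a i else 0.
Proof.
rewrite /fourier.
have -> : (fun x : R => (\sum_(i <- r) a i * expi ((j i)%:~R * x)) * expi (- (k%:~R * x))) =
   (fun x : R => \sum_(i <- r) a i * expi ((j i - k)%:~R * x)).
  apply/funext => x; rewrite big_distrl /=; apply: eq_bigr => i _.
  by rewrite -mulrA -expiD rmorphB mulrBl.
rewrite torus_integral_sum => [|i]; last by apply: ccontM; [exact: ccont_cst|exact: ccont_expi].
rewrite big_distrr /=; apply: eq_bigr => i _.
rewrite torus_integralZ; last exact: ccont_expi.
rewrite torus_integral_expi subr_eq0; case: eqP => _; last by rewrite !mulr0.
have p0 : (pi *+ 2 : R)%:C != 0 :> R[i].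
  by rewrite -nm_eq0 nm_real normr_eq0 gt_eqF// pi2_gt0.
rewrite mulrCA -rmorphM /= mulVf ?rmorph1 ?mulr1//.
by rewrite gt_eqF// pi2_gt0.
Qed.

Lemma fourier_trig W f k : uniq W -> fourier (trig W f) k = if k \in W then f k else 0.
Proof.
move=> uW; rewrite /trig (fourier_sum W f id); case: ifPn => kW.
  rewrite (bigD1_seq k)//= eqxx big1 ?addr0// => j /negbTE -> //.
by rewrite big_seq big1// => j jW; case: eqP => // e; rewrite e (negbTE kW) in jW.
Qed.

Lemma sq_normE (z : R[i]) : `|z| ^+ 2 = z * cj z.
Proof. by rewrite sqr_normc. Qed.

Lemma fourier_tri W f k :
  fourier (fun x => `|trig W f x| ^+ 2 * trig W f x) k = tri3 W f k.
Proof.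
have -> : (fun x => `|trig W f x| ^+ 2 * trig W f x) = (fun x : R =>
  \sum_(p <- [seq (a, bc) | a <- W, bc <- [seq (b, c) | b <- W, c <- W]])
     (f p.1 * cj (f p.2.1) * f p.2.2) * expi ((p.1 - p.2.1 + p.2.2)%:~R * x)).
  apply/funext => x; rewrite sq_normE big_allpairs.
  rewrite -mulrA {1}/trig big_distrl /=; apply: eq_bigr => a _.
  rewrite big_allpairs /= {1}/trig rmorph_sum /= big_distrl big_distrr /=; apply: eq_bigr => b _.
  rewrite /trig !big_distrr /=; apply: eq_bigr => c _.
  rewrite rmorphD rmorphB /= mulrDl mulrBl !expiD expiN cjM; ring.
rewrite fourier_sum big_allpairs /tri; apply: eq_bigr => a _.
by rewrite big_allpairs.
Qed.

Lemma ccont_fourier u k : ccont u -> ccont (fun x => u x * expi (- (k%:~R * x))).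
Proof.
move=> cu; apply: ccontM => //.
have -> : (fun x : R => expi (- (k%:~R * x))) = (fun x : R => expi ((- k%:~R) * x)).
  by apply/funext => x; rewrite mulNr.
exact: ccont_expi.
Qed.

Lemma fourierB u v k : ccont u -> ccont v ->
  fourier (fun x => u x - v x) k = fourier u k - fourier v k.
Proof.
move=> cu cv; rewrite /fourier -mulrBr; congr (_ * _).
have -> : (fun x : R => (u x - v x) * expi (- (k%:~R * x))) = (fun x : R => u x * expi (- (k%:~R * x))
   + (-1) * (v x * expi (- (k%:~R * x)))) by apply/funext => x; ring.
have cw := ccont_fourier k cv.
by rewrite (torus_integralD (ccont_fourier k cu) (ccontM (ccont_cst _) cw)) (torus_integralZ _ cw) mulN1r.
Qed.

Lemma fourier_le u k (C : R) : ccont u -> (forall x, nm (u x) <= C) -> nm (fourier u k) <= 2 * C.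
Proof.
move=> cu hC; rewrite /fourier nmM nm_real ger0_norm ?invr_ge0 ?(ltW pi2_gt0)//.
rewrite ler_pdivrMl ?pi2_gt0//; apply: le_trans (torus_integral_le (C := C) (ccont_fourier k cu) _) _.
  by move=> x; rewrite nmM nm_expi mulr1.
by apply: le_of_eq; ring.
Qed.

Lemma fourier_limit (w : nat -> R -> R[i]) u (e : nat -> R) k : e @ \oo --> (0 : R) ->
  (forall n, ccont (w n)) -> (forall n x, nm (u x - w n x) <= e n) ->
  ccvg (fun n => fourier (w n) k) (fourier u k).
Proof.
move=> e0 cw h; have cu := ccont_uniform e0 cw h.
apply: (ccvg_le (b := fun n => 2 * e n)).
  near=> n; rewrite nm_distC -fourierB//; apply: fourier_le => [|x //].
  rewrite /=; under eq_fun do rewrite -mulN1r.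
  by apply: ccontD => //; apply: ccontM => //; exact: ccont_cst.
exact: cvg0Z.
Unshelve. all: by end_near. Qed.

End Fourier.

(** * The limit of the Galerkin solutions is a solution *)

Section SobolevNorm.
Variable R : realType.

(** Finite partial sums of the squared H^r norm; [Hnorm_le] and [Hnorm_ge] transfer bounds on them
    to [Hnorm]. *)
Definition wsq (r : R) (S : seq int) (f : int -> R[i]) : R :=
  \sum_(k <- S) (1 + k%:~R ^+ 2) `^ r * nm (f k) ^+ 2.

Lemma wsq_ge0 r S f : 0 <= wsq r S f.
Proof. by apply: sumr_ge0 => k _; rewrite mulr_ge0 ?powR_ge0 ?sqr_ge0. Qed.

Lemma wsq_sub r S V f : uniq S -> uniq V -> {subset S <= V} -> wsq r S f <= wsq r V f.
Proof.
move=> uS uV SV; rewrite /wsq [leRHS](bigID (mem S)) /=.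
rewrite -[X in _ <= X + _]big_filter [X in _ <= X + _](perm_big S).
  by rewrite lerDl sumr_ge0// => k _; rewrite mulr_ge0 ?powR_ge0 ?sqr_ge0.
apply: uniq_perm => //; first exact: filter_uniq.
by move=> k; rewrite mem_filter; apply/andP/idP => [[]//|kV]; split; rewrite // SV.
Qed.

Lemma sub_win (S : seq int) : exists N, {subset S <= win N}.
Proof.
elim: S => [|a S [N IH]]; first by exists 0%N.
exists (maxn N `|a|) => k; rewrite in_cons => /orP[/eqP ->|/IH]; rewrite !mem_win.
  exact: leq_maxr.
by move=> /leq_trans; apply; exact: leq_maxl.
Qed.

Lemma sqr_poweR (C : R) : 0 <= C -> ((C ^+ 2)%:E `^ 2^-1 = C%:E)%E.
Proof. by move=> C0; rewrite poweR_EFin powR12_sqrt ?sqr_ge0// sqrtr_sqr ger0_norm. Qed.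

Lemma poweR_half_mono (x y : \bar R) : (0 <= x -> x <= y -> x `^ 2^-1 <= y `^ 2^-1)%E.
Proof.
move=> x0 xy; apply: gt0_ler_poweR => //.
- by rewrite in_itv /= x0 leey.
- by rewrite in_itv /= (le_trans x0 xy) leey.
Qed.

Lemma Hnorm_le r (f : R -> R[i]) (C : R) : 0 <= C ->
  (forall N, wsq r (win N) (fourier f) <= C ^+ 2) -> (Hnorm r f <= C%:E)%E.
Proof.
move=> C0 h; rewrite -(sqr_poweR C0) /Hnorm.
apply: poweR_half_mono.
  by apply: esum_ge0 => k _; rewrite lee_fin mulr_ge0 ?powR_ge0 ?sqr_ge0.
apply: ge_ereal_sup => _ [X [fX _] <-].
rewrite fsbig_finite// sumEFin lee_fin.
have [N hN] := sub_win (finmap.enum_fset (fset_set X)).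
apply: le_trans (h N); apply: wsq_sub => //; last exact: uniq_win.
exact: finmap.fset_uniq.
Qed.

Lemma Hnorm_ge r (f : R -> R[i]) (C : R) (S : seq int) : uniq S -> 0 <= C ->
  C ^+ 2 <= wsq r S (fourier f) -> (C%:E <= Hnorm r f)%E.
Proof.
move=> uS C0 h; rewrite -(sqr_poweR C0) /Hnorm.
apply: poweR_half_mono; first by rewrite lee_fin sqr_ge0.
apply: esum_ge; exists [set` S]; first by split => //; exact: finite_seq.
rewrite fsbig_finite; last exact: finite_seq.
have e : perm_eq (finmap.enum_fset (fset_set [set` S])) S.
  apply: uniq_perm => //.
  have fS : finite_set [set` S] by exact: finite_seq.
  by move=> k; rewrite in_fset_set// mem_setE.
by rewrite (perm_big _ e) sumEFin lee_fin.
Qed.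

Lemma nm_ccvg (z : nat -> R[i]) l : ccvg z l -> (fun n => nm (z n)) @ \oo --> nm l.
Proof.
move=> h; apply/cvgrPdist_le => e e0; have /cvgrPdist_le/(_ _ e0) := h.
apply: filterS => n; rewrite sub0r normrN ger0_norm ?nm_ge0// => hn.
rewrite ler_norml; have := nm_lerB (z n) l; have := nm_lerB l (z n).
by rewrite [nm (l - _)]nm_distC; lra.
Qed.

Lemma wsum_limit (S : seq int) (c : int -> R) (z : int -> nat -> R[i]) (l : int -> R[i]) (C : R) :
  (forall k, k \in S -> ccvg (z k) (l k)) ->
  (\forall n \near \oo, \sum_(k <- S) c k * nm (z k n) ^+ 2 <= C) ->
  \sum_(k <- S) c k * nm (l k) ^+ 2 <= C.
Proof.
move=> h hC.
have hs : (fun n => \sum_(k <- S) c k * nm (z k n) ^+ 2) @ \oo --> \sum_(k <- S) c k * nm (l k) ^+ 2.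
  elim: S h {hC} => [|a S IH] h.
    by rewrite big_nil; under eq_fun do rewrite big_nil; exact: cvg_cst.
  rewrite big_cons; under eq_fun do rewrite big_cons.
  apply: cvgD; last by apply: IH => k kS; apply: h; rewrite in_cons kS orbT.
  apply: cvgM; first exact: cvg_cst.
  have ha : (fun n => nm (z a n)) @ \oo --> nm (l a) by apply: nm_ccvg; apply: h; rewrite mem_head.
  by rewrite expr2; under eq_fun do rewrite expr2; exact: cvgM.
exact: (cvgr_to_le hs hC).
Qed.

Lemma ccvg_shift (z : nat -> R[i]) l p : ccvg z l -> ccvg (fun n => z (n + p)%N) l.
Proof.
move=> h; elim: p => [|p IH]; first by under eq_fun do rewrite addn0.
have := cvg_shiftS (fun n => nm (z (n + p)%N - l)) (nbhs (0 : R)) => e.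
have : [sequence nm (z (n.+1 + p)%N - l)]_n @ \oo --> (0 : R) by rewrite e.
by under eq_fun do rewrite addSnnS.
Qed.

Lemma cvg_inv_nat (C : R) : (fun n : nat => C / n.+1%:R) @ \oo --> (0 : R).
Proof. exact: cvg0Z (@cvg_harmonic R). Qed.

Lemma torus_L2_cont (f : R -> R[i]) : ccont f -> periodic f (pi *+ 2) -> torus_L2 f.
Proof.
move=> cf pf; have [c1 c2] := cf; split => //.
  by split; apply: measurable_realfun.continuous_measurable_fun.
have : (@lebesgue_measure R).-integrable `[(0 : R), pi *+ 2] (EFin \o (fun x => nm (f x) ^+ 2)).
  apply: cont_integrable.
  apply: (rcont_ext (f := fun x => complex.Re (f x * cj (f x)))); first by move=> x; rewrite mulzJ.
  by have [] := ccontM cf (ccont_conj cf).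
move=> /integrableP[_]; apply: le_lt_trans.
apply: le_of_eq; apply: eq_integral => x _ /=.
by rewrite ger0_norm ?sqr_ge0.
Qed.

End SobolevNorm.

(** * Passage to the limit in the equation *)

Section Existence.
Variable R : realType.
Local Notation lam := (@lam R).

Lemma trig_sub (N M : nat) (f : int -> R[i]) : (N <= M)%N ->
  (forall k, k \notin win N -> f k = 0) -> trig (win M) f =1 trig (win N) f.
Proof.
move=> NM hf x; apply: sum_supp; [exact: uniq_win|exact: uniq_win|exact: win_sub|].
by move=> k /hf ->; rewrite mul0r.
Qed.

Lemma trig_periodic W (f : int -> R[i]) : periodic (trig W f) (pi *+ 2).
Proof.
by move=> x; apply: eq_bigr => k _; rewrite mulrDr expiD expi_2pi mulr1.
Qed.

Lemma nm_trigB W (f g : int -> R[i]) x : nm (trig W f x - trig W g x) <= n1 W (fun k => f k - g k).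
Proof.
rewrite /trig -sumrB n1E; apply: le_trans (nm_sum _ _ _) _; apply: ler_sum => k _.
by rewrite -mulrBl nmM nm_expi mulr1.
Qed.

Lemma nm_trig W (f : int -> R[i]) x : nm (trig W f x) <= n1 W f.
Proof.
rewrite /trig n1E; apply: le_trans (nm_sum _ _ _) _; apply: ler_sum => k _.
by rewrite nmM nm_expi mulr1.
Qed.

Lemma cubic_lip (z w : R[i]) (B : R) : nm z <= B -> nm w <= B ->
  nm (`|z| ^+ 2 * z - `|w| ^+ 2 * w) <= 3 * B ^+ 2 * nm (z - w).
Proof.
move=> hz hw; rewrite !sq_normE.
have -> : z * cj z * z - w * cj w * w = (z - w) * (cj z * z) + w * (cj (z - w) * z) + w * (cj w * (z - w)).
  by rewrite rmorphB /=; ring.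
have B0 : 0 <= B by exact: le_trans (nm_ge0 z) hz.
have q0 := nm_ge0 (z - w).
apply: le_trans (nmD _ _) _; apply: le_trans (lerD (nmD _ _) (lexx _)) _.
rewrite !nmM !nmJ.
have h1 : nm z * nm z <= B * B by apply: ler_pM; rewrite ?nm_ge0.
have h2 : nm w * nm z <= B * B by apply: ler_pM; rewrite ?nm_ge0.
have h3 : nm w * nm w <= B * B by apply: ler_pM; rewrite ?nm_ge0.
have -> : nm (z - w) * (nm z * nm z) + nm w * (nm (z - w) * nm z) + nm w * (nm w * nm (z - w)) =
  (nm z * nm z + nm w * nm z + nm w * nm w) * nm (z - w) by ring.
by apply: ler_wpM2r => //; rewrite expr2; lra.
Qed.

Lemma ccont_cubic (v : R -> R[i]) : ccont v -> ccont (fun x => `|v x| ^+ 2 * v x).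
Proof.
move=> cv; have -> : (fun x => `|v x| ^+ 2 * v x) = (fun x => v x * cj (v x) * v x).
  by apply/funext => x; rewrite sq_normE.
by apply: ccontM => //; apply: ccontM => //; exact: ccont_conj.
Qed.

Section Limit.
Variables (N0 : nat) (f0 : int -> R[i]) (u : nat -> R -> int -> R[i]) (Y K : R -> R).
Hypothesis hu : galerkin_family N0 f0 u Y K.

Let W n := win (n + N0).

Let uz n t k : k \notin W n -> u n t k = 0.
Proof. by case: hu => hg _ _ _ _; case: (hg n) => h _; exact: h. Qed.

Let Y0 (t : R) : 0 <= Y `|t|.
Proof. by case: hu => _ _ _ hY _; apply: le_trans (hY 0%N t); exact: NWjap_ge0. Qed.

Let hY n t : NW (@jap R) (W n) (u n t) <= Y `|t|.
Proof. by case: hu => _ _ _ h _; exact: h. Qed.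

Let hYT n (s T : R) : `|s| <= T -> NW (@jap R) (W n) (u n s) <= Y T.
Proof.
move=> sT; apply: le_trans (hY n s) _; case: hu => _ _ [mY _] _ _.
by apply: mY => //; rewrite nnegrE ?(le_trans _ sT).
Qed.

(** The limit is chosen pointwise in (t, x). The rate does not depend on x, which gives continuity
    of U t and convergence of its Fourier coefficients. *)
Lemma galerkin_function_limit : exists U : R -> R -> R[i],
  forall n t x, nm (U t x - trig (W n) (u n t) x) <= 2 * K `|t| / n.+1%:R.
Proof.
have [|U hU] := @choice _ _ (fun (p : R * R) l => forall n, nm (l - trig (W n) (u n p.1) p.2) <= 2 * (K `|p.1| / n.+1%:R)).
  move=> [t x] /=; apply: (@ccauchy R (fun n => trig (W n) (u n t) x) (fun n => K `|t| / n.+1%:R)) => n m nm_.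
  rewrite -(@trig_sub (n + N0) (m + N0) (u n t)); [|by rewrite leq_add2r|by move=> k; exact: uz].
  apply: le_trans (nm_trigB _ _ _ _) _; case: hu => _ _ _ _; exact.
by exists (fun t x => U (t, x)) => n t x; rewrite -mulrA; exact: hU (t, x) n.
Qed.

Variable U : R -> R -> R[i].
Hypothesis hU : forall n t x, nm (U t x - trig (W n) (u n t) x) <= 2 * K `|t| / n.+1%:R.

Let cU t : ccont (U t).
Proof.
exact: ccont_uniform (cvg_inv_nat (2 * K `|t|)) (fun n => ccont_trig (W n) (u n t)) (fun n x => hU n t x).
Qed.

Lemma galerkin_fourier_limit t k : ccvg (fun n => u n t k) (fourier (U t) k).
Proof.
have e : (fun n => fourier (trig (W n) (u n t)) k) = (fun n => u n t k).
  apply/funext => n; rewrite fourier_trig ?uniq_win//; case: ifPn => // kn.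
  by rewrite uz.
by rewrite -e; exact: fourier_limit (cvg_inv_nat (2 * K `|t|)) (fun n => ccont_trig (W n) (u n t)) (fun n x => hU n t x).
Qed.

Let Ulim t x : ccvg (fun n => trig (W n) (u n t) x) (U t x).
Proof.
apply: (ccvg_le (b := fun n => 2 * K `|t| / n.+1%:R)); last exact: cvg_inv_nat.
by near=> n; rewrite nm_distC.
Unshelve. all: by end_near. Qed.

Lemma limit_periodic t : periodic (U t) (pi *+ 2).
Proof.
move=> x; apply: (ccvg_unique (Ulim t (x + pi *+ 2))).
by under eq_fun do rewrite trig_periodic; exact: Ulim.
Qed.

Lemma limit_initial x : U 0 x = trig (win N0) f0 x.
Proof.
apply: (ccvg_unique (Ulim 0 x)).
have [hg h0 _ _ _] := hu.
have -> : (fun n => trig (W n) (u n 0) x) = (fun=> trig (win N0) f0 x).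
  apply/funext => n; rewrite h0 (@trig_sub N0 (n + N0)) ?leq_addl// => k kN.
  by rewrite -(h0 0%N) uz.
exact: ccvg_cst.
Qed.

Let B T := Y T.
Let L T := Y T + Y T ^+ 3.

Lemma galerkin_speed n (s T : R) : `|s| <= T ->
  n1 (W n) (fun k => wave_rhs (W n) (u n s) k) <= L T.
Proof.
move=> sT; apply: le_trans (NWD _ _ _ (fun=> ler01)) _; rewrite !NWN NWZ nm_i mul1r.
have YT0 : 0 <= Y T by apply: le_trans (hYT 0%N sT); exact: NWjap_ge0.
apply: lerD.
  apply: le_trans (hYT n sT); apply: ler_sum => k _.
  rewrite mul1r !nmM nm_i mul1r nm_real ger0_norm ?lam_ge0// ler_wpM2r ?nm_ge0// /jap lerDr//.
apply: le_trans (n1_jap _ _) _.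
apply: le_trans (tri_bound _ _ _ _ (@jap_ge0 R) (@jap_submul R) (uniq_win _)) _.
have p0 : 0 <= NW (@jap R) (W n) (u n s) by exact: NWjap_ge0.
by rewrite !exprS expr0 mulr1 mulrA; apply: ler_pM; rewrite ?mulr_ge0 ?hYT//; apply: ler_pM; rewrite ?hYT.
Qed.

Lemma galerkin_lip n (t x : R) : `|x - t| <= 1 ->
  n1 (W n) (fun k => u n x k - u n t k) <= L (`|t| + 1) * `|x - t|.
Proof.
move=> xt; have [hg _ _ _ _] := hu; rewrite n1E.
apply: (lip_norm (d := fun s k => wave_rhs (W n) (u n s) k)).
  by move=> s k _; case: (hg n) => _; exact.
move=> s st; rewrite -n1E; apply: galerkin_speed.
by have := ler_normD (s - t) t; rewrite subrK; lra.
Qed.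

Lemma fourier_lip (t x : R) k : `|x - t| <= 1 ->
  nm (fourier (U x) k - fourier (U t) k) <= L (`|t| + 1) * `|x - t|.
Proof.
move=> xt; apply: nm_ccvg_le (ccvgB (galerkin_fourier_limit x k) (galerkin_fourier_limit t k)) _.
near=> n; apply: le_trans (galerkin_lip n xt).
have [kW|kW] := boolP (k \in W n).
  by exact: (n1_term (fun k => u n x k - u n t k)).
by rewrite !uz// subrr nm0 n1_ge0.
Unshelve. all: by end_near. Qed.

Let absle (t x : R) : `|x - t| <= 1 -> `|x| <= `|t| + 1.
Proof. by move=> xt; have := ler_normD (x - t) t; rewrite subrK; lra. Qed.

Lemma powR_half_jap k : (1 + k%:~R ^+ 2 : R) `^ 2^-1 <= jap R k.
Proof.
have h : 0 <= 1 + k%:~R ^+ 2 :> R by rewrite addr_ge0 ?sqr_ge0.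
rewrite powR12_sqrt// -[leRHS]ger0_norm ?jap_ge0// -sqrtr_sqr ler_sqrt ?sqr_ge0//.
rewrite /jap /lam sqrrD expr1n mul1r -[k%:~R ^+ 2]real_normK ?num_real// intr_norm.
by rewrite addrAC lerDl mulrn_wge0.
Qed.

Lemma half_term k (z C : R) : 0 <= z -> z <= C ->
  (1 + k%:~R ^+ 2) `^ 2^-1 * z ^+ 2 <= C * (jap R k * z).
Proof.
move=> z0 zC; rewrite mulrC expr2 -mulrA; apply: ler_pM; rewrite ?mulr_ge0 ?powR_ge0//.
by rewrite mulrC ler_wpM2r ?powR_half_jap.
Qed.

(** Interpolation: the squared H^{1/2} norm of the difference is at most the supremum of its
    coefficients, Lipschitz in time, times its weighted l^1 norm, which is bounded. Hence U is
    1/2-Hoelder in time. *)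
Lemma wsq_half_lip (t x : R) N : `|x - t| <= 1 ->
  wsq 2^-1 (win N) (fun k => fourier (U x) k - fourier (U t) k) <=
  (L (`|t| + 1) * `|x - t|) * (2 * Y (`|t| + 1)).
Proof.
move=> xt; set C := L _ * _; set Y1 := Y _.
have C0 : 0 <= C by apply: le_trans (fourier_lip 0 xt); exact: nm_ge0.
apply: (wsum_limit (z := fun k n => u n x k - u n t k)).
  by move=> k _; apply: ccvgB; exact: galerkin_fourier_limit.
exists N => //= n /= Nn.
have xT := absle xt; have tT : `|t| <= `|t| + 1 by rewrite lerDl.
apply: (@le_trans _ _ (C * NW (@jap R) (win N) (fun k => u n x k - u n t k))).
  rewrite /NW big_distrr /=; apply: ler_sum => k _.
  have h : nm (u n x k - u n t k) <= C.
    apply: le_trans (galerkin_lip n xt); have [kW|kW] := boolP (k \in W n).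
      by exact: (n1_term (fun k => u n x k - u n t k)).
    by rewrite !uz// subrr nm0 n1_ge0.
  by apply: half_term; rewrite ?nm_ge0.
apply: ler_wpM2l => //.
apply: le_trans (NW_sub _ (@jap_ge0 R) (uniq_win N) (uniq_win (n + N0)) _) _.
  by apply: win_sub; exact: leq_trans Nn (leq_addr _ _).
apply: le_trans (NWB _ _ _ (@jap_ge0 R)) _.
by rewrite mulrDl mul1r; apply: lerD; exact: hYT.
Qed.

Lemma limit_in_H t : in_H 2^-1 (U t).
Proof.
split; first exact: torus_L2_cont (cU t) (limit_periodic t).
apply: (@le_lt_trans _ _ (Y `|t|)%:E); last exact: ltry.
apply: Hnorm_le => // N.
apply: (wsum_limit (z := fun k n => u n t k)).
  by move=> k _; exact: galerkin_fourier_limit.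
exists N => //= n /= Nn.
apply: (@le_trans _ _ (NW (@jap R) (win N) (u n t) ^+ 2)); last first.
  have p0 : 0 <= NW (@jap R) (win N) (u n t) by exact: NWjap_ge0.
  rewrite ler_pXn2r ?nnegrE//.
  apply: le_trans (NW_sub _ (@jap_ge0 R) (uniq_win N) (uniq_win (n + N0)) _) _.
    by apply: win_sub; exact: leq_trans Nn (leq_addr _ _).
  exact: hY.
rewrite [leRHS]expr2 {2}/NW big_distrr /= big_seq [leRHS]big_seq; apply: ler_sum => k kN.
apply: half_term; first exact: nm_ge0.
apply: le_trans (NW_term (u n t) (@jap_ge0 R) kN).
by rewrite ler_peMl ?nm_ge0// jap_ge1.
Qed.

Lemma limit_continuous : continuous_in_H 2^-1 U.
Proof.
split; first exact: limit_in_H.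
move=> t; set A := L (`|t| + 1) * (2 * Y (`|t| + 1)).
have A0 : 0 <= A.
  have := @wsq_half_lip t (t + 1) 0%N; rewrite addrAC subrr add0r normr1 mulr1.
  by move=> /(_ (lexx _)); apply: le_trans; exact: wsq_ge0.
have hb x : `|x - t| <= 1 -> (0%:E <= Hnorm 2^-1 (U x \- U t)%R <= (Num.sqrt (A * `|x - t|))%:E)%E.
  move=> xt; rewrite poweR_ge0 /=; apply: Hnorm_le; first exact: sqrtr_ge0.
  move=> N; rewrite sqr_sqrtr; last exact: mulr_ge0 A0 (normr_ge0 _).
  have -> : fourier (U x \- U t) = (fun k => fourier (U x) k - fourier (U t) k).
    by apply/funext => k; exact: fourierB.
  apply: le_trans (wsq_half_lip _ xt) _.
  by apply: le_of_eq; rewrite /A; ring.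
apply: (squeeze_cvge (f := fun=> 0%:E) (h := fun x : R => (Num.sqrt (A * `|x - t|))%:E)).
- near=> x; apply: hb; near: x.
  by exists 1 => //= y; rewrite distrC => /ltW.
- exact: cvg_cst.
- apply: cvg_EFin; first by near=> x.
  have h : {for t, continuous (fun x : R => Num.sqrt (A * `|x - t|))}.
    apply: continuous_comp; last exact: sqrt_continuous.
    apply: continuousM; first exact: cst_continuous.
    apply: continuous_comp; last exact: norm_continuous.
    by apply: continuousB; [move=> P|exact: cst_continuous].
  by move: h; rewrite /prop_for /continuous_at subrr normr0 mulr0 sqrtr0.
Unshelve. all: by end_near. Qed.

Lemma limit_equation t k : exists d : R[i],
  is_cderive (fun t' => fourier (U t') k) t d /\
  'i * d - (`|k|%:~R) * fourier (U t) k = fourier (fun x => `|U t x| ^+ 2 * U t x) k.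
Proof.
set N := fourier (fun x => `|U t x| ^+ 2 * U t x) k.
exists (- ('i%C * (lam k)%:C * fourier (U t) k) + - ('i%C * N)); split; last first.
  rewrite ImiE; have -> : `|k|%:~R = (lam k)%:C :> R[i] by rewrite /lam rmorph_int.
  transitivity (- ('i%C * 'i%C) * ((lam k)%:C * fourier (U t) k + N) - (lam k)%:C * fourier (U t) k).
    by ring.
  by rewrite ii opprK mul1r; ring.
have [hg _ _ _ _] := hu.
(* After a shift of the sequence by |k|, the mode k belongs to every window. *)
pose p := `|k|%N.
have kW n : k \in W (n + p) by rewrite mem_win /p; lia.
set Y1 := Y (`|t| + 1).
have tT : `|t| <= `|t| + 1 by rewrite lerDl.
have Y10 : 0 <= Y1 by apply: le_trans (hYT 0%N tT); exact: NWjap_ge0.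
have L0 : 0 <= L (`|t| + 1) by rewrite addr_ge0 ?exprn_ge0.
apply: (@cder_limit R (fun n s => u (n + p)%N s k) (fun n s => wave_rhs (W (n + p)) (u (n + p)%N s) k) _ t
  (lam k * L (`|t| + 1) + 3 * Y1 ^+ 2 * L (`|t| + 1))).
- by rewrite addr_ge0 ?mulr_ge0 ?exprn_ge0 ?lam_ge0.
- by move=> n x; have [_ h] := hg (n + p)%N; exact: h (kW n).
- move=> n x xt; set m := (n + p)%N.
  have hl := galerkin_lip m xt.
  have -> : wave_rhs (W m) (u m x) k - wave_rhs (W m) (u m t) k =
     - ('i%C * ((lam k)%:C * (u m x k - u m t k) +
       (tri3 (W m) (u m x) k - tri3 (W m) (u m t) k))) by ring.
  rewrite nmN nmM nm_i mul1r mulrDl; apply: le_trans (nmD _ _) _; apply: lerD.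
    rewrite nmM nm_real ger0_norm ?lam_ge0// -mulrA ler_wpM2l ?lam_ge0//.
    apply: le_trans hl.
    exact: (n1_term (fun k => u m x k - u m t k) (kW n)).
  have w1 (a b c : int) : (1 : R) <= 1 * 1 * 1 by rewrite !mulr1.
  have := @tri_lip R (fun=> 1) (W m) (W m) (u m x) (u m t) Y1 (fun=> ler01) w1 (uniq_win _)
    (le_trans (n1_jap _ _) (hYT m (absle xt))) (le_trans (n1_jap _ _) (hYT m tT)).
  move=> h; apply: le_trans (le_trans _ h) _.
    exact: (n1_term (fun k => tri3 (W m) (u m x) k - tri3 (W m) (u m t) k) (kW n)).
  by rewrite -[leRHS]mulrA ler_wpM2l ?mulr_ge0 ?exprn_ge0.
- by move=> s; apply: (ccvg_shift (z := fun n => u n s k)); exact: galerkin_fourier_limit.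
- apply: (ccvg_shift (z := fun n => wave_rhs (W n) (u n t) k)).
  have h1 := ccvgZ (- ('i%C * (lam k)%:C)) (galerkin_fourier_limit t k).
  have h2 : ccvg (fun n => tri3 (W n) (u n t) k) N.
    have e : (fun n => tri3 (W n) (u n t) k) =
      (fun n => fourier (fun x => `|trig (W n) (u n t) x| ^+ 2 * trig (W n) (u n t) x) k).
      by apply/funext => n; rewrite fourier_tri.
    rewrite e; apply: (fourier_limit (e := fun n => 3 * Y `|t| ^+ 2 * (2 * K `|t|) / n.+1%:R)).
    + exact: cvg_inv_nat.
    + by move=> n; apply: ccont_cubic; exact: ccont_trig.
    + move=> n x.
      have hw m : nm (trig (W m) (u m t) x) <= Y `|t|.
        by apply: le_trans (nm_trig _ _ _) _; apply: le_trans (n1_jap _ _) (hY m t).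
      have hUx : nm (U t x) <= Y `|t| by apply: nm_ccvg_le (Ulim t x) _; near=> m.
      apply: le_trans (cubic_lip hUx (hw n)) _.
      by rewrite -[leRHS]mulrA ler_wpM2l ?mulr_ge0 ?exprn_ge0.
  have := ccvgD h1 (ccvgZ (- 'i%C) h2).
  rewrite !mulNr; by under eq_fun do rewrite !mulNr.
Unshelve. all: by end_near. Qed.

Lemma limit_solution : half_wave_solution (trig (win N0) f0) U.
Proof.
split; [exact: limit_continuous| |exact: limit_equation].
by apply: aeW => x; exact: limit_initial.
Qed.

End Limit.

End Existence.

(** * The cubic term of a rational profile *)

Section RationalCubic.
Variable R : realType.
Local Notation C := R[i].

Lemma sum_win (V : nmodType) (F : int -> V) M :
  \sum_(k <- win M) F k = F 0 + \sum_(j < M) (F (Posz j.+1) + F (- Posz j.+1)).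
Proof.
elim: M => [|M IH]; first by rewrite big_ord0 addr0 big_seq1.
have -> : \sum_(k <- win M.+1) F k = F (Posz M.+1) + (F (- Posz M.+1) + \sum_(k <- win M) F k).
  by rewrite (perm_big _ (perm_winS M)) 2!big_cons.
rewrite IH big_ord_recr /= addrA [RHS]addrA [RHS]addrC; congr (_ + _).
Qed.

Lemma sum_geom (w : C) M : w != 1 -> \sum_(j < M) w ^+ j = (1 - w ^+ M) / (1 - w).
Proof.
move=> w1; have w1' : 1 - w != 0 by rewrite subr_eq0 eq_sym.
by rewrite -[1 - w ^+ M]opprB subrX1 -mulNr opprB mulrAC divff ?mul1r.
Qed.

Lemma sum_geom_le (x : R) M : 0 <= x -> x < 1 -> \sum_(j < M) x ^+ j <= (1 - x)^-1.
Proof.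
move=> x0 x1; rewrite -[leRHS]mul1r ler_pdivlMr ?subr_gt0// mulrC -[1 - x]opprB mulNr -subrX1 opprB.
by rewrite gerBl exprn_ge0.
Qed.

Lemma sum_arith_geom (w : C) M : w != 1 ->
  \sum_(j < M.+1) j%:R * w ^+ j.-1 = (1 - M.+1%:R * w ^+ M + M%:R * w ^+ M.+1) / (1 - w) ^+ 2.
Proof.
move=> w1; have w1' : 1 - w != 0 by rewrite subr_eq0 eq_sym.
elim: M => [|M IH]; first by rewrite big_ord1 expr0 !mul0r mulr1 subrr addr0 mul0r.
rewrite big_ord_recr IH /= -!natr1 !exprS; field => //.
Qed.

(** Write x = y^2: one factor y^n keeps n y^n below 1 / (1 - y), the other tends to 0. *)
Lemma natmul_expr_cvg0 (x : R) : 0 <= x < 1 -> (fun n : nat => n%:R * x ^+ n) @ \oo --> (0 : R).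
Proof.
move=> /andP[x0 x1].
pose y := Num.sqrt x.
have y0 : 0 <= y by exact: sqrtr_ge0.
have y1 : y < 1 by rewrite -sqrtr1 ltr_sqrt.
have yx : x = y * y by rewrite -expr2 sqr_sqrtr.
have h n : n%:R * y ^+ n <= (1 - y)^-1.
  rewrite -[leRHS]mul1r ler_pdivlMr ?subr_gt0//.
  have : n%:R * y ^+ n * (1 - y) <= 1 - y ^+ n; last by have := exprn_ge0 n y0; lra.
  elim: n => [|n IH]; first by rewrite !mul0r expr0 subrr.
  rewrite -natr1 exprS; have yn := exprn_ge0 n y0.
  have yn1 : y ^+ n <= 1 by rewrite exprn_ile1// ltW.
  have h1 : 0 <= (1 - y) * (1 - y * y ^+ n).
    rewrite mulr_ge0// subr_ge0; first exact: ltW.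
    by rewrite -[leRHS]mulr1; apply: ler_pM => //; exact: ltW.
  have h2 := ler_wpM2l y0 IH.
  move: (y ^+ n) h1 h2 => Yn h1 h2; lra.
apply: (cvg0_le (b := fun n => (1 - y)^-1 * y ^+ n)).
- by move=> n; rewrite mulr_ge0 ?exprn_ge0.
- near=> n; rewrite yx exprMn mulrA; apply: ler_wpM2r; [exact: exprn_ge0|exact: h].
exact: cvg0_geom.
Unshelve. all: by end_near. Qed.

Lemma fourier_series (F : R -> C) (c : int -> C) (e : nat -> R) k : e @ \oo --> (0 : R) ->
  (forall n x, nm (F x - trig (win n.+1) c x) <= e n) -> fourier F k = c k.
Proof.
move=> e0 h.
have h1 := fourier_limit k e0 (fun n => ccont_trig (win n.+1) c) h.
apply: ccvg_unique h1 _; apply: (ccvg_le (b := fun=> 0)); last exact: cvg_cst.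
exists `|k|%N => // n /= kn; rewrite fourier_trig ?uniq_win// mem_win leqW//.
by rewrite subrr nm0.
Qed.

Section Coefficients.
Variables (b A P : C) (rho Bd : R).
Hypotheses (rho0 : 0 <= rho) (rho1 : rho < 1) (hP : nm P <= rho) (hb : nm b <= Bd) (hA : nm A <= Bd).

(* The coefficients of b + A z / (1 - P z) in powers of z = e^{ix}, and (below)
   those of its cubic nonlinearity, read off a partial fraction expansion. *)
Definition ratc (k : int) : C :=
  match k with Posz 0 => b | Posz j.+1 => A * P ^+ j | Negz _ => 0 end.

Let q := 1 - P * cj P.
Let X := 2 * b * cj b * A + 2 * b * A * cj A * P / q + cj A * A ^+ 2 / q ^+ 2.
Let Y := cj b * A ^+ 2 + cj A * A ^+ 2 * P / q.
(** The value of [ratf] at conj P, so that conj A beta^2 is the residue there of the cubic term, the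
    source of its negative frequencies. *)
Let beta := b + A * cj P / q.

Let cub0 := b ^+ 2 * cj b + cj A * (2 * b * A / q + A ^+ 2 * cj P / q ^+ 2).

Definition cubc (k : int) : C :=
  match k with
  | Posz 0 => cub0
  | Posz j.+1 => X * P ^+ j + j%:R * Y * P ^+ j.-1
  | Negz j => cj A * beta ^+ 2 * cj P ^+ j
  end.

Definition ratf (z : C) : C := b + A * z / (1 - P * z).

Let D := (1 - rho)^-1.
Let D0 : 0 < D. Proof. by rewrite invr_gt0 subr_gt0. Qed.
Let Bd0 : 0 <= Bd. Proof. exact: le_trans (nm_ge0 b) hb. Qed.

Let nmden (w : C) : nm w <= rho -> 1 - w != 0 /\ nm (1 - w)^-1 <= D.
Proof.
move=> hw; have h : 1 - rho <= nm (1 - w).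
  by have := nm_lerB 1 w; rewrite nm1; lra.
have h0 : 0 < nm (1 - w) by apply: lt_le_trans h; rewrite subr_gt0.
split; first by rewrite -nm_eq0 gt_eqF.
by rewrite nmV lef_pV2 ?posrE// subr_gt0.
Qed.

Let nmPz (z : C) : nm z = 1 -> nm (P * z) <= rho.
Proof. by move=> hz; rewrite nmM hz mulr1. Qed.

Let q0 : q != 0.
Proof.
have [|] := @nmden (P * cj P); last by [].
rewrite nmM nmJ; apply: (@le_trans _ _ (rho * 1)); last by rewrite mulr1.
by apply: ler_pM; rewrite ?nm_ge0// (le_trans hP)// ltW.
Qed.

(** On the circle conj z = 1 / z, so both sides are rational functions of z, with a double pole at 1
    / P and a simple one at conj P. *)
Lemma cubic_partial_fractions (z : C) : nm z = 1 ->
  ratf z * cj (ratf z) * ratf z =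
  cub0 + X * z / (1 - P * z) + Y * z ^+ 2 / (1 - P * z) ^+ 2
   + cj A * beta ^+ 2 * cj z / (1 - cj P * cj z).
Proof.
move=> hz; have zz : z * cj z = 1 by rewrite mulzJ hz expr1n.
have z0 : z != 0 by rewrite -nm_eq0 hz oner_eq0.
have zi : cj z = z^-1 by rewrite -[LHS]mul1r -(mulVf z0) -mulrA zz mulr1.
have [d1 _] := nmden (nmPz hz).
have [|d2 _] := @nmden (cj P * cj z).
  by rewrite -cjM nmJ; exact: nmPz.
have e : cj (ratf z) = cj b + cj A * z^-1 / (1 - cj P * z^-1).
  by rewrite /ratf cjD !cjM fmorphV rmorphB !rmorph1 /= cjM zi.
rewrite zi in d2 *; rewrite e /ratf /cub0 /X /Y /beta.
have d3 : z - cj P != 0.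
  by move: d2; apply: contra => /eqP h; rewrite -(mulfV z0) -mulrBl h mul0r.
have d4 := q0; rewrite /q in d4 *.
field; rewrite ?d1 ?d3 ?d4 ?z0 //.
Qed.

Lemma expi_natM (j : nat) (x : R) : expi ((Posz j)%:~R * x) = expi x ^+ j.
Proof.
rewrite (_ : (Posz j)%:~R = j%:R :> R)//; elim: j => [|j IH]; first by rewrite mul0r expi0 expr0.
by rewrite -natr1 mulrDl mul1r expiD IH exprSr.
Qed.

Lemma expi_negM (j : nat) (x : R) : expi ((- Posz j)%:~R * x) = cj (expi x) ^+ j.
Proof. by rewrite rmorphN mulNr expiN expi_natM rmorphXn. Qed.

Let w1 (w : C) : nm w <= rho -> w != 1.
Proof. by move=> /nmden[+ _]; rewrite subr_eq0 eq_sym. Qed.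

Lemma trig_ratc M x : trig (win M) ratc x =
  b + A * expi x * ((1 - (P * expi x) ^+ M) / (1 - P * expi x)).
Proof.
rewrite /trig sum_win mul0r expi0 mulr1; congr (_ + _).
rewrite -sum_geom; last exact: w1 (nmPz (nm_expi x)).
rewrite big_distrr /=; apply: eq_bigr => j _; rewrite mul0r addr0.
by rewrite expi_natM exprMn exprS; ring.
Qed.

Lemma trig_cubc n x : trig (win n.+1) cubc x =
  cub0 + X * expi x * ((1 - (P * expi x) ^+ n.+1) / (1 - P * expi x)) +
  Y * expi x ^+ 2 * ((1 - n.+1%:R * (P * expi x) ^+ n + n%:R * (P * expi x) ^+ n.+1) / (1 - P * expi x) ^+ 2) +
  cj A * beta ^+ 2 * cj (expi x) * ((1 - (cj P * cj (expi x)) ^+ n.+1) / (1 - cj P * cj (expi x))).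
Proof.
have hw := nmPz (nm_expi x).
have hw' : nm (cj P * cj (expi x)) <= rho by rewrite -cjM nmJ.
rewrite /trig sum_win mul0r expi0 mulr1.
rewrite -(sum_geom n.+1 (w1 hw)) -(sum_geom n.+1 (w1 hw')) -(sum_arith_geom n (w1 hw)).
have assoc (c0 s1 s2 s3 : C) : c0 + s1 + s2 + s3 = c0 + (s1 + s2 + s3) by ring.
rewrite assoc; congr (_ + _).
rewrite !big_distrr /= -!big_split /=; apply: eq_bigr => j _.
rewrite expi_natM (expi_negM j.+1) !exprMn.
case: j => [[|j] hj] /=; rewrite ?expr0 ?exprS; ring.
Qed.

(** The partial sums of [cubc] converge uniformly; n rho^n in the rate comes from the double
    pole. *)
Lemma fourier_cubic k :
  fourier (fun x => `|ratf (expi x)| ^+ 2 * ratf (expi x)) k = cubc k.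
Proof.
pose G := cj A * beta ^+ 2.
pose K1 := (nm X + nm G) * D + nm Y * D ^+ 2.
pose K2 := 2 * nm Y * D ^+ 2.
apply: (@fourier_series _ _ (fun n => K1 * rho ^+ n + K2 * (n%:R * rho ^+ n))).
  rewrite -[X in _ --> X](addr0 0); apply: cvgD; first exact: cvg0_geom.
  by apply: cvg0Z; apply: natmul_expr_cvg0; rewrite rho0.
move=> n x.
have hw := nmPz (nm_expi x).
have hw' : nm (cj P * cj (expi x)) <= rho by rewrite -cjM nmJ.
have [d1 i1] := nmden hw; have [d2 i2] := nmden hw'.
rewrite sq_normE cubic_partial_fractions ?nm_expi// trig_cubc -/G.
set z := expi x in d1 d2 i1 i2 hw hw' *.
set w := P * z in d1 i1 hw *; set w' := cj P * cj z in d2 i2 hw' *.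
have -> : cub0 + X * z / (1 - w) + Y * z ^+ 2 / (1 - w) ^+ 2 + G * cj z / (1 - w') -
   (cub0 + X * z * ((1 - w ^+ n.+1) / (1 - w)) +
    Y * z ^+ 2 * ((1 - n.+1%:R * w ^+ n + n%:R * w ^+ n.+1) / (1 - w) ^+ 2) +
    G * cj z * ((1 - w' ^+ n.+1) / (1 - w'))) =
  X * z * (w ^+ n.+1 * (1 - w)^-1) + G * cj z * (w' ^+ n.+1 * (1 - w')^-1) +
  Y * z ^+ 2 * ((n.+1%:R * w ^+ n - n%:R * w ^+ n.+1) * (1 - w)^-1 ^+ 2) by rewrite exprVn; ring.
have rn := exprn_ge0 n rho0.
have hz : nm z = 1 by exact: nm_expi.
have hp (v : C) : nm v <= rho -> nm (v ^+ n) <= rho ^+ n.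
  by move=> hv; rewrite nmX lerXn2r ?nnegrE ?nm_ge0.
have hps (v : C) : nm v <= rho -> nm (v ^+ n.+1) <= rho ^+ n.
  move=> hv; rewrite exprS nmM -[leRHS]mul1r; apply: ler_pM; rewrite ?nm_ge0 ?hp//.
  by rewrite (le_trans hv)// ltW.
have t1 (a v y : C) : nm v <= rho -> nm y = 1 -> nm (1 - v)^-1 <= D ->
    nm (a * y * (v ^+ n.+1 * (1 - v)^-1)) <= nm a * D * rho ^+ n.
  move=> hv hy hi; rewrite !nmM hy mulr1 -mulrA ler_wpM2l ?nm_ge0// mulrC.
  by apply: ler_pM; rewrite ?nm_ge0 ?hps.
have t2 : nm (Y * z ^+ 2 * ((n.+1%:R * w ^+ n - n%:R * w ^+ n.+1) * (1 - w)^-1 ^+ 2)) <=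
    nm Y * (((2 * n%:R + 1) * rho ^+ n) * D ^+ 2).
  rewrite [leLHS]nmM [nm (Y * _)]nmM [nm (z ^+ 2)]nmX hz expr1n mulr1.
  apply: ler_wpM2l; first exact: nm_ge0.
  rewrite [leLHS]nmM [nm ((1 - w)^-1 ^+ 2)]nmX; apply: ler_pM; rewrite ?exprn_ge0 ?nm_ge0//; last by rewrite ler_pXn2r ?nnegrE ?nm_ge0// ltW.
  have nmn (m : nat) : nm (m%:R : C) = m%:R.
    by rewrite -(rmorph_nat (real_complex R)) nm_real ger0_norm.
  apply: le_trans (nmB _ _) _; rewrite !nmM !nmn.
  have := hp w hw; have := hps w hw; have n0 : 0 <= n%:R :> R by exact: ler0n.
  rewrite -natr1 => a1 a2; have := ler_wpM2l n0 a1; have := ler_wpM2l n0 a2; lra.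
apply: le_trans (nmD _ _) _; apply: le_trans (lerD (nmD _ _) t2) _.
have b1 := t1 X w z hw hz i1; have b2 := t1 G w' (cj z) hw' _ i2.
rewrite nmJ in b2; have {}b2 := b2 hz.
by rewrite /K1 /K2; lra.
Qed.

(** Truncating the profile moves the function by O(rho^M) uniformly in x, hence moves each
    coefficient of its cubic term by the same order. *)
Lemma tri_ratc_close M k :
  nm (tri3 (win M) ratc k - cubc k) <=
  2 * (3 * (Bd * (1 + D)) ^+ 2 * (Bd * D * rho ^+ M)).
Proof.
have D1 : 0 <= D by exact: ltW.
have BD : 0 <= Bd * (1 + D) by rewrite mulr_ge0 ?addr_ge0.
have hV x : nm (trig (win M) ratc x) <= Bd * (1 + D).
  rewrite /trig sum_win mul0r expi0 mulr1; apply: le_trans (nmD _ _) _.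
  rewrite mulrDr mulr1; apply: lerD => //; apply: le_trans (nm_sum _ _ _) _.
  apply: (@le_trans _ _ (\sum_(j < M) Bd * rho ^+ j)).
    apply: ler_sum => j _; rewrite mul0r addr0 nmM nm_expi mulr1 nmM nmX.
    apply: ler_pM; rewrite ?nm_ge0 ?exprn_ge0 ?nm_ge0//.
    by rewrite lerXn2r ?nnegrE ?nm_ge0.
  by rewrite -big_distrr ler_wpM2l//= sum_geom_le.
have hF x : nm (ratf (expi x)) <= Bd * (1 + D).
  have [d1 i1] := nmden (nmPz (nm_expi x)).
  rewrite /ratf; apply: le_trans (nmD _ _) _; rewrite mulrDr mulr1; apply: lerD => //.
  by rewrite !nmM nm_expi mulr1; apply: ler_pM; rewrite ?nm_ge0.
have hd (M' : nat) x : nm (trig (win M') ratc x - ratf (expi x)) <= Bd * D * rho ^+ M'.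
  have [d1 i1] := nmden (nmPz (nm_expi x)).
  rewrite trig_ratc /ratf.
  have -> : b + A * expi x * ((1 - (P * expi x) ^+ M') / (1 - P * expi x)) -
    (b + A * expi x / (1 - P * expi x)) = - (A * (1 - P * expi x)^-1 * (P * expi x) ^+ M' * expi x) by ring.
  rewrite nmN !nmM nm_expi mulr1 nmX; apply: ler_pM; rewrite ?mulr_ge0 ?exprn_ge0 ?nm_ge0//.
    by apply: ler_pM; rewrite ?nm_ge0.
  by rewrite lerXn2r ?nnegrE ?nm_ge0//; exact: nmPz (nm_expi x).
have cR : ccont (fun x => ratf (expi x)).
  apply: (ccont_uniform (w := fun n x => trig (win n) ratc x) (e := fun n => Bd * D * rho ^+ n)).
  - exact: cvg0_geom.
  - by move=> n; exact: ccont_trig.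
  - by move=> n x; rewrite nm_distC.
rewrite -fourier_tri -fourier_cubic -fourierB; try exact: ccont_cubic; last exact/ccont_cubic/ccont_trig.
apply: fourier_le => [|x].
  apply: ccontD; first exact/ccont_cubic/ccont_trig.
  under eq_fun do rewrite -mulN1r; apply: ccontM; [exact: ccont_cst|exact: ccont_cubic].
apply: le_trans (cubic_lip (hV x) (hF x)) _.
by apply: ler_wpM2l; [rewrite mulr_ge0 ?exprn_ge0|exact: hd].
Qed.

End Coefficients.

End RationalCubic.

(** * An explicit solution of the cubic Szego equation *)

Section Explicit.
Variable R : realType.
Local Notation C := R[i].
Local Notation lam := (@lam R).

Lemma cder_real (f : R -> R) (t df : R) : is_derive t 1 f df -> is_cderive (fun s => (f s)%:C) t df%:C.
Proof. by move=> h; split; [exact: h|exact: is_derive_cst]. Qed.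

Lemma cder_sin (a t : R) : is_cderive (fun s => (sin (a * s))%:C) t (a%:C * (cos (a * t))%:C).
Proof.
have [_ h] := cder_expi a t; rewrite -rmorphM; apply: cder_real; apply: (rder_eq h) => /=; ring.
Qed.

Lemma cder_cos (a t : R) : is_cderive (fun s => (cos (a * s))%:C) t (- (a%:C * (sin (a * t))%:C)).
Proof.
have [h _] := cder_expi a t; rewrite -rmorphM -rmorphN; apply: cder_real; apply: (rder_eq h) => /=; ring.
Qed.

Lemma cj_real (x : R) : cj x%:C = x%:C :> C.
Proof. by apply: eq_ReIm; rewrite //= oppr0. Qed.

Let reM (x y : R) : (x * y)%:C = x%:C * y%:C :> C. Proof. exact: rmorphM. Qed.

Let reD (x y : R) : (x + y)%:C = x%:C + y%:C :> C. Proof. exact: rmorphD. Qed.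

Let reN (x : R) : (- x)%:C = - x%:C :> C. Proof. exact: rmorphN. Qed.

Let reX (x : R) n : (x ^+ n)%:C = x%:C ^+ n :> C. Proof. exact: rmorphXn. Qed.

Let natC (n : nat) : (n%:R)%:C = n%:R :> C. Proof. exact: (rmorph_nat (real_complex R)). Qed.

Let cj_nat (n : nat) : cj n%:R = n%:R :> C. Proof. exact: (rmorph_nat (@conjc R)). Qed.

Variables (e d : R).
Hypotheses (d0 : 0 < d).

(* With the phases szF and szG factored out, the Szego equation for
   v = e (b + A z / (1 - P z)) reduces to a rotation with frequency szom e^2. *)
Definition szh : R := Num.sqrt (4 + d ^+ 2).
Definition szom : R := d * szh / 2.
Let kap : R := szh^-1.
Definition szsin (t : R) : R := sin (szom * e ^+ 2 * t).
Definition szcos (t : R) : R := cos (szom * e ^+ 2 * t).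
Definition szF (t : R) : C := expi (- (e ^+ 2 * (1 + d ^+ 2 / 2)) * t).
Definition szG (t : R) : C := expi (- (1 + e ^+ 2 * d ^+ 2 / 2) * t).
Definition szb (t : R) : C := szF t * ((d * szcos t)%:C - 'i%C * ((2 + d ^+ 2) / szh * szsin t)%:C).
Definition szP (t : R) : C := szG t * - ('i%C * (2 / szh * szsin t)%:C).
(** Over a common denominator the profile is (b + F G z) / (1 - P z): the coefficient of z in the
    numerator keeps modulus 1. *)
Definition szA (t : R) : C := szF t * szG t + szb t * szP t.
Definition szr (t : R) : R := 4 / szh ^+ 2 * szsin t ^+ 2.

Lemma szh_gt0 : 0 < szh.
Proof. by rewrite sqrtr_gt0 addr_gt0// exprn_gt0. Qed.

Lemma szh2 : szh ^+ 2 = 4 + d ^+ 2.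
Proof. by rewrite sqr_sqrtr// addr_ge0// sqr_ge0. Qed.

(** This is szh^2 = 4 + d^2 divided by szh^2. With sin^2 + cos^2 = 1, i^2 = -1 and the unimodularity
    of F and G, it generates the relations modulo which [ring:] and [field:] check the identities
    below. *)
Let kapE : kap * kap * d * d = 1 - 4 * (kap * kap).
Proof.
have := szh2; have h0 := szh_gt0; rewrite /kap => hh.
have h1 : szh != 0 by rewrite gt_eqF.
have -> : szh^-1 * szh^-1 * d * d = d ^+ 2 / szh ^+ 2 by field.
have -> : d ^+ 2 = szh ^+ 2 - 4 by rewrite hh; ring.
by field.
Qed.

Let kapC : kap%:C * kap%:C * d%:C * d%:C = 1 - 4 * (kap%:C * kap%:C) :> C.
Proof. by rewrite -!reM kapE reD reN !reM natC. Qed.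

Let scC t : (szsin t)%:C * (szsin t)%:C = 1 - (szcos t)%:C * (szcos t)%:C :> C.
Proof.
rewrite -!rmorphM -[X in X - _](rmorph1 (real_complex R)) -rmorphB /=; congr (_%:C).
by have := cos2Dsin2 (szom * e ^+ 2 * t); rewrite /szsin /szcos !expr2 => <-; ring.
Qed.

Let FF t : szF t * cj (szF t) = 1. Proof. exact: expi_mulJ. Qed.
Let GG t : szG t * cj (szG t) = 1. Proof. exact: expi_mulJ. Qed.

Let bE t : szb t = szF t * (d%:C * (szcos t)%:C - 'i%C * ((2 + d%:C ^+ 2) * kap%:C * (szsin t)%:C)).
Proof. by rewrite /szb !reM reD reX natC. Qed.
Let cbE t : cj (szb t) = cj (szF t) * (d%:C * (szcos t)%:C + 'i%C * ((2 + d%:C ^+ 2) * kap%:C * (szsin t)%:C)).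
Proof.
rewrite bE cjM; congr (_ * _); rewrite cjD cjN !cjM cj_i cjD expr2 cjM !cj_real cj_nat; ring.
Qed.
Let PE t : szP t = szG t * - ('i%C * (2 * kap%:C * (szsin t)%:C)).
Proof. by rewrite /szP !reM natC. Qed.
Let cPE t : cj (szP t) = cj (szG t) * ('i%C * (2 * kap%:C * (szsin t)%:C)).
Proof.
rewrite PE cjM; congr (_ * _); rewrite cjN !cjM cj_i !cj_real cj_nat; ring.
Qed.
Let rE t : (szr t)%:C = 4 * kap%:C * kap%:C * (szsin t)%:C * (szsin t)%:C :> C.
Proof. by rewrite /szr -exprVn !expr2 !reM natC; ring. Qed.

Lemma szP_mulJ t : szP t * cj (szP t) = (szr t)%:C.
Proof.
rewrite cPE PE rE; have := GG t; set G := szG t; set cG := cj G => h.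
by ring: h (ii R).
Qed.

Lemma szb_mulJ t : szb t * cj (szb t) = (szr t)%:C + d%:C ^+ 2.
Proof.
rewrite cbE bE rE; have := FF t; set G := szF t; set cG := cj G => h.
have := scC t; set S := (szsin t)%:C; set Co := (szcos t)%:C => h2.
have := kapC; set k := kap%:C; set D := d%:C => h3.
ring: h (ii R) h2 h3.
Qed.

Let AE t : szA t = szF t * szG t * (1 + (d%:C * (szcos t)%:C - 'i%C * ((2 + d%:C ^+ 2) * kap%:C * (szsin t)%:C)) * - ('i%C * (2 * kap%:C * (szsin t)%:C))).
Proof. by rewrite /szA bE PE; ring. Qed.

Let cAE t : cj (szA t) = cj (szF t) * cj (szG t) * (1 + (d%:C * (szcos t)%:C + 'i%C * ((2 + d%:C ^+ 2) * kap%:C * (szsin t)%:C)) * ('i%C * (2 * kap%:C * (szsin t)%:C))).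
Proof. by rewrite /szA cjD [cj (szF t * _)]cjM [cj (szb t * _)]cjM cbE cPE; ring. Qed.

(** This cancels the denominators 1 - |P|^2 of [cubc], so that the equations for b, P and A are
    polynomial. It is also the link between residue and pole that bounds the weighted norm in
    [NW_szv]. *)
Lemma szA_mulJ t : szA t * cj (szA t) = (1 - (szr t)%:C) ^+ 2.
Proof.
rewrite cAE AE rE.
have := FF t; set F := szF t; set cF := cj F => h.
have := GG t; set G := szG t; set cG := cj G => h'.
have := scC t; set S := (szsin t)%:C; set Co := (szcos t)%:C => h2.
have := kapC; set k := kap%:C; set D := d%:C => h3.
ring: h h' (ii R) h2 h3.
Qed.


Let half : (2^-1)%:C = 2^-1 :> C. Proof.
have n2 : (2 : C) != 0 by rewrite pnatr_eq0.
by apply: (mulIf n2); rewrite mulVf// -[X in _ * X]natC -reM mulVf// pnatr_eq0.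
Qed.

Let omE : (szom * e ^+ 2)%:C = d%:C * kap%:C * (4 + d%:C ^+ 2) / 2 * e%:C ^+ 2.
Proof.
have -> : szom = d * kap * (4 + d ^+ 2) * 2^-1.
  by rewrite -szh2 /szom /kap; have := szh_gt0 => h; field; rewrite gt_eqF.
by rewrite 4!reM reD 2!reX natC half.
Qed.

Let pE : (- (1 + e ^+ 2 * d ^+ 2 / 2))%:C = - (1 + e%:C ^+ 2 * d%:C ^+ 2 / 2) :> C.
Proof. by rewrite reN reD 2!reM 2!reX half. Qed.

Let fE : (- (e ^+ 2 * (1 + d ^+ 2 / 2)))%:C = - (e%:C ^+ 2 * (1 + d%:C ^+ 2 / 2)) :> C.
Proof. by rewrite reN reM [(e ^+ 2)%:C]reX reD reM reX half. Qed.

Lemma cder_szP t : is_cderive szP t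
  (- ('i%C * (szP t + e%:C ^+ 2 * (szA t * cj (szb t) + (1 - (szr t)%:C) * szP t)))).
Proof.
have hP : szP = fun t => szG t * - ('i%C * (2 * kap%:C * (szsin t)%:C)) by apply: funext => s; rewrite PE.
rewrite {1}hP; apply: cder_eq (cderM (cder_expi _ _) (cderN (cderZ _ (cderZ _ (cder_sin _ _))))).
rewrite cbE AE PE rE pE omE.
have := FF t; set F := szF t; set cF := cj F => h.
rewrite -/(szG t); set G := szG t.
have := scC t; rewrite -/(szcos t) -/(szsin t); set S := (szsin t)%:C; set Co := (szcos t)%:C => h2.
have := kapC; set k := kap%:C; set D := d%:C => h3.
set E := e%:C.
by field: h (ii R) h2 h3.
Qed.

Lemma cder_szb t : is_cderive szb t
  (- ('i%C * (e%:C ^+ 2 * (szb t ^+ 2 * cj (szb t) + 2 * szb t * (1 - (szr t)%:C) + szA t * cj (szP t))))).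
Proof.
have hP : szb = fun t => szF t * (d%:C * (szcos t)%:C - 'i%C * ((2 + d%:C ^+ 2) * kap%:C * (szsin t)%:C)).
  by apply: funext => s; rewrite bE.
rewrite {1}hP; apply: cder_eq (cderM (cder_expi _ _) (cderB (cderZ _ (cder_cos _ _)) (cderZ _ (cderZ _ (cder_sin _ _))))).
rewrite cbE cPE AE bE rE fE omE.
have := FF t; rewrite -/(szF t); set F := szF t; set cF := cj F => h.
have := GG t; set G := szG t; set cG := cj G => h'.
have := scC t; rewrite -/(szcos t) -/(szsin t); set S := (szsin t)%:C; set Co := (szcos t)%:C => h2.
have := kapC; set k := kap%:C; set D := d%:C => h3.
set E := e%:C.
by field: h h' (ii R) h2 h3.
Qed.

Lemma cder_szA t : is_cderive szA t
  (- ('i%C * (szA t + e%:C ^+ 2 *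
     (2 * szb t * cj (szb t) * szA t + 2 * szb t * (1 - (szr t)%:C) * szP t + szA t)))).
Proof.
apply: cder_eq (cderD (cderM (cder_expi _ _) (cder_expi _ _)) (cderM (cder_szb t) (cder_szP t))).
rewrite pE fE.
have hb := szb_mulJ t; have hP := szP_mulJ t; move: hb hP; rewrite /szA -/(szF t) -/(szG t).
set b := szb t; set P := szP t; set cb := cj b; set cP := cj P; set r := (szr t)%:C => hb hP.
set F := szF t; set G := szG t; set D := d%:C; set E := e%:C.
by field: hb hP.
Qed.

(** 1 - szeta is the largest value of |P|^2, reached when szsin is 1 or -1. *)
Definition szeta : R := d ^+ 2 / (4 + d ^+ 2).

Let den0 : 0 < 4 + d ^+ 2. Proof. by rewrite addr_gt0// exprn_gt0. Qed.

Lemma szrE t : szr t = (1 - szeta) * szsin t ^+ 2.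
Proof.
rewrite /szr szh2 /szeta; congr (_ * _); field; by rewrite gt_eqF.
Qed.

Lemma szeta_gt0 : 0 < szeta.
Proof. by rewrite divr_gt0// exprn_gt0. Qed.

Lemma szeta_lt1 : szeta < 1.
Proof. by rewrite ltr_pdivrMr// mul1r ltrDr. Qed.

Lemma szr_ge0 t : 0 <= szr t.
Proof. by rewrite szrE mulr_ge0 ?sqr_ge0// subr_ge0 ltW// szeta_lt1. Qed.

Lemma szr_le t : szr t <= 1 - szeta.
Proof.
rewrite szrE -[leRHS]mulr1; apply: ler_wpM2l; first by rewrite subr_ge0 ltW// szeta_lt1.
by rewrite /szsin; have := cos2Dsin2 (szom * e ^+ 2 * t); have := sqr_ge0 (cos (szom * e ^+ 2 * t)); lra.
Qed.

Lemma szr_lt1 t : szr t < 1.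
Proof. by have := szr_le t; have := szeta_gt0; lra. Qed.

Lemma nm_szP2 t : nm (szP t) ^+ 2 = szr t.
Proof. by have := szP_mulJ t; rewrite mulzJ => -[]. Qed.

Lemma nm_szb2 t : nm (szb t) ^+ 2 = szr t + d ^+ 2.
Proof.
by have := szb_mulJ t; rewrite mulzJ -reX -reD => -[].
Qed.

Lemma nm_szA t : nm (szA t) = 1 - szr t.
Proof.
have h : 0 <= 1 - szr t by rewrite subr_ge0 ltW// szr_lt1.
apply/eqP; rewrite -(@eqrXn2 _ 2)// ?nm_ge0//.
by have := szA_mulJ t; rewrite mulzJ -[1 : C]/(1%:C) -reN -reD -reX => -[->].
Qed.

Definition szv (t : R) (k : int) : C := e%:C * ratc (szb t) (szA t) (szP t) k.
Definition szn (t : R) (k : int) : C := e%:C ^+ 3 * cubc (szb t) (szA t) (szP t) k.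

(** The Szego equation mode by mode, on the frequencies k >= 0 kept by the projection. *)
Lemma cder_szv t (j : nat) : is_cderive (szv^~ (Posz j)) t
  (- ('i%C * (lam (Posz j))%:C * szv t (Posz j)) - 'i%C * szn t (Posz j)).
Proof.
have q0 : 1 - (szr t)%:C != 0 :> C.
  rewrite -[1 : C]/(1%:C) -reN -reD -nm_eq0 nm_real gtr0_norm ?subr_gt0 ?szr_lt1//.
  by rewrite gt_eqF// subr_gt0 szr_lt1.
have hA := szA_mulJ t.
have -> : (lam (Posz j))%:C = j%:R :> C by rewrite -natC.
rewrite /szn /szv /cubc /ratc szP_mulJ; case: j => [|j].
  apply: cder_eq (cderZ _ (cder_szb t)).
  set b := szb t; set cb := cj b; set A := szA t; set P := szP t; set cP := cj P.
  set q := 1 - _; rewrite -/q in q0 hA *; rewrite -/A -/cb in hA *; set cA := cj A in hA *.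
  rewrite mulr0 mul0r oppr0 add0r.
  have -> : cA * (2 * b * A / q + A ^+ 2 * cP / q ^+ 2) = A * cA * (2 * b / q + A * cP / q ^+ 2) by ring.
  rewrite hA; by field.
apply: cder_eq (cderZ _ (cderM (cder_szA t) (cderX j (cder_szP t)))).
set b := szb t; set cb := cj b; set A := szA t; set P := szP t.
set q := 1 - _; rewrite -/q in q0 hA *; rewrite -/A -/cb in hA *; set cA := cj A in hA *.
have -> : 2 * b * cb * A + 2 * b * A * cA * P / q + cA * A ^+ 2 / q ^+ 2 =
  2 * b * cb * A + A * cA * (2 * b * P / q + A / q ^+ 2) by ring.
have -> : cb * A ^+ 2 + cA * A ^+ 2 * P / q = cb * A ^+ 2 + A * cA * (A * P / q) by ring.
have -> : j.+1%:R = j%:R + 1 :> C by rewrite natr1.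
rewrite hA.
case: j => [|j]; first by rewrite !expr0 !mul0r; field.
by rewrite (exprS P) [j.+1.-1]/=; set p := P ^+ j; set n := j.+1%:R; field.
Qed.

End Explicit.

(** * Distance from the Galerkin solution to the explicit profile *)

Section TriAlgebra.
Variable R : realType.
Implicit Types (f g h : int -> R[i]) (W : seq int).

Lemma triZl W (x : R[i]) f g h k : tri W (fun a => x * f a) g h k = x * tri W f g h k.
Proof.
rewrite /tri big_distrr; apply: eq_bigr => a _; rewrite big_distrr; apply: eq_bigr => b _.
by rewrite big_distrr; apply: eq_bigr => c _ /=; case: ifP => _; rewrite ?mulr0// !mulrA.
Qed.

Lemma triZm W (x : R[i]) f g h k : tri W f (fun a => x * g a) h k = cj x * tri W f g h k.
Proof.
rewrite /tri big_distrr; apply: eq_bigr => a _; rewrite big_distrr; apply: eq_bigr => b _.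
by rewrite big_distrr; apply: eq_bigr => c _ /=; case: ifP => _; rewrite ?mulr0// cjM; ring.
Qed.

Lemma triZr W (x : R[i]) f g h k : tri W f g (fun a => x * h a) k = x * tri W f g h k.
Proof.
rewrite /tri big_distrr; apply: eq_bigr => a _; rewrite big_distrr; apply: eq_bigr => b _.
by rewrite big_distrr; apply: eq_bigr => c _ /=; case: ifP => _; rewrite ?mulr0//; ring.
Qed.

Lemma tri_frequency W f g h k :
  tri W (fun a => a%:~R%:C * f a) g h k - tri W f (fun a => a%:~R%:C * g a) h k +
  tri W f g (fun a => a%:~R%:C * h a) k = k%:~R%:C * tri W f g h k.
Proof.
rewrite /tri -sumrB -big_split big_distrr; apply: eq_bigr => a _.
rewrite -sumrB -big_split big_distrr; apply: eq_bigr => b _.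
rewrite -sumrB -big_split big_distrr; apply: eq_bigr => c _ /=.
case: eqP => [<-|_]; last by rewrite subrr mulr0 addr0.
have -> : ((a - b + c)%:~R : R)%:C = (a%:~R : R)%:C - (b%:~R : R)%:C + (c%:~R : R)%:C :> R[i].
  by rewrite intrD intrB; apply: eq_ReIm => /=; ring.
by rewrite cjM cj_real; ring.
Qed.

(** When each mode a of v rotates at rate a, the k-th mode of the cubic term rotates at rate k
    because a - b + c = k. What remains contains n once, and is of fifth order when n is cubic. *)
Lemma cder_tri_transport W (v n : R -> int -> R[i]) t k :
  (forall a, is_cderive (v^~ a) t (- 'i%C * (a%:~R%:C * v t a) - 'i%C * n t a)) ->
  is_cderive (fun s => tri3 W (v s) k) t (- 'i%C * (k%:~R%:C * tri3 W (v t) k +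
    (tri W (n t) (v t) (v t) k - tri W (v t) (n t) (v t) k + tri W (v t) (v t) (n t) k))).
Proof.
move=> hv.
pose v' t k : R[i] := - 'i%C * (k%:~R%:C * v t k) - 'i%C * n t k.
have dv : {in W, forall k, is_cderive (v^~ k) t (v' t k)} by move=> a _; exact: hv.
apply: cder_eq (cder_tri k dv dv dv); rewrite /v'.
by rewrite triBl triBm triBr !triZl !triZm !triZr !(cjN, cj_i) -tri_frequency; ring.
Qed.

End TriAlgebra.

(** * The weight sigma^{-|k|} *)

Section ExponentialWeight.
Variables (R : realType) (sg : R).
Hypotheses (sg0 : 0 < sg) (sg1 : sg < 1).

Definition expw (k : int) : R := sg^-1 ^+ `|k|%N.

Let i1 : 1 <= sg^-1. Proof. by rewrite invf_ge1// ltW. Qed.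
Let i0 : 0 <= sg^-1. Proof. exact: le_trans i1. Qed.

Lemma expw_ge0 k : 0 <= expw k. Proof. exact: exprn_ge0. Qed.

Lemma expw_submul a b c : expw (a - b + c) <= expw a * expw b * expw c.
Proof. by rewrite /expw -!exprD; apply: ler_weXn2l => //; lia. Qed.

Lemma sum_expw N : \sum_(k <- win N) expw k <= (2 * N%:R + 1) * sg^-1 ^+ N.
Proof.
rewrite sum_win.
have h (k : int) : (`|k| <= N)%N -> expw k <= sg^-1 ^+ N by move=> kN; exact: ler_weXn2l.
have -> : (2 * N%:R + 1) * sg^-1 ^+ N = sg^-1 ^+ N + \sum_(j < N) (sg^-1 ^+ N + sg^-1 ^+ N).
  by rewrite sumr_const card_ord -(mulr_natr (_ + _) N); ring.
by apply: lerD; [exact: h|apply: ler_sum => j _; apply: lerD; apply: h; have := ltn_ord j; lia].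
Qed.

End ExponentialWeight.

(** * Weighted bounds on the profile, the corrector and the Gronwall estimate *)

Section Profile.
Variables (R : realType) (e d sg : R).
Local Notation C := R[i].
Hypotheses (e0 : 0 < e) (d0 : 0 < d) (d1 : d <= 1) (sg0 : 0 < sg) (sg1 : sg < 1)
  (hsg : sg ^+ 8 = 1 - szeta d).
Local Notation w := (expw sg).
Local Notation v := (szv e d).
Local Notation W := win.

Lemma szeta_le : szeta d <= 1 / 5.
Proof.
rewrite /szeta ler_pdivrMr; last by rewrite addr_gt0// exprn_gt0.
have := ler_pM (ltW d0) (ltW d0) d1 d1; rewrite -expr2; lra.
Qed.

Lemma sg_ge : 4 / 5 <= sg.
Proof.
have : sg ^+ 8 <= sg ^+ 1 by apply: ler_wiXn2l; rewrite ?ltW.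
by rewrite expr1 hsg; have := szeta_le; lra.
Qed.

Lemma nm_szP t : nm (szP e d t) <= sg ^+ 4.
Proof.
have s4 := exprn_ge0 4 (ltW sg0).
rewrite -(@ler_pXn2r _ 2) ?nnegrE ?nm_ge0// nm_szP2// -exprM hsg; exact: szr_le.
Qed.

Lemma nm_szb t : nm (szb e d t) <= 2.
Proof.
rewrite -(@ler_pXn2r _ 2) ?nnegrE ?nm_ge0// nm_szb2//.
have := szr_le e d0 t; have := szeta_gt0 d0.
have := ler_pM (ltW d0) (ltW d0) d1 d1; rewrite -expr2; lra.
Qed.

Lemma nm_szA1 t : nm (szA e d t) <= 1.
Proof. by rewrite nm_szA// gerBl szr_ge0. Qed.

Lemma szv_neg t (j : nat) : v t (Negz j) = 0.
Proof. by rewrite /szv mulr0. Qed.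

(** The mean contributes 2 e. With p = |P|, the rest is at most e (1 - p^2) / (sg - p), bounded by 4
    e uniformly in time. *)
Lemma NW_szv N t : NW w (W N) (v t) <= 6 * e.
Proof.
rewrite /NW sum_win /szv.
have ne : nm (e%:C : C) = e by rewrite nm_real gtr0_norm.
have -> : w 0 * nm (e%:C * ratc (szb e d t) (szA e d t) (szP e d t) 0) = e * nm (szb e d t).
  by rewrite /expw expr0 mul1r nmM ne.
set p : R := nm (szP e d t); have p0 : 0 <= p by exact: nm_ge0.
pose x := p / sg; pose y := (1 - szr e d t) / sg.
have x0 : 0 <= x by rewrite divr_ge0// ltW.
have hp : p <= sg ^+ 4 by exact: nm_szP.
have rp : szr e d t = p ^+ 2 by rewrite nm_szP2.
have hs := sg_ge.
(* Equivalent to 1 - p >= 2 (1 - sg), and implied by p <= sg^4 once sg >= 4/5; it yields 2 (1 - p)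
   <= 4 (sg - p). *)
have hp2 : p <= 2 * sg - 1.
  apply: le_trans hp _; rewrite -subr_ge0.
  have -> : 2 * sg - 1 - sg ^+ 4 = (1 - sg) * (sg ^+ 3 + sg ^+ 2 + sg - 1) by ring.
  apply: mulr_ge0; first by rewrite subr_ge0 ltW.
  have : 4 / 5 * (4 / 5) <= sg * sg by apply: ler_pM.
  have := exprn_ge0 3 (ltW sg0); rewrite (expr2 sg); lra.
have hy : y <= 4 * (1 - x).
  rewrite /y /x rp ler_pdivrMr//.
  have -> : 4 * (1 - p / sg) * sg = 4 * (sg - p) by field; rewrite gt_eqF.
  have -> : 1 - p ^+ 2 = (1 - p) * (1 + p) by ring.
  apply: (@le_trans _ _ ((1 - p) * 2)); last by lra.
  have hp3 : p <= 1 by have s1 := sg1; lra.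
  apply: ler_wpM2l; first by rewrite subr_ge0.
  by rewrite -[2]/(1 + 1) lerD2l.
have x1 : x < 1 by rewrite ltr_pdivrMr// mul1r; have s1 := sg1; lra.
have hsum : \sum_(j < N) y * x ^+ j <= 4.
  rewrite -big_distrr; apply: le_trans (ler_wpM2l _ (sum_geom_le N x0 x1)) _.
    by rewrite divr_ge0 ?(ltW sg0)// subr_ge0 ltW// szr_lt1.
  by rewrite ler_pdivrMr ?subr_gt0.
apply: (@le_trans _ _ (e * 2 + e * \sum_(j < N) y * x ^+ j)); last first.
  by have := ler_wpM2l (ltW e0) hsum; lra.
apply: lerD; first by rewrite ler_wpM2l ?(ltW e0) ?nm_szb.
rewrite big_distrr; apply: ler_sum => j _.
rewrite -[ratc _ _ _ (- _)]/(0 : C) mulr0 nm0 mulr0 addr0 -[ratc _ _ _ _]/(szA e d t * szP e d t ^+ j).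
rewrite /expw absz_nat !nmM ne nmX nm_szA// -/p /y /x exprSr.
rewrite -[leRHS]/(e * ((1 - szr e d t) / sg * (p / sg) ^+ j)).
apply: le_of_eq; rewrite expr_div_n exprVn; field.
by rewrite expf_neq0 ?gt_eqF.
Qed.

Definition forcing (t : R) (k : int) : C := if k is Posz _ then szn e d t k else 0.
Local Notation n := forcing.

Lemma cder_szv_all t k : is_cderive (v^~ k) t (- 'i%C * (k%:~R%:C * v t k) - 'i%C * n t k).
Proof.
case: k => j.
  apply: cder_eq (cder_szv e d0 t j).
  by congr (_ - _); rewrite -mulrA -mulNr.
by rewrite /szv /= !mulr0 subr0; exact: cder_cst.
Qed.

Let D : R := (1 - sg ^+ 4)^-1.
(** The constant of [tri_ratc_close] for rho = sg^4 and Bd = 2, as |b| <= 2 and |A| <= 1. *)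
Definition tail_cst : R := 2 * (3 * (2 * (1 + D)) ^+ 2 * (2 * D)).

Let s4lt : sg ^+ 4 < 1. Proof. by rewrite exprn_ilt1// ltW. Qed.
Let s4ge : 0 <= sg ^+ 4. Proof. exact/exprn_ge0/ltW. Qed.
Let D0 : 0 < D. Proof. by rewrite invr_gt0 subr_gt0. Qed.

Lemma tri_szv W t k : tri3 W (v t) k =
  e%:C ^+ 3 * tri W (ratc (szb e d t) (szA e d t) (szP e d t))
    (ratc (szb e d t) (szA e d t) (szP e d t)) (ratc (szb e d t) (szA e d t) (szP e d t)) k.
Proof. by rewrite /szv triZl triZm triZr cj_real; ring. Qed.

Lemma forcing_close N t (j : nat) :
  nm (tri3 (win N) (v t) (Posz j) - n t (Posz j)) <= e ^+ 3 * (tail_cst * (sg ^+ 4) ^+ N).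
Proof.
rewrite tri_szv /n /szn -mulrBr nmM nmX nm_real gtr0_norm//.
apply: ler_wpM2l; first exact/exprn_ge0/ltW.
have h := tri_ratc_close s4ge s4lt (nm_szP t) (nm_szb t) (le_trans (nm_szA1 t) _) N j.
apply: le_trans (h _) _; first by lra.
by rewrite /tail_cst -/D !mulrA.
Qed.

Section Window.
Variables (N : nat) (hN : tail_cst * (2 * N%:R + 1) * sg ^+ (3 * N) <= e ^+ 2).
Hypothesis (e1 : e <= 1).
Local Notation V := (win N).
Local Notation T f := (tri3 V f).

Let uV : uniq V. Proof. exact: uniq_win. Qed.
Let w0 := expw_ge0 sg0 sg1.
Let wM := expw_submul sg0 sg1.
Let tb f g h := @tri_bound R w V V f g h w0 wM uV.

Let tail_ge0 : 0 <= tail_cst.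
Proof. by rewrite /tail_cst !mulr_ge0 ?exprn_ge0 ?mulr_ge0 ?addr_ge0// ltW. Qed.

(** The weights on the window sum to at most (2 N + 1) sg^{-N}. Against the truncation error sg^{4
    N} this leaves the factor sg^{3 N} that [hN] makes small. *)
Let ksum : \sum_(k <- V) w k * (e ^+ 3 * (tail_cst * (sg ^+ 4) ^+ N)) <= e ^+ 5.
Proof.
rewrite -big_distrl /=.
have h0 : 0 <= e ^+ 3 * (tail_cst * (sg ^+ 4) ^+ N).
  by rewrite mulr_ge0 ?exprn_ge0 ?(ltW e0)// mulr_ge0// exprn_ge0.
apply: le_trans (ler_wpM2r h0 (sum_expw sg0 sg1 N)) _.
have -> : (2 * N%:R + 1) * sg^-1 ^+ N * (e ^+ 3 * (tail_cst * (sg ^+ 4) ^+ N)) =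
   e ^+ 3 * (tail_cst * (2 * N%:R + 1) * sg ^+ (3 * N)).
  have -> : (sg ^+ 4) ^+ N = sg ^+ (3 * N) * sg ^+ N by rewrite -exprM -exprD; congr (_ ^+ _); rewrite mulSnr.
  by rewrite exprVn; field; rewrite expf_neq0 ?gt_eqF.
by rewrite (exprD e 3 2); apply: ler_wpM2l => //; exact/exprn_ge0/ltW.
Qed.

Let e30 : 0 <= e ^+ 3. Proof. exact/exprn_ge0/ltW. Qed.
Let e53 : e ^+ 5 <= e ^+ 3. Proof. by apply: ler_wiXn2l => //; exact: ltW. Qed.

Lemma NW_tri_szv t : NW w V (T (v t)) <= 216 * e ^+ 3.
Proof.
apply: le_trans (tb _ _ _) _; have h := NW_szv N t; have h0 := NW_ge0 V (v t) w0.
have h2 := ler_pM (mulr_ge0 h0 h0) h0 (ler_pM h0 h0 h h) h.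
by apply: le_trans h2 _; apply: le_of_eq; ring.
Qed.

(** The cubic term of the truncated profile gives 216 = 6^3, the truncation error 1. *)
Lemma NW_forcing t : NW w V (n t) <= 217 * e ^+ 3.
Proof.
apply: (@le_trans _ _ (NW w V (T (v t)) + \sum_(k <- V) w k * (e ^+ 3 * (tail_cst * (sg ^+ 4) ^+ N)))).
  rewrite /NW -big_split; apply: ler_sum => k _; rewrite /= -mulrDr; apply: ler_wpM2l => //.
  case: k => j; last by rewrite nm0 addr_ge0 ?nm_ge0// mulr_ge0// mulr_ge0// exprn_ge0.
  by have := forcing_close N t j; have := nm_lerB (n t j) (T (v t) j); rewrite nm_distC; lra.
have := NW_tri_szv t; have := ksum; have := e53; lra.
Qed.

(** What is left of the derivative of the cubic term of v after the rotation of [cder_tri_transport]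
    is split off, up to the factor - i. *)
Definition quad_forcing (t : R) (k : int) : C :=
  tri V (n t) (v t) (v t) k - tri V (v t) (n t) (v t) k + tri V (v t) (v t) (n t) k.

Lemma NW_quad_forcing t : NW w V (quad_forcing t) <= 23436 * e ^+ 5.
Proof.
apply: le_trans (NWD _ _ _ w0) _.
apply: le_trans (lerD (NWB _ _ _ w0) (lexx _)) _.
have h := NW_szv N t; have h0 := NW_ge0 V (v t) w0.
have g := NW_forcing t; have g0 := NW_ge0 V (n t) w0.
have k1 := ler_pM (mulr_ge0 g0 h0) h0 (ler_pM g0 h0 g h) h.
have k2 := ler_pM (mulr_ge0 h0 g0) h0 (ler_pM h0 g0 h g) h.
have k3 := ler_pM (mulr_ge0 h0 h0) g0 (ler_pM h0 h0 h h) g.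
apply: le_trans (lerD (lerD (le_trans (tb _ _ _) k1) (le_trans (tb _ _ _) k2)) (le_trans (tb _ _ _) k3)) _.
by apply: le_of_eq; ring.
Qed.

(* For k < 0 the k-th mode of the Szego solution vanishes while T_k(v)
   oscillates like e^{-ikt}: this solves i c' = |k| c + T_k(v) up to O(e^5). *)
Definition corrector (t : R) (k : int) : C :=
  if k is Negz j then - (2 * j.+1%:R)^-1%:C * T (v t) k else 0.
Definition corrected (t : R) (k : int) : C := v t k + corrector t k.

Let inv_half (j : nat) : 0 <= (2 * j.+1%:R : R)^-1 <= 1 / 2.
Proof.
have h : 1 <= j.+1%:R :> R by rewrite ler1n.
rewrite invr_ge0 mulr_ge0//= mul1r lef_pV2 ?posrE//; lra.
Qed.

Lemma NW_corrector t : NW w V (corrector t) <= 108 * e ^+ 3.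
Proof.
apply: (@le_trans _ _ (1 / 2 * NW w V (T (v t)))); last by have := NW_tri_szv t; lra.
rewrite /NW big_distrr; apply: ler_sum => k _ /=; rewrite mulrCA; apply: ler_wpM2l => //.
rewrite /corrector; case: k => j; first by rewrite nm0 mulr_ge0 ?nm_ge0// divr_ge0.
have /andP[h1 h2] := inv_half j.
by rewrite mulNr nmN nmM nm_real ger0_norm// ler_wpM2r ?nm_ge0.
Qed.

Lemma cder_corrector t (j : nat) : is_cderive (corrector^~ (Negz j)) t
  (- ('i%C * (lam R (Negz j))%:C * corrector t (Negz j)) - 'i%C * T (v t) (Negz j)
   + 'i%C * ((2 * j.+1%:R)^-1%:C * quad_forcing t (Negz j))).
Proof.
apply: cder_eq (cderZ _ (cder_tri_transport V (Negz j) (cder_szv_all t))).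
rewrite -/(quad_forcing t (Negz j)) /corrector; set T0 := T (v t) _; set Q := quad_forcing _ _.
have -> : (lam R (Negz j))%:C = j.+1%:R :> C by exact: (rmorph_nat (real_complex R)).
have -> : ((Negz j)%:~R : R)%:C = - j.+1%:R :> C.
  by rewrite NegzE rmorphN /= -[RHS]opprK; congr (- _); rewrite opprK; exact: (rmorph_nat (real_complex R)).
have -> : ((2 * j.+1%:R)^-1)%:C = (2 * j.+1%:R)^-1 :> C.
  by rewrite -natrM fmorphV; congr (_^-1); rewrite -natrM; exact: (rmorph_nat (real_complex R)).
have hj : j.+1%:R != 0 :> C by rewrite pnatr_eq0.
by field.
Qed.

(** The defect of the corrected profile: truncation error for k >= 0, derivative of the corrector
    beyond its rotation for k < 0. *)
Definition residual (t : R) (k : int) : C :=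
  match k with
  | Posz _ => T (v t) k - n t k
  | Negz j => (2 * j.+1%:R)^-1%:C * quad_forcing t k
  end.

Lemma NW_residual t : NW w V (residual t) <= 11719 * e ^+ 5.
Proof.
apply: (@le_trans _ _ (\sum_(k <- V) w k * (e ^+ 3 * (tail_cst * (sg ^+ 4) ^+ N)) +
    1 / 2 * NW w V (quad_forcing t))); last by have := NW_quad_forcing t; have := ksum; lra.
rewrite /NW big_distrr -big_split; apply: ler_sum => k _ /=.
rewrite [1 / 2 * _]mulrCA -mulrDr; apply: ler_wpM2l => //.
case: k => j.
  apply: le_trans (forcing_close N t j) _; rewrite lerDl mulr_ge0 ?nm_ge0//.
have /andP[h1 h2] := inv_half j.
apply: (@le_trans _ _ (1 / 2 * nm (quad_forcing t (Negz j)))).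
  by rewrite nmM nm_real ger0_norm// ler_wpM2r ?nm_ge0.
by rewrite lerDr; apply: mulr_ge0 => //; apply: mulr_ge0 => //; exact: exprn_ge0.
Qed.

Variables (u : R -> int -> C) (tau : R).
Hypotheses (hu : galerkin N u) (hu0 : u 0 = v 0) (ht : 160 * e ^+ 2 * expR (384 * e ^+ 2 * tau) <= 1)
  (tau0 : 0 <= tau).

Let rate0 : 0 <= 384 * e ^+ 2. Proof. exact: mulr_ge0 (ler0n _ _) (sqr_ge0 _). Qed.
Let amp0 : 0 <= 160 * e ^+ 2. Proof. exact: mulr_ge0 (ler0n _ _) (sqr_ge0 _). Qed.

Let expR_ge1 t : 0 <= t -> 1 <= expR (384 * e ^+ 2 * t).
Proof. by move=> t0; rewrite -[leLHS]expR0 ler_expR; exact: mulr_ge0 rate0 t0. Qed.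

Let e2 : 160 * e ^+ 2 <= 1.
Proof.
by apply: le_trans ht; rewrite -[leLHS]mulr1; exact: (ler_wpM2l amp0 (expR_ge1 tau0)).
Qed.

Let e3 : 108 * e ^+ 3 <= e.
Proof.
have -> : 108 * e ^+ 3 = 108 * e ^+ 2 * e by ring.
rewrite -[leRHS]mul1r; apply: ler_wpM2r; first exact: ltW.
by have := sqr_ge0 e; have := e2; lra.
Qed.

(** The rate is twice 192 = 3 * 8^2, the Lipschitz constant at size 8 e. The second half absorbs the
    sources: (15876 + 11719) e^5 <= 192 e^2 * 160 e^3. Also 160 exceeds the 108 of the initial
    corrector. *)
Definition error_bound (t : R) : R := 160 * e ^+ 3 * expR (384 * e ^+ 2 * t).

Let amp3 : 0 <= 160 * e ^+ 3. Proof. exact: mulr_ge0 (ler0n _ _) e30. Qed.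

Let error_mono s t : s <= t -> error_bound s <= error_bound t.
Proof.
move=> st; apply: (ler_wpM2l amp3); rewrite ler_expR; exact: (ler_wpM2l rate0 st).
Qed.

Let error_max : error_bound tau <= e.
Proof.
have := ler_wpM2l (ltW e0) ht; rewrite mulr1; apply: le_trans.
by apply: le_of_eq; rewrite /error_bound; ring.
Qed.

Let error_ge t : 0 <= t -> 160 * e ^+ 3 <= error_bound t.
Proof. by move=> t0; rewrite -[leLHS]mulr1; exact: (ler_wpM2l amp3 (expR_ge1 t0)). Qed.

(** While the error is below its bound, hence below e, the corrected profile has norm at most 7 e
    and the solution at most 8 e. This closes the estimate in [comparison_abs]. *)
Lemma galerkin_close t : `|t| <= tau ->
  NW w V (fun k => u t k - corrected t k) <= error_bound `|t|.
Proof.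
move=> tt; apply: ltW.
have [_ du] := hu.
apply: (comparison_abs (lam := lam R) (T := tau) (q := fun t k => u t k - corrected t k)
  (g := fun t k => - 'i%C * (((T (u t) k - T (corrected t) k) + (T (corrected t) k - T (v t) k)) + residual t k))
  (y := error_bound) (y' := fun t => 384 * e ^+ 2 * error_bound t)); last exact: tt.
- exact: w0.
- move=> s k _ kV; rewrite /corrected.
  have h := cderB (du s k kV) (cderD (cder_szv_all s k) _).
  case: k kV h => j kV h.
    apply: cder_eq (h _ _ (cder_cst _ _)); rewrite /corrector /residual.
    have -> : (lam R j)%:C = ((Posz j)%:~R)%:C by [].
    by ring.
  apply: cder_eq (h _ _ (cder_corrector s j)); rewrite /residual.
  have -> : ((Negz j)%:~R)%:C * v s (Negz j) = 0 :> C by rewrite szv_neg mulr0.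
  have -> : n s (Negz j) = 0 by [].
  by rewrite szv_neg; ring.
- by move=> s _; exact: cexpR_deriv.
- move=> s ss hq; rewrite -/(NW w V (fun k => u s k - corrected s k)) in hq.
  set y := error_bound `|s| in hq *.
  have ye : y <= e by exact: le_trans (error_mono ss) error_max.
  have hv := NW_szv N s; have hc := NW_corrector s.
  have ha : NW w V (corrected s) <= 7 * e.
    by apply: le_trans (NWD _ _ _ w0) _; have := e3; lra.
  have hub : NW w V (u s) <= 8 * e.
    have -> : NW w V (u s) = NW w V (fun k => corrected s k + (u s k - corrected s k)).
      by apply: eq_NW => k _; ring.
    by apply: le_trans (NWD _ _ _ w0) _; lra.
  have le78 : 7 * e <= 8 * e by have := e0; lra.
  have l1 := tri_lip w0 wM uV hub (le_trans ha le78).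
  have l2 := tri_lip w0 wM uV ha (le_trans hv _ : _ <= 7 * e).
  have {}l2 : NW w V (fun k => T (corrected s) k - T (v s) k) <= 15876 * e ^+ 5.
    apply: (le_trans (l2 _)); first by have := e0; lra.
    have -> : NW w V (fun k => corrected s k - v s k) = NW w V (corrector s).
      by apply: eq_NW => k _; rewrite /corrected; ring.
    have -> : 15876 * e ^+ 5 = 3 * (7 * e) ^+ 2 * (108 * e ^+ 3) by ring.
    by apply: ler_wpM2l => //; exact: mulr_ge0 (ler0n _ _) (sqr_ge0 _).
  have {}l1 : NW w V (fun k => T (u s) k - T (corrected s) k) <= 192 * e ^+ 2 * y.
    apply: le_trans l1 _; have -> : 192 * e ^+ 2 * y = 3 * (8 * e) ^+ 2 * y by ring.
    by apply: ler_wpM2l => //; exact: mulr_ge0 (ler0n _ _) (sqr_ge0 _).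
  rewrite -/(NW w V (fun k => - 'i%C * _)) NWZ nmN nm_i mul1r.
  apply: le_trans (NWD _ _ _ w0) _; apply: le_trans (lerD (NWD _ _ _ w0) (NW_residual s)) _.
  have yge : 160 * e ^+ 3 <= y by exact/error_ge/normr_ge0.
  have := ler_wpM2l (sqr_ge0 e) yge.
  have -> : e ^+ 2 * (160 * e ^+ 3) = 160 * e ^+ 5 by ring.
  have := exprn_ge0 5 (ltW e0).
  move: l1 l2; lra.
rewrite -/(NW w V (fun k => u 0 k - corrected 0 k)).
have -> : NW w V (fun k => u 0 k - corrected 0 k) = NW w V (fun k => - corrector 0 k).
  by apply: eq_NW => k _; rewrite hu0 /corrected; ring.
rewrite NWN; apply: le_lt_trans (NW_corrector 0) _; apply: lt_le_trans (error_ge (lexx _)).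
by have := exprn_gt0 3 e0; lra.
Qed.

Lemma galerkin_profile t : `|t| <= tau ->
  NW w V (fun k => u t k - v t k) <= error_bound tau + 108 * e ^+ 3.
Proof.
move=> tt.
have -> : NW w V (fun k => u t k - v t k) = NW w V (fun k => (u t k - corrected t k) + corrector t k).
  by apply: eq_NW => k _; rewrite /corrected; ring.
apply: le_trans (NWD _ _ _ w0) _; apply: lerD; last exact: NW_corrector.
exact: le_trans (galerkin_close tt) (error_mono tt).
Qed.

End Window.

End Profile.

(** * The profile at its peak time *)

Section Approximation.
Variables (R : realType) (e d sg tau : R).
Local Notation C := R[i].
Hypotheses (e0 : 0 < e) (e1 : e <= 1) (d0 : 0 < d) (d1 : d <= 1) (sg0 : 0 < sg) (sg1 : sg < 1)
  (hsg : sg ^+ 8 = 1 - szeta d) (tau0 : 0 <= tau)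
  (ht : 160 * e ^+ 2 * expR (384 * e ^+ 2 * tau) <= 1).

Definition datum (k : int) : C :=
  match k with Posz 0 => (e * d)%:C | Posz 1 => e%:C | _ => 0 end.

Lemma szv0 : szv e d 0 = datum.
Proof.
have S0 : szsin e d 0 = 0 by rewrite /szsin mulr0 sin0.
have C0 : szcos e d 0 = 1 by rewrite /szcos mulr0 cos0.
have P0 : szP e d 0 = 0 by rewrite /szP S0 mulr0 rmorph0 mulr0 oppr0 mulr0.
have F0 : szF e d 0 = 1 by rewrite /szF mulr0 expi0.
have G0 : szG e d 0 = 1 by rewrite /szG mulr0 expi0.
have b0 : szb e d 0 = d%:C by rewrite /szb S0 C0 F0 mulr1 mulr0 rmorph0 mulr0 subr0 mul1r.
have A0 : szA e d 0 = 1 by rewrite /szA P0 F0 G0 mulr0 addr0 mulr1.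
apply/funext => -[[|[|j]]|j]; rewrite /szv /ratc ?b0 ?A0 ?P0 /datum.
- by rewrite rmorphM.
- by rewrite expr0 !mulr1.
- by rewrite exprS mul0r !mulr0.
- by rewrite mulr0.
Qed.

Lemma datum_supp k : k \notin win 1 -> datum k = 0.
Proof. by rewrite mem_win; case: k => [[|[|j]]|j]. Qed.

Lemma tail_cvg0 : (fun N : nat => tail_cst sg * (2 * N%:R + 1) * sg ^+ (3 * N)) @ \oo --> (0 : R).
Proof.
have s3 : 0 <= sg ^+ 3 < 1.
  by rewrite exprn_ge0 ?(ltW sg0)//= exprn_ilt1// ltW.
have /andP[s30 s31] := s3.
have h : (fun N => 2 * tail_cst sg * (N%:R * (sg ^+ 3) ^+ N) + tail_cst sg * (sg ^+ 3) ^+ N) @ \oo --> (0 + 0 : R).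
  by apply: cvgD; [exact/cvg0Z/natmul_expr_cvg0|exact: cvg0_geom].
rewrite addr0 in h.
by apply: cvg_trans h; apply: near_eq_cvg; near=> N; rewrite exprM; ring.
Unshelve. all: by end_near. Qed.

(** The bound of [galerkin_profile] is independent of the window, and its condition on the tail
    holds for all large windows. A single term of the weighted sum gives the factor sg^|k|. *)
Lemma solution_near_profile : exists U : R -> R -> C,
  half_wave_solution (trig (win 1) datum) U /\
  forall t k, `|t| <= tau ->
    nm (fourier (U t) k - szv e d t k) <=
    (160 * e ^+ 3 * expR (384 * e ^+ 2 * tau) + 108 * e ^+ 3) * sg ^+ `|k|%N.
Proof.
have [u [Y [K hu]]] := galerkin_family_exists datum_supp.
have [U hU] := galerkin_function_limit hu.
exists U; split; first exact (limit_solution hu hU).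
move=> t k tt.
have hc : ccvg (fun n => u n t k - szv e d t k) (fourier (U t) k - szv e d t k).
  by apply: ccvgB; [exact (galerkin_fourier_limit hu hU t k)|exact: ccvg_cst].
apply: nm_ccvg_le hc _.
have hN : \forall n \near \oo, tail_cst sg * (2 * (n + 1)%:R + 1) * sg ^+ (3 * (n + 1)) <= e ^+ 2.
  have e2 : 0 < e ^+ 2 by exact: exprn_gt0.
  have /cvgrPdist_le/(_ _ e2) [p _ hp] := tail_cvg0.
  exists p => // n /= pn; have := hp (n + 1)%N (leq_trans pn (leq_addr _ _)).
  by rewrite /= sub0r normrN; apply: le_trans; exact: ler_norm.
have hk : \forall n \near \oo, (`|k| <= n + 1)%N.
  by exists `|k|%N => // n /= h; exact: leq_trans h (leq_addr _ _).
near=> n.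
have h1 : tail_cst sg * (2 * (n + 1)%:R + 1) * sg ^+ (3 * (n + 1)) <= e ^+ 2 by near: n.
have h2 : k \in win (n + 1) by rewrite mem_win; near: n.
have [hg hi _ _ _] := hu.
have hi0 : u n 0 = szv e d 0 by rewrite szv0.
have h := galerkin_profile e0 d0 d1 sg0 sg1 hsg h1 e1 (hg n) hi0 ht tau0 tt.
have := le_trans (NW_term (fun k => u n t k - szv e d t k) (expw_ge0 sg0 sg1) h2) h.
by rewrite /expw exprVn -ler_pdivlMl ?invr_gt0 ?exprn_gt0// invrK mulrC.
Unshelve. all: by end_near. Qed.

End Approximation.

Section PeakTime.
Variables (R : realType) (e d sg : R).
Local Notation C := R[i].
Hypotheses (e0 : 0 < e) (d0 : 0 < d) (d1 : d <= 1) (sg0 : 0 < sg) (sg1 : sg < 1)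
  (hsg : sg ^+ 8 = 1 - szeta d).

Lemma szom_ge : d <= szom d.
Proof.
have h : 2 <= szh d.
  by rewrite -(@ler_pXn2r _ 2) ?nnegrE ?(ltW (szh_gt0 d0))// szh2; have := sqr_ge0 d; lra.
by rewrite /szom ler_pdivlMr//; apply: ler_wpM2l h; exact: ltW.
Qed.

(** A quarter period of the rotation: the first positive time at which szsin is 1. *)
Definition peak_time : R := pi / 2 / (szom d * e ^+ 2).

Let den_gt0 : 0 < szom d * e ^+ 2.
Proof. by rewrite mulr_gt0 ?exprn_gt0// (lt_le_trans d0 szom_ge). Qed.

Lemma peak_time_gt0 : 0 < peak_time.
Proof. by apply: divr_gt0 den_gt0; apply: divr_gt0 => //; exact: pi_gt0. Qed.

Lemma peak_time_le : e ^+ 2 * peak_time <= 2 / d.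
Proof.
have h : szom d != 0 by rewrite gt_eqF// (lt_le_trans d0 szom_ge).
have -> : e ^+ 2 * peak_time = pi / 2 / szom d.
  by rewrite /peak_time; field; rewrite h gt_eqF.
apply: ler_pM; [exact/ltW/divr_gt0/ltr0n/pi_gt0| |exact/ltW/pihalf_lt2|].
  by rewrite invr_ge0 ltW// (lt_le_trans d0 szom_ge).
by rewrite lef_pV2 ?posrE ?szom_ge// (lt_le_trans d0 szom_ge).
Qed.

Let sin1 : szsin e d peak_time = 1.
Proof. by rewrite /szsin /peak_time mulrC divfK ?sin_pihalf// gt_eqF. Qed.

Let r1 : szr e d peak_time = 1 - szeta d.
Proof. by rewrite szrE// sin1 expr1n mulr1. Qed.

Lemma nm_szP_peak : nm (szP e d peak_time) = sg ^+ 4.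
Proof.
have s4 := exprn_ge0 4 (ltW sg0).
by apply/eqP; rewrite -(@eqrXn2 _ 2)// ?nm_ge0// nm_szP2// r1 -exprM hsg.
Qed.

Lemma nm_szv_peak (j : nat) : nm (szv e d peak_time (Posz j.+1)) = e * szeta d * sg ^+ (4 * j).
Proof.
rewrite /szv /ratc !nmM nm_real gtr0_norm// nmX nm_szP_peak nm_szA// r1 -exprM mulrA.
by congr (_ * _ * _); ring.
Qed.

Lemma nm_szv0_le t : nm (szv e d t 0) <= 2 * e.
Proof.
rewrite /szv /ratc nmM nm_real gtr0_norm// mulrC; apply: ler_wpM2r; first exact: ltW.
exact: nm_szb.
Qed.

Let eta0 := szeta_gt0 d0.

(** Bernoulli's inequality for sg^4, with 1 - sg^4 <= 1 - sg^8 = szeta d. *)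
Lemma sg_pow_ge (j : nat) : j%:R * szeta d <= 1 / 2 -> 1 / 2 <= sg ^+ (4 * j).
Proof.
move=> hj; rewrite exprM.
have s40 := exprn_ge0 4 (ltW sg0).
have h4 : 1 - sg ^+ 4 <= szeta d.
  have : sg ^+ 8 <= sg ^+ 4 by apply: ler_wiXn2l => //; exact: ltW.
  by rewrite hsg; lra.
have s41 : sg ^+ 4 <= 1 by rewrite exprn_ile1// ltW.
have bern (i : nat) : 1 - i%:R * (1 - sg ^+ 4) <= (sg ^+ 4) ^+ i.
  elim: i => [|i IH]; first by rewrite expr0 mul0r subr0.
  set x := sg ^+ 4 in s40 s41 IH *; rewrite -natr1 [x ^+ i.+1]exprS.
  have p1 : 0 <= i%:R * (1 - x) ^+ 2 by apply: mulr_ge0; [exact: ler0n|exact: sqr_ge0].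
  have := ler_wpM2l s40 IH; rewrite expr2 in p1; lra.
apply: le_trans (bern j).
by have := ler_wpM2l (ler0n _ j : 0 <= j%:R :> R) h4; lra.
Qed.

Variables (c : int -> C) (E : R).
Hypotheses (hE : E <= e * szeta d / 4)
  (hc : forall k, nm (c k - szv e d peak_time k) <= E * sg ^+ `|k|%N).

Let E0 : 0 <= E.
Proof. by have := hc 0; rewrite expr0 mulr1; apply: le_trans; exact: nm_ge0. Qed.

Let ee : 0 <= e * szeta d. Proof. exact: mulr_ge0 (ltW e0) (ltW eta0). Qed.

(** The profile contributes at least half of e szeta, the error takes away at most a quarter. *)
Lemma peak_lower (j : nat) : j%:R * szeta d <= 1 / 2 -> e * szeta d / 4 <= nm (c (Posz j.+1)).
Proof.
move=> hj; have h := ler_wpM2l ee (sg_pow_ge hj).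
have := nm_lerB (szv e d peak_time (Posz j.+1)) (c (Posz j.+1)).
rewrite nm_distC nm_szv_peak => h2.
have h3 : E * sg ^+ `|Posz j.+1|%N <= E.
  by rewrite -[leRHS]mulr1; apply: ler_wpM2l => //; rewrite exprn_ile1// ltW.
by have := hc (Posz j.+1); have := hE; lra.
Qed.

Let c_le k : nm (c k) <= nm (szv e d peak_time k) + E * sg ^+ `|k|%N.
Proof. by have := nm_lerB (c k) (szv e d peak_time k); have := hc k; lra. Qed.

Lemma peak_upper0 : nm (c 0) <= 3 * e.
Proof.
apply: le_trans (c_le 0) _; rewrite expr0 mulr1; have := nm_szv0_le peak_time.
have h : e * szeta d <= e by rewrite -[leRHS]mulr1; apply: ler_wpM2l; [exact: ltW|exact/ltW/szeta_lt1].
have := e0; have := hE; lra.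
Qed.

Lemma peak_upper k : k != 0 -> nm (c k) <= 3 * (e * szeta d) * sg ^+ `|k|%N.
Proof.
move=> k0; apply: le_trans (c_le k) _.
have sk := exprn_ge0 `|k|%N (ltW sg0).
have h1 : E * sg ^+ `|k|%N <= e * szeta d * sg ^+ `|k|%N.
  by apply: ler_wpM2r => //; have := hE; have := ee; lra.
suff h2 : nm (szv e d peak_time k) <= 2 * (e * szeta d) * sg ^+ `|k|%N.
  by apply: le_trans (lerD h2 h1) _; rewrite -mulrDl; apply: ler_wpM2r => //; have := ee; lra.
case: k k0 sk {h1} => [[|j]|j] // _ sk; last first.
  by rewrite szv_neg nm0; apply: mulr_ge0 => //; exact: mulr_ge0 (ler0n _ _) ee.
rewrite nm_szv_peak [2 * _]mulrC -[leRHS]mulrA; apply: ler_wpM2l; first exact: ee.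
(* From j to the frequency j + 1 one factor sg is lost; as sg >= 4/5, the constant 2 pays for it. *)
apply: (@le_trans _ _ (sg ^+ j)); first by apply: (ler_wiXn2l (ltW sg0) (ltW sg1)); exact: leq_pmull.
rewrite absz_nat exprS mulrA -[leLHS]mul1r; apply: ler_wpM2r; first exact/exprn_ge0/ltW.
by have := sg_ge d0 d1 sg0 sg1 hsg; lra.
Qed.

End PeakTime.

(** * Sobolev norms near the peak *)

Section SobolevBounds.
Variables (R : realType) (s eta sg : R).
Local Notation C := R[i].
Hypotheses (s0 : 0 < s) (eta0 : 0 < eta) (eta1 : eta <= 1) (sg0 : 0 < sg) (sg1 : sg < 1)
  (hsg : sg ^+ 8 = 1 - eta).

Lemma sg_pow_le (k : nat) : sg ^+ k <= expR (- (eta * k%:R / 8)).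
Proof.
have h : sg <= expR (- (eta / 8)).
  rewrite -(@ler_pXn2r _ 8) ?nnegrE ?expR_ge0 ?(ltW sg0)// hsg -expRM_natr.
  apply: le_trans (expR_ge1Dx _) _; rewrite ler_expR; apply: le_of_eq.
  by field.
have -> : - (eta * k%:R / 8) = - (eta / 8) * k%:R by ring.
rewrite expRM_natr; case: k => [|k]; first by rewrite !expr0.
by rewrite ler_pXn2r ?nnegrE ?expR_ge0 ?(ltW sg0).
Qed.

Definition peak_cst : R := expR 1 * (16 * s) `^ (2 * s).

Lemma bracket_sq (k : nat) : ((1 + k%:R) ^+ 2) `^ s = (1 + k%:R : R) `^ (2 * s).
Proof. by rewrite powRrM -(@powR_mulrn _ _ 2)// addr_ge0. Qed.

(** Take y <= exp y at y = x / (2 s), where x = eta (1 + k) / 8, and raise to the power 2 s. The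
    exponentials then combine to exp (eta / 8) <= exp 1, the first factor of [peak_cst]. *)
Lemma bracket_exp_le (k : nat) :
  (1 + k%:R ^+ 2) `^ s * expR (- (eta * k%:R / 8)) <= peak_cst * eta `^ (- (2 * s)).
Proof.
have k0 : 0 <= k%:R :> R by exact: ler0n.
have s20 : 0 < 2 * s by rewrite mulr_gt0.
have e1 : eta != 0 by rewrite gt_eqF.
have e2 : s != 0 by rewrite gt_eqF.
pose x := eta * (1 + k%:R) / 8.
have x0 : 0 <= x by rewrite divr_ge0// mulr_ge0 ?addr_ge0// ltW.
have h1 : (1 + k%:R ^+ 2) `^ s <= (1 + k%:R : R) `^ (2 * s).
  rewrite -bracket_sq; apply: ge0_ler_powR; rewrite ?nnegrE ?addr_ge0 ?sqr_ge0 ?(ltW s0)//.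
  have -> : (1 + k%:R) ^+ 2 = 1 + k%:R ^+ 2 + 2 * k%:R :> R by ring.
  by rewrite lerDl mulr_ge0.
have h2 : 1 + k%:R <= 16 * s / eta * expR (x / (2 * s)).
  have -> : 1 + k%:R = 16 * s / eta * (x / (2 * s)) by rewrite /x; field; rewrite e1 e2.
  apply: ler_wpM2l; first by rewrite divr_ge0 ?(ltW eta0)// mulr_ge0// ltW.
  by have := expR_ge1Dx (x / (2 * s)); lra.
have h3 : (1 + k%:R) `^ (2 * s) <= (16 * s) `^ (2 * s) * eta `^ (- (2 * s)) * expR x.
  have -> : (16 * s) `^ (2 * s) * eta `^ (- (2 * s)) * expR x = (16 * s / eta * expR (x / (2 * s))) `^ (2 * s).
    rewrite !powRM ?expR_ge0 ?mulr_ge0 ?invr_ge0 ?(ltW s0) ?(ltW eta0)//.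
    rewrite -expRM divfK ?gt_eqF//; congr (_ * _ * _).
    by rewrite -(powR_inv1 (ltW eta0)) -powRrM mulN1r.
  apply: ge0_ler_powR; rewrite ?nnegrE ?addr_ge0 ?(ltW s20)//.
  by rewrite mulr_ge0 ?expR_ge0// divr_ge0 ?(ltW eta0)// mulr_ge0// ltW.
apply: le_trans (ler_wpM2r (expR_ge0 _) (le_trans h1 h3)) _.
rewrite -[leLHS]mulrA -expRD /peak_cst.
have -> : x - eta * k%:R / 8 = eta / 8 by rewrite /x; ring.
have h4 : expR (eta / 8) <= expR 1 by rewrite ler_expR; have := eta0; have := eta1; lra.
rewrite [leLHS]mulrC -[leRHS]mulrA; apply: ler_wpM2r => //.
by rewrite mulr_ge0 ?powR_ge0.
Qed.

(** Three applications of 1 - x^2 <= 2 (1 - x) give eta = 1 - sg^8 <= 8 (1 - sg). *)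
Lemma sum_sg_pow N : \sum_(j < N) sg ^+ j.+1 <= 8 / eta.
Proof.
have h : eta <= 8 * (1 - sg).
  have sq (x : R) : 0 <= x -> x <= 1 -> 1 - x ^+ 2 <= 2 * (1 - x).
    by move=> x0 x1; have := sqr_ge0 (1 - x); rewrite expr2; lra.
  have a1 := sq sg (ltW sg0) (ltW sg1).
  have a2 := sq (sg ^+ 2) (exprn_ge0 _ (ltW sg0)) (exprn_ile1 _ (ltW sg0) (ltW sg1)).
  have a3 := sq (sg ^+ 4) (exprn_ge0 _ (ltW sg0)) (exprn_ile1 _ (ltW sg0) (ltW sg1)).
  rewrite -!exprM in a2 a3; rewrite hsg in a3; lra.
apply: (@le_trans _ _ (\sum_(j < N) sg ^+ j)).
  by apply: ler_sum => j _; apply: (ler_wiXn2l (ltW sg0) (ltW sg1)).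
apply: le_trans (sum_geom_le N (ltW sg0) sg1) _.
rewrite -[leLHS]mul1r ler_pdivrMr ?subr_gt0// mulrAC ler_pdivlMr// mul1r; exact: h.
Qed.

(** Of the two factors sg^|k| in |c_k|^2, one beats the polynomial weight and the other is summed to
    8 / eta. The mean mode fits under the same bound because eta^{1 - 2 s} >= 1. *)
Lemma wsq_upper (c : int -> C) (e : R) N : 0 <= e -> 1 <= 2 * s ->
  nm (c 0) <= 3 * e -> (forall k, k != 0 -> nm (c k) <= 3 * (e * eta) * sg ^+ `|k|%N) ->
  wsq s (win N) c <= e ^+ 2 * (9 + 144 * peak_cst) * eta `^ (1 - 2 * s).
Proof.
move=> e0 hs h0 hk.
have M0 : 0 <= 3 * (e * eta) by rewrite mulr_ge0// mulr_ge0// ltW.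
have pc0 : 0 <= peak_cst by rewrite mulr_ge0 ?expR_ge0 ?powR_ge0.
have ht (j : nat) k : `|k|%N = j.+1 -> (1 + k%:~R ^+ 2) `^ s * nm (c k) ^+ 2 <=
    9 * (e * eta) ^+ 2 * (peak_cst * eta `^ (- (2 * s))) * sg ^+ j.+1.
  move=> kj; have k0 : k != 0 by apply/eqP => k0; rewrite k0 in kj.
  have -> : k%:~R ^+ 2 = j.+1%:R ^+ 2 :> R.
    by rewrite -kj natr_absz intr_norm real_normK ?num_real.
  have h1 : nm (c k) ^+ 2 <= (3 * (e * eta) * sg ^+ j.+1) ^+ 2.
    rewrite ler_pXn2r ?nnegrE ?nm_ge0 ?mulr_ge0 ?exprn_ge0 ?(ltW sg0) ?(ltW eta0)//.
    by rewrite -kj; exact: hk.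
  apply: le_trans (ler_wpM2l (powR_ge0 _ _) h1) _.
  have -> : (1 + j.+1%:R ^+ 2) `^ s * (3 * (e * eta) * sg ^+ j.+1) ^+ 2 =
    9 * (e * eta) ^+ 2 * ((1 + j.+1%:R ^+ 2) `^ s * sg ^+ j.+1) * sg ^+ j.+1 by ring.
  apply: ler_wpM2r; first exact/exprn_ge0/ltW.
  apply: ler_wpM2l; first by rewrite mulr_ge0// sqr_ge0.
  apply: le_trans _ (bracket_exp_le j.+1); apply: ler_wpM2l; [exact: powR_ge0|exact: sg_pow_le].
have eb : eta `^ (1 - 2 * s) = eta * eta `^ (- (2 * s)).
  by rewrite powRD ?powRr1 ?(ltW eta0)// (gt_eqF eta0) implybT.
have eb1 : 1 <= eta `^ (1 - 2 * s).
  rewrite -opprB powRN invf_ge1 ?powR_gt0//.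
  have := @ge0_ler_powR R (2 * s - 1) _ eta 1; rewrite powR1; apply; rewrite ?nnegrE ?subr_ge0 ?(ltW eta0)//.
rewrite /wsq sum_win; set K := 9 * (e * eta) ^+ 2 * (peak_cst * eta `^ (- (2 * s))) in ht.
have t0 : (1 + 0%:~R ^+ 2) `^ s * nm (c 0) ^+ 2 <= 9 * e ^+ 2.
  rewrite expr0n addr0 powR1 mul1r; have -> : 9 * e ^+ 2 = (3 * e) ^+ 2 by ring.
  by rewrite ler_pXn2r ?nnegrE ?nm_ge0 ?mulr_ge0.
have K0 : 0 <= K.
  apply: mulr_ge0; last exact: mulr_ge0 pc0 (powR_ge0 _ _).
  exact: mulr_ge0 (ler0n _ _) (sqr_ge0 _).
have t1 : \sum_(j < N) ((1 + (Posz j.+1)%:~R ^+ 2) `^ s * nm (c (Posz j.+1)) ^+ 2 +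
    (1 + (- Posz j.+1)%:~R ^+ 2) `^ s * nm (c (- Posz j.+1)) ^+ 2) <= 2 * K * (8 / eta).
  apply: (@le_trans _ _ (2 * K * \sum_(j < N) sg ^+ j.+1)).
    rewrite big_distrr; apply: ler_sum => j _ /=; rewrite -mulrA mulr_natl mulr2n.
    by apply: lerD; apply: ht.
  by apply: ler_wpM2l (sum_sg_pow N); rewrite mulr_ge0.
apply: le_trans (lerD t0 t1) _.
have -> : 2 * K * (8 / eta) = 144 * e ^+ 2 * peak_cst * (eta * eta `^ (- (2 * s))).
  by rewrite /K; field; rewrite gt_eqF.
rewrite -eb; have := ler_wpM2l (sqr_ge0 e) eb1; lra.
Qed.

End SobolevBounds.

(** The m^2 modes from m^2 + 1 to 2 m^2 suffice: each has weight at least m^{4 s}. *)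
Lemma wsq_lower (R : realType) (s : R) (c : int -> R[i]) (b : R) (m : nat) : 0 < s -> 0 <= b ->
  (forall j : nat, (j <= 2 * m ^ 2)%N -> b <= nm (c (Posz j.+1))) ->
  m%:R ^+ 2 * (m%:R `^ (4 * s)) * b ^+ 2 <= wsq s [seq Posz j.+1 | j <- iota (m ^ 2) (m ^ 2)] c.
Proof.
move=> s0 b0 hb; rewrite /wsq big_map.
have -> : m%:R ^+ 2 * (m%:R `^ (4 * s)) * b ^+ 2 = \sum_(j <- iota (m ^ 2) (m ^ 2)) (m%:R `^ (4 * s) * b ^+ 2).
  by rewrite big_const_seq count_predT size_iota iter_addr addr0 -[RHS]mulr_natr natrX; ring.
rewrite big_seq [leRHS]big_seq; apply: ler_sum => j; rewrite mem_iota => /andP[j1 j2].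
apply: ler_pM; rewrite ?powR_ge0 ?sqr_ge0//.
  rewrite powRrM; have -> : m%:R `^ 4 = m%:R ^+ 4 :> R by exact: powR_mulrn (ler0n _ _).
  apply: ge0_ler_powR; rewrite ?nnegrE ?addr_ge0 ?sqr_ge0 ?exprn_ge0 ?(ltW s0)//.
  have h : m%:R ^+ 2 <= j.+1%:R :> R by rewrite -natrX ler_nat; exact: leq_trans j1 _.
  have h0 : 0 <= m%:R ^+ 2 :> R by exact: sqr_ge0.
  have := ler_pM h0 h0 h h; rewrite -exprD -expr2 => h4; apply: le_trans h4 _.
  by rewrite lerDr.
rewrite ler_pXn2r ?nnegrE ?nm_ge0//; apply: hb; lia.
Qed.

(** * Choice of the parameters *)

Section Datum.
Variables (R : realType) (e d : R).
Local Notation C := R[i].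
Hypotheses (e0 : 0 < e) (d0 : 0 < d).
Local Notation u0 := (trig (win 1) (datum e d)).

Lemma fourier_datum k : fourier u0 k = datum e d k.
Proof.
rewrite fourier_trig ?uniq_win//; case: ifPn => // kn; by rewrite datum_supp.
Qed.

Definition datum_norm (r : R) : R := e * Num.sqrt (2 `^ r + d ^+ 2).

Let rad_ge0 (r : R) : 0 <= 2 `^ r + d ^+ 2.
Proof. by rewrite addr_ge0 ?powR_ge0 ?sqr_ge0. Qed.

Let datum_norm_ge0 r : 0 <= datum_norm r.
Proof. by rewrite mulr_ge0 ?sqrtr_ge0// ltW. Qed.

Let datum_norm_sq r : datum_norm r ^+ 2 = e ^+ 2 * (2 `^ r + d ^+ 2).
Proof. by rewrite exprMn sqr_sqrtr. Qed.

Let w0 r : (1 + (0 : int)%:~R ^+ 2) `^ r * nm (fourier u0 0) ^+ 2 = e ^+ 2 * d ^+ 2.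
Proof.
by rewrite expr0n addr0 powR1 mul1r fourier_datum nm_real real_normK ?num_real// exprMn.
Qed.

Let w1 r : (1 + (1 : int)%:~R ^+ 2) `^ r * nm (fourier u0 1) ^+ 2 = e ^+ 2 * 2 `^ r.
Proof. by rewrite expr1n fourier_datum nm_real real_normK ?num_real// mulrC. Qed.

Lemma Hnorm_datum r : Hnorm r u0 = (datum_norm r)%:E.
Proof.
apply/eqP; rewrite eq_le; apply/andP; split.
  apply: Hnorm_le => // N; apply: le_trans (wsq_sub r _ (uniq_win N) (uniq_win N.+1) (win_sub (leqnSn N))) _.
  rewrite /wsq sum_win big_ord_recl w0 big1.
    have -> : fourier u0 (- Posz (@ord0 N).+1) = 0 by rewrite fourier_datum.
    have -> : Posz (@ord0 N).+1 = 1 by [].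
    by rewrite w1 nm0 expr0n mulr0 !addr0 datum_norm_sq mulrDr addrC.
  move=> j _; rewrite !fourier_datum.
  have -> : datum e d (Posz (lift ord0 j).+1) = 0 by [].
  have -> : datum e d (- Posz (lift ord0 j).+1) = 0 by [].
  by rewrite nm0 expr0n !mulr0 addr0.
apply: (@Hnorm_ge _ _ _ _ [:: 0; 1]) => //.
by rewrite /wsq big_cons big_seq1 w0 w1 datum_norm_sq mulrDr addrC.
Qed.

Lemma datum_in_H r : in_H r u0.
Proof.
split; last by rewrite Hnorm_datum ltry.
by apply: torus_L2_cont; [exact: ccont_trig|exact: trig_periodic].
Qed.

Let ae_imp (P Q : R -> Prop) : (forall x, P x -> Q x) ->
  {ae (@lebesgue_measure R), forall x, P x} -> {ae (@lebesgue_measure R), forall x, Q x}.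
Proof. by move=> PQ; apply: (@filterS _ _ (ae_filter_ringOfSetsType (@lebesgue_measure R))). Qed.

(** A function vanishing almost everywhere has zero Fourier coefficients, while the coefficient of
    the datum at 1 is e. *)
Lemma datum_nonzero : ~ torus_ae_eq u0 (fun=> 0).
Proof.
move=> h.
have : fourier u0 1 = 0.
  have c : ccont (fun x => u0 x * expi (- ((1 : int)%:~R * x))).
    apply: ccontM; first exact: ccont_trig.
    under eq_fun do rewrite -mulNr; exact: ccont_expi.
  have [c1 c2] := c.
  rewrite /fourier /torus_integral.
  have aux (f : R -> R) : rcont f -> {ae (@lebesgue_measure R), forall x, f x = 0} ->
      \int[@lebesgue_measure R]_(x in `[0, pi *+ 2]) f x = 0.
    move=> cf hf; rewrite /Rintegral (ae_eq_integral (cst 0%E)) //.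
    - by rewrite integral0.
    - apply/measurable_realfun.measurable_EFinP; apply: measurable_funTS; exact: measurable_realfun.continuous_measurable_fun.
    - by apply: ae_imp hf => x hx _ /=; rewrite hx.
  rewrite !aux ?mulr0//.
  - by apply: ae_imp h => x hx; rewrite hx mul0r.
  - by apply: ae_imp h => x hx; rewrite hx mul0r.
rewrite fourier_datum /datum => -[he].
by move: e0; rewrite he ltxx.
Qed.

End Datum.

(** * Parameters as functions of m, and two-sided bounds at the peak *)

Section ParameterChoice.
Variables (R : realType) (m : R).
Hypothesis m1 : 1 <= m.
Local Notation C := R[i].

(* The Gronwall factor is at most exp (768 m); any rate larger than 384 in par_e
   beats it. *)
Definition par_d : R := m^-1.
Definition par_e : R := expR (- (500 * m)).
(** The eighth root of 1 - szeta, as an iterated square root. *)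
Definition par_sg : R := Num.sqrt (Num.sqrt (Num.sqrt (1 - szeta par_d))).
Local Notation d := par_d.
Local Notation e := par_e.
Local Notation sg := par_sg.
Local Notation eta := (szeta par_d).

Let m0 : 0 < m. Proof. exact: lt_le_trans m1. Qed.
Let msq : 1 <= m ^+ 2. Proof. exact: exprn_ege1. Qed.

Lemma par_d_gt0 : 0 < d. Proof. by rewrite invr_gt0. Qed.
Lemma par_d_le1 : d <= 1. Proof. by rewrite invf_le1. Qed.
Lemma par_e_gt0 : 0 < e. Proof. exact: expR_gt0. Qed.

Lemma par_eta : eta = (4 * m ^+ 2 + 1)^-1.
Proof.
have h : 4 * m ^+ 2 + 1 != 0 by rewrite gt_eqF//; have := msq; lra.
have hm : m != 0 by rewrite gt_eqF.
by rewrite /szeta /d; field; rewrite h hm.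
Qed.

Let eta0 : 0 < eta. Proof. exact: szeta_gt0 par_d_gt0. Qed.
Let eta1 : eta < 1. Proof. exact: szeta_lt1 par_d_gt0. Qed.

Let eta_ge : (5 * m ^+ 2)^-1 <= eta.
Proof.
by rewrite par_eta lef_pV2 ?posrE; have := msq; lra.
Qed.

Let sg0 : 0 < sg. Proof. by rewrite !sqrtr_gt0 subr_gt0. Qed.

Let sg8 : sg ^+ 8 = 1 - eta.
Proof.
have h : 0 <= 1 - eta by rewrite subr_ge0 ltW.
rewrite (_ : 8 = 2 * 2 * 2)%N// !exprM !sqr_sqrtr ?sqrtr_ge0//.
Qed.

Let sg1 : sg < 1.
Proof.
rewrite ltNge; apply/negP => h.
have h8 : 1 <= sg ^+ 8 by exact: exprn_ege1.
by rewrite sg8 in h8; have := eta0; lra.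
Qed.

Let tn : R := peak_time e d.
Definition par_err : R := 160 * e ^+ 3 * expR (384 * e ^+ 2 * tn) + 108 * e ^+ 3.

(** e^2 = exp (- 1000 m) times the Gronwall factor exp (768 m). *)
Let z : R := expR (- (232 * m)).
Let z0 : 0 < z. Proof. exact: expR_gt0. Qed.

(** 13456 = 116^2 and 232 = 2 * 116: this is the square of 116 m <= exp (116 m). *)
Let zm : 13456 * (m ^+ 2 * z) <= 1.
Proof.
have h : 116 * m <= expR (116 * m) by have := expR_ge1Dx (116 * m); lra.
have h0 : 0 <= 116 * m by have := m0; lra.
have h2 := ler_pM h0 h0 h h.
have hz : expR (116 * m) * expR (116 * m) * z = 1.
  rewrite /z -!expRD -[RHS]expR0; congr expR; ring.
rewrite -[leRHS]hz; have -> : 13456 * (m ^+ 2 * z) = 116 * m * (116 * m) * z by ring.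
by apply: ler_wpM2r h2; exact: ltW.
Qed.

Let e2z : e ^+ 2 <= z.
Proof.
rewrite /e -expRM_natl ler_expR; have := m0; lra.
Qed.

Let e2tn : 384 * e ^+ 2 * tn <= 768 * m.
Proof.
have := peak_time_le par_e_gt0 par_d_gt0; rewrite -/tn /d invrK => h.
have := ler_wpM2l (ler0n R 384) h; lra.
Qed.

Let e2X : e ^+ 2 * expR (384 * e ^+ 2 * tn) <= z.
Proof.
have aux (X : R) : X <= 768 * m -> e ^+ 2 * expR X <= z.
  by move=> hX; rewrite /e -expRM_natl -expRD ler_expR; lra.
exact: aux e2tn.
Qed.

Let par_time_small : 160 * e ^+ 2 * expR (384 * e ^+ 2 * tn) <= 1.
Proof.
have h := ler_wpM2l (ler0n R 160) e2X; rewrite mulrA in h; apply: le_trans h _.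
have := zm; have := ler_wpM2r (ltW z0) msq; rewrite mul1r; have := z0; lra.
Qed.

(** The error is at most 268 e z with 268 = 160 + 108, while eta >= 1 / (5 m^2); [zm] leaves room,
    as 20 * 268 < 13456. *)
Let par_err_le : par_err <= e * eta / 4.
Proof.
have -> : par_err = e * (160 * (e ^+ 2 * expR (384 * e ^+ 2 * tn)) + 108 * e ^+ 2).
  by rewrite /par_err; ring.
rewrite -[leRHS]mulrA; apply: (ler_wpM2l (ltW par_e_gt0)).
apply: (@le_trans _ _ (268 * z)); first by have := e2X; have := e2z; lra.
apply: (@le_trans _ _ ((5 * m ^+ 2)^-1 / 4)); last by have := eta_ge; lra.
rewrite -[(5 * m ^+ 2)^-1]mul1r -mulrA -invfM ler_pdivlMr; last by have := msq; lra.
have := zm; have := mulr_gt0 (lt_le_trans ltr01 msq) z0; lra.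
Qed.

Let e_le1 : e <= 1.
Proof. by rewrite /e -[leRHS]expR0 ler_expR; have := m0; lra. Qed.

Definition par_u0 : R -> C := trig (win 1) (datum e d).

Lemma par_solution : exists U : R -> R -> C, half_wave_solution par_u0 U /\
  forall k, nm (fourier (U tn) k - szv e d tn k) <= par_err * sg ^+ `|k|%N.
Proof.
have tn0 : 0 < tn := peak_time_gt0 par_e_gt0 par_d_gt0.
have [U [h1 h2]] := solution_near_profile par_e_gt0 e_le1 par_d_gt0 par_d_le1 sg0 sg1 sg8 (ltW tn0) par_time_small.
by exists U; split => // k; apply: h2; rewrite gtr0_norm.
Qed.

Variable (s : R).
Hypothesis hs : 1 < s.

(** The constant of [wsq_upper], with 1 / eta <= 5 m^2 turning eta^{1 - 2 s} into 5^{2 s - 1} times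
    the square of m^{2 s - 1}. *)
Definition upper_cst : R := Num.sqrt ((9 + 144 * peak_cst s) * 5 `^ (2 * s - 1)).

Let pw := m `^ (2 * s - 1).

Variable (U : R -> R -> C).
Hypothesis hU : forall k, nm (fourier (U tn) k - szv e d tn k) <= par_err * sg ^+ `|k|%N.

Lemma par_upper : (Hnorm s (U tn) <= (upper_cst * (e * pw))%:E)%E.
Proof.
have s0 : 0 < s by exact: lt_trans ltr01 hs.
have pc : 0 <= (9 + 144 * peak_cst s) * 5 `^ (2 * s - 1).
  apply: mulr_ge0 (powR_ge0 _ _); apply: addr_ge0 => //; apply: mulr_ge0 => //.
  by apply: mulr_ge0; [exact: expR_ge0|exact: powR_ge0].
apply: Hnorm_le => [|N].
  by apply: mulr_ge0 (sqrtr_ge0 _) _; apply: mulr_ge0; [exact/ltW/par_e_gt0|exact: powR_ge0].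
have h := wsq_upper s0 eta0 (ltW eta1) sg0 sg1 sg8 N (ltW par_e_gt0) _
  (peak_upper0 par_e_gt0 par_d_gt0 par_d_le1 par_err_le hU)
  (fun k => @peak_upper _ _ _ _ par_e_gt0 par_d_gt0 par_d_le1 sg0 sg1 sg8 _ _ par_err_le hU k).
apply: le_trans (h _) _; first by have := hs; lra.
rewrite exprMn sqr_sqrtr// exprMn.
have -> : (9 + 144 * peak_cst s) * 5 `^ (2 * s - 1) * (e ^+ 2 * pw ^+ 2) =
  e ^+ 2 * (9 + 144 * peak_cst s) * (5 `^ (2 * s - 1) * pw ^+ 2) by ring.
apply: ler_wpM2l.
  apply: mulr_ge0 (sqr_ge0 _) _; apply: addr_ge0 => //; apply: mulr_ge0 => //.
  by apply: mulr_ge0; [exact: expR_ge0|exact: powR_ge0].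
have -> : 5 `^ (2 * s - 1) * pw ^+ 2 = (5 * m ^+ 2) `^ (2 * s - 1).
  by rewrite powRM ?sqr_ge0// expr2 [m ^+ 2]expr2 powRM ?(ltW m0).
rewrite par_eta -[1 - 2 * s]opprB powRN -[(4 * _ + 1)^-1]powR_inv1; last by have := msq; lra.
rewrite -powRrM mulN1r powRN invrK.
by apply: ge0_ler_powR; rewrite ?nnegrE; have := msq; have := hs; lra.
Qed.

(** Modes with j <= 2 m^2 satisfy j eta <= 1/2, as 1 / eta = 4 m^2 + 1. The constant is 1/20 because
    (m^2 eta)^2 / 16 >= 1/400. *)
Lemma par_lower (n : nat) : m = n%:R -> ((e * pw / 20)%:E <= Hnorm s (U tn))%E.
Proof.
move=> mn; have s0 : 0 < s by exact: lt_trans ltr01 hs.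
have b0 : 0 <= e * eta / 4 by apply: divr_ge0 => //; apply: mulr_ge0; [exact/ltW/par_e_gt0|exact: ltW].
have hb (j : nat) : (j <= 2 * n ^ 2)%N -> e * eta / 4 <= nm (fourier (U tn) (Posz j.+1)).
  move=> hj; apply: (peak_lower par_e_gt0 par_d_gt0 sg0 sg1 sg8 par_err_le hU).
  have hj' : j%:R <= 2 * m ^+ 2 by rewrite mn -natrX -natrM ler_nat.
  rewrite par_eta ler_pdivrMr; have := msq; lra.
have h := wsq_lower s0 b0 hb; rewrite -mn in h.
apply: Hnorm_ge (le_trans _ h).
- rewrite map_inj_uniq ?iota_uniq// => i j [] //.
- by apply: divr_ge0 => //; apply: mulr_ge0; [exact/ltW/par_e_gt0|exact: powR_ge0].
have -> : m `^ (4 * s) = m ^+ 2 * pw ^+ 2.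
  rewrite -!powR_mulrn ?powR_ge0 ?(ltW m0)// -powRrM -powRD; last by rewrite (gt_eqF m0) implybT.
  by congr (_ `^ _); ring.
have -> : (e * pw / 20) ^+ 2 = (e * pw) ^+ 2 / 400 by field.
have -> : m ^+ 2 * (m ^+ 2 * pw ^+ 2) * (e * eta / 4) ^+ 2 = (e * pw) ^+ 2 * ((m ^+ 2 * eta) ^+ 2 / 16) by field.
apply: (ler_wpM2l (sqr_ge0 _)).
have hq : 1 / 5 <= m ^+ 2 * eta.
  have := ler_wpM2l (le_trans ler01 msq) eta_ge; apply: le_trans.
  by apply: le_of_eq; field; rewrite gt_eqF.
have q0 : 0 <= 1 / 5 :> R by rewrite divr_ge0.
have := ler_pM q0 q0 hq hq; rewrite -expr2; lra.
Qed.

End ParameterChoice.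

(** * From powers of m to powers of the logarithm of the datum *)

Theorem corollary1 (R : realType) (s : R) (hs : 1 < s) :
  exists (u0 : nat -> R -> R[i]) (tn : nat -> R) (u : nat -> R -> R -> R[i]),
    [/\ forall n, ~ torus_ae_eq (u0 n) (fun _ => 0) /\
                  (forall r : R, in_H r (u0 n)),
        forall n, 0 < tn n,
        forall r : R, Hnorm r (u0 n) @[n --> \oo] --> 0%E,
        forall n, half_wave_solution (u0 n) (u n) &
        exists A B : R,
          [/\ 0 < A, A <= B &
              \forall n \near \oo,
                let y := fine (Hnorm s (u0 n)) in
                let z := y * ln (1 / y) `^ (2 * s - 1) in
                ((A * z)%:E <= Hnorm s (u n (tn n)) <= (B * z)%:E)%E]].
Proof.
pose m (n : nat) : R := n.+1%:R.
have m1 n : 1 <= m n by rewrite ler1n.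
have m0 n : 0 < m n by exact: lt_le_trans (m1 n).
pose e n := par_e (m n); pose d n := par_d (m n).
have e0 n : 0 < e n by exact: par_e_gt0.
have d0 n : 0 < d n by exact: par_d_gt0.
have d1 n : d n ^+ 2 <= 1 by rewrite exprn_ile1 ?(ltW (d0 n)) ?par_d_le1.
have [u hu] := choice (fun n => par_solution (m1 n)).
exists (fun n => par_u0 (m n)), (fun n => peak_time (e n) (d n)), u; split.
- by move=> n; split=> [|r]; [exact: datum_nonzero (e0 n)|exact: datum_in_H (e0 n) _].
- by move=> n; exact: peak_time_gt0.
- move=> r.
  have -> : (fun n => Hnorm r (par_u0 (m n))) = (fun n => (datum_norm (e n) (d n) r)%:E).
    by apply/funext => n; exact: Hnorm_datum (d n) (e0 n) r.
  apply: cvg_EFin; first by near=> n.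
  (* For each r the norm of the datum is e times a bounded factor, and e <= 1 / (n + 1) follows from
     1 + x <= exp x. *)
  apply: (cvg0_le (b := fun n => Num.sqrt (2 `^ r + 1) / n.+1%:R)).
  + by move=> n; rewrite /= mulr_ge0 ?sqrtr_ge0 ?(ltW (e0 n)).
  + near=> n; rewrite /= /datum_norm mulrC; apply: ler_pM; rewrite ?sqrtr_ge0 ?(ltW (e0 n))//.
      by rewrite ler_wsqrtr// lerD2l.
    rewrite /e /par_e expRN lef_pV2 ?posrE ?expR_gt0//.
    apply: le_trans (expR_ge1Dx _); have := m0 n; rewrite /m; lra.
  exact: cvg_inv_nat.
- by move=> n; have [] := hu n.
pose p := 2 * s - 1; have p0 : 0 < p by rewrite /p; lra.
pose c1 : R := Num.sqrt (2 `^ s + 1); pose L := ln c1.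
pose ka n : R := Num.sqrt (2 `^ s + d n ^+ 2).
have two_s : 1 <= 2 `^ s :> R.
  have := @ge0_ler_powR R s _ 1 2; rewrite powR1; apply; rewrite ?nnegrE//; lra.
have c11 : 1 <= c1 by rewrite -sqrtr1 ler_wsqrtr//; lra.
have ka1 n : 1 <= ka n by rewrite -sqrtr1 ler_wsqrtr//; have := sqr_ge0 (d n); lra.
have kac n : ka n <= c1 by rewrite ler_wsqrtr// lerD2l.
(* K names the rate in [par_e]. With K >= 2, ln (1 / y) = K m - ln (ka n) lies between m and K m as
   soon as ln (ka n) <= m. *)
have [K K1 KE] : exists2 K : R, 2 <= K & 500 = K by exists 500; rewrite ?ler_nat.
have cp : 0 < K `^ p by apply: powR_gt0; exact: lt_le_trans K1.
(* The 1/20 of [par_lower] divided by the constant of the upper bound z <= c1 K^p e m^p. *)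
pose A : R := (20 * (c1 * K `^ p))^-1.
have A0 : 0 < A.
  by rewrite invr_gt0; apply: mulr_gt0 => //; apply: mulr_gt0 => //; exact: lt_le_trans c11.
have up0 : 0 <= upper_cst s by exact: sqrtr_ge0.
(* Adding A to the upper constant secures A <= B. *)
exists A, (upper_cst s + A); split => //; first by rewrite lerDr.
(* From here on m exceeds L, an upper bound of ln (ka n) for all n. *)
have hL : \forall n \near \oo, L <= m n.
  have [N hN] : exists N : nat, L <= N%:R.
    by exists (Num.Def.archi_bound `|L|); exact: le_trans (ler_norm _) (ltW (archi_boundP (normr_ge0 _))).
  exists N => // n /= Nn; apply: le_trans hN _; rewrite ler_nat; lia.
apply: filterS hL => n Ln /=; set y := fine _; set z := y * _.
have [_ hn] := hu n.
have yE : y = e n * ka n by rewrite /y (Hnorm_datum (d n) (e0 n) s).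
have lnE : ln (1 / y) = K * m n - ln (ka n).
  have k0 : 0 < ka n by exact: lt_le_trans (ka1 n).
  rewrite div1r yE lnV ?posrE ?mulr_gt0// lnM ?posrE// /e /par_e expRK -KE; ring.
have lk0 : 0 <= ln (ka n) by exact: ln_ge0.
have lkL : ln (ka n) <= L.
  by rewrite ler_ln ?posrE// (lt_le_trans ltr01).
have Km : 2 * m n <= K * m n by apply: ler_wpM2r K1; exact: ltW.
have mn0 := m0 n.
have pw0 : 0 <= m n `^ p by exact: powR_ge0.
have ln_lo : m n `^ p <= ln (1 / y) `^ p.
  by rewrite lnE; apply: ge0_ler_powR; rewrite ?nnegrE; lra.
have ln_hi : ln (1 / y) `^ p <= K `^ p * m n `^ p.
  have hK : 0 <= K by lra.
  rewrite -(powRM p hK (ltW mn0)) lnE; apply: ge0_ler_powR; rewrite ?nnegrE; lra.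
have zE : z = e n * ka n * ln (1 / y) `^ p by rewrite -yE.
have en0 := ltW (e0 n).
have z_lo : e n * m n `^ p <= z.
  rewrite zE -[e n * ka n * _]mulrA; apply: (ler_wpM2l en0); apply: le_trans ln_lo _.
  by rewrite -[leLHS]mul1r; apply: (ler_wpM2r (powR_ge0 _ _)); exact: ka1.
have z_hi : z <= c1 * K `^ p * (e n * m n `^ p).
  have -> : c1 * K `^ p * (e n * m n `^ p) = e n * (c1 * (K `^ p * m n `^ p)) by ring.
  rewrite zE -[e n * ka n * _]mulrA; apply: (ler_wpM2l en0).
  by apply: ler_pM (kac n) ln_hi; [exact: sqrtr_ge0|exact: powR_ge0].
have em0 : 0 <= e n * m n `^ p by exact: mulr_ge0.
apply/andP; split.
  apply: le_trans (par_lower (m1 n) hs hn (erefl _)); rewrite lee_fin.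
  have cancel_cst (a x : R) : 0 < a -> (20 * a)^-1 * (a * x) = x / 20.
    by move=> a0; field; rewrite gt_eqF.
  apply: le_trans (ler_wpM2l (ltW A0) z_hi) _; rewrite cancel_cst//.
  by apply: mulr_gt0 cp; exact: lt_le_trans c11.
apply: le_trans (par_upper (m1 n) hs hn) _; rewrite lee_fin.
have h1 := ler_wpM2l up0 z_lo; apply: le_trans h1 _.
rewrite mulrDl lerDl mulr_ge0 ?(ltW A0)//; exact: le_trans z_lo.
Unshelve. all: by end_near. Qed.
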